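(* Let $f:\mathbb{T}\to T^4$ be a ${\rm G}_2$-torus fibration, let $\mathbf{E}\to\mathbb{T}$ be the pullback by $f$ of an indecomposable vector bundle $E\to T^4$, and let $\varphi$ denote the ${\rm G}_2$-structure of $\mathbb{T}$. Let $\mathcal{M}^4_+$ be the moduli space of self-dual connections on $E\to T^4$, and for a ${\rm G}_2$-structure $\varphi'$ on $\mathbb{T}$ let $\mathcal{M}^7_{\varphi'}$ be the moduli space of ${\rm G}_2$-instantons on $\mathbf{E}$ relative to $\varphi'$. Then: (i) every self-dual connection on $E$ lifts to a ${\rm G}_2$-instanton on $\mathbf{E}$, i.e. $f^*\mathcal{M}^4_+\subset\mathcal{M}^7_\varphi$; (ii) if, moreover, $c_2(E)\neq0$, then any perturbation $\varphi+\phi$ away from the class of fibred structures (i.e. of type (IV)) causes the moduli space of ${\rm G}_2$-instantons to vanish, i.e. $\mathcal{M}^7_{\varphi+\phi}=\varnothing$.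
   Context: **${\rm G}_2$-structures.** A ${\rm G}_2$-structure on an oriented 7-manifold is a 3-form $\varphi$ which at every point has, in some coframe $e^1,\dots,e^7$, the form $$\varphi=e^{567}+\omega_1\wedge e^5+\omega_2\wedge e^6+\omega_3\wedge e^7,\quad \omega_1=e^{12}-e^{34},\ \omega_2=e^{13}-e^{42},\ \omega_3=e^{14}-e^{23}.$$ It determines a Riemannian metric (inner product), for which such coframes are orthonormal, and $$\ast_\varphi\varphi=e^{1234}-\omega_1\wedge e^{67}-\omega_2\wedge e^{75}-\omega_3\wedge e^{56}.$$ **${\rm G}_2$-instantons.** A connection $A$ is a ${\rm G}_2$-instanton relative to $\varphi$ if its curvature satisfies $F_A\wedge\ast_\varphi\varphi=0$. Bundles have compact structure group, and moduli spaces consist of gauge equivalence classes of solutions. **${\rm G}_2$-torus fibrations.** A ${\rm G}_2$-torus fibration structure is a triplet $(\eta,L,\alpha)$, where $\eta$ is a metric on $\mathbb{R}^4$; $L$ is a lattice on the space $\Lambda^2_+=\Lambda^2_+(\mathbb{R}^4,\eta)$ of $\eta$-self-dual 2-forms; and $\alpha:\mathbb{R}^4\to\Lambda^2_+$ is a linear map. Put $V=\mathbb{R}^4\oplus\Lambda^2_+$, $\tilde L=\{(\mu,\nu+\alpha\mu)\mid\mu\in\mathbb{Z}^4,\ \nu\in L\}\subset V$ and $\mathbb{T}=V/\tilde L$. The torus $\mathbb{T}$ inherits from $V$ the (constant, flat) ${\rm G}_2$-structure $\varphi$ which makes the generators of $\tilde L$ orthonormal with respect to the inner product induced by $\varphi$.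 The map $f:\mathbb{T}\to T^4=\mathbb{R}^4/\mathbb{Z}^4$ is the fibration induced by the projection $V\to\mathbb{R}^4$; it is an associative fibration, i.e. a Riemannian submersion onto the base whose fibres $P$ satisfy $\varphi|_P=\operatorname{dVol}|_P$. A connection on $E\to T^4$ is self-dual if its curvature is fixed by the Hodge star of the base metric. **Perturbations.** For a perturbation $\varphi\to\varphi+\phi$ of the ${\rm G}_2$-structure put $\xi_\phi:=\ast_{\varphi+\phi}(\varphi+\phi)-\ast_\varphi\varphi$. Such 4-forms decompose orthogonally according to $$\Lambda^4(\mathbb{R}^4\oplus\Lambda^2_+)=\underbrace{\Lambda^4(\mathbb{R}^4)}_{\rm (I)}\oplus\underbrace{\Lambda^3(\mathbb{R}^4)\otimes\Lambda^1(\Lambda^2_+)}_{\rm (II)}\oplus\underbrace{\Lambda^2(\mathbb{R}^4)\otimes\Lambda^2(\Lambda^2_+)}_{\rm (III)}\oplus\underbrace{\Lambda^1(\mathbb{R}^4)\otimes\Lambda^3(\Lambda^2_+)}_{\rm (IV)}.$$ Components (I)–(III) correspond to changes of the data $(\eta,L,\alpha)$, while (IV) parametrises deformations transverse to the fibred structures. Perturbations away from the class of fibred structures are those of type (IV), i.e. with $0\neq\xi_\phi\in\Lambda^1(\mathbb{R}^4)\otimes\Lambda^3(\Lambda^2_+)$. *)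

(* Defs.v *)
From HB Require Import structures.
From mathcomp Require Import all_boot all_order all_algebra all_fingroup.
From mathcomp Require Import all_classical all_reals all_analysis.
From mathcomp Require Import complex.

Set Implicit Arguments.
Unset Strict Implicit.
Unset Printing Implicit Defensive.

Import Order.TTheory GRing.Theory Num.Theory.
Import numFieldNormedType.Exports.
Local Open Scope classical_set_scope.
Local Open Scope ring_scope.
Local Open Scope complex_scope.

(* T-valued k-forms on W, as functions of k vectors.  Multilinearity and
   alternation are not part of the type: the real forms below are sums of
   exterior products of covectors, the matrix-valued ones are curvatures. *)
Notation kform k W T := (('I_k -> W) -> T).

Section Wedge.
Variable W : Type.

Definition shuffle k l (s : 'S_(k + l)) : bool :=
  [forall i : 'I_k, forall j : 'I_k,
     (i < j)%N ==> (s (lshift l i) < s (lshift l j))%N] &&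
  [forall i : 'I_l, forall j : 'I_l,
     (i < j)%N ==> (s (rshift k i) < s (rshift k j))%N].

(* Exterior product, the values being multiplied by mul:
   (e^1 /\ e^2)(v_1, v_2) = e^1(v_1) e^2(v_2) - e^1(v_2) e^2(v_1). *)
Definition wedge (A B : Type) (S : zmodType) (mul : A -> B -> S) k l
    (a : kform k W A) (b : kform l W B) : kform (k + l) W S := fun v =>
  \sum_(s : 'S_(k + l) | shuffle s)
     mul (a (fun i => v (s (lshift l i))))
         (b (fun j => v (s (rshift k j)))) *~ (-1) ^+ s.

End Wedge.

Section G2Linear.
Variables (R : realType) (W : vectType R).
Implicit Type e : 7.-tuple 'Hom(W, R^o).

Definition coframe e : Prop := basis_of fullv e.

(* e^{i_1 ... i_k}, with indices running from 1 to 7 *)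
Definition emon e (I : seq nat) : kform (size I) W R := fun v =>
  \det (\matrix_(a < size I, b < size I) (nth 0 e (nth 0%N I a).-1 (v b) : R)).
Arguments emon e I v : clear implicits.

Definition omega1 e : kform 2 W R := emon e [:: 1; 2]%N \- emon e [:: 3; 4]%N.
Definition omega2 e : kform 2 W R := emon e [:: 1; 3]%N \- emon e [:: 4; 2]%N.
Definition omega3 e : kform 2 W R := emon e [:: 1; 4]%N \- emon e [:: 2; 3]%N.

Definition g2_form e : kform 3 W R :=
  emon e [:: 5; 6; 7]%N
  \+ wedge *%R (omega1 e) (emon e [:: 5]%N)
  \+ wedge *%R (omega2 e) (emon e [:: 6]%N)
  \+ wedge *%R (omega3 e) (emon e [:: 7]%N).

Definition g2_dual_form e : kform 4 W R :=
  emon e [:: 1; 2; 3; 4]%N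
  \- wedge *%R (omega1 e) (emon e [:: 6; 7]%N)
  \- wedge *%R (omega2 e) (emon e [:: 7; 5]%N)
  \- wedge *%R (omega3 e) (emon e [:: 5; 6]%N).

Implicit Type phi : kform 3 W R.

Definition adapted phi e : Prop := coframe e /\ phi = g2_form e.

Definition g2_structure phi : Prop := exists e, adapted phi e.

(* The metric, the volume form and the 4-form * phi do not depend on the
   adapted coframe: two of them differ by an element of G2, a subgroup of
   SO(7) which also fixes * phi. *)
Definition g2_coframe phi : 7.-tuple 'Hom(W, R^o) :=
  xget [tuple 0 | _ < 7] [set e | adapted phi e].

Definition g2_metric phi (u v : W) : R :=
  \sum_(i < 7) tnth (g2_coframe phi) i u * tnth (g2_coframe phi) i v.

Definition g2_vol phi : kform 7 W R := fun v =>
  \det (\matrix_(a < 7, b < 7) (tnth (g2_coframe phi) a (v b) : R)).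

Definition g2_star phi : kform 4 W R := g2_dual_form (g2_coframe phi).

End G2Linear.

Section SelfDual.
Variable R : realType.
Implicit Types (eta w : 'M[R]_4).

Definition is_metric eta : Prop :=
  eta^T = eta /\ forall x : 'rV[R]_4, x != 0 -> 0 < (x *m eta *m x^T) 0 0.

Definition levi_civita (i j k l : 'I_4) : R :=
  \det (\matrix_(a < 4, b < 4) (tnth [tuple i; j; k; l] a == b)%:R).

(* Hodge star on 2-forms of (R^4, eta), with the standard orientation; a
   2-form is given by the matrix of its values on the standard basis. *)
Definition hodge eta w : 'M[R]_4 :=
  let up := invmx eta *m w *m (invmx eta)^T in
  \matrix_(k, l) (2^-1 * Num.sqrt (\det eta) *
                  \sum_i \sum_j levi_civita i j k l * up i j).

Fact hodge_is_linear eta : linear (hodge eta).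
Proof.
move=> c u v; apply/matrixP => k l; rewrite /hodge !mxE.
rewrite mulrCA -mulrDr; congr (_ * _).
rewrite mulr_sumr -big_split; apply: eq_bigr => i _ /=.
rewrite mulr_sumr -big_split; apply: eq_bigr => j _ /=.
rewrite mulmxDr mulmxDl -scalemxAr -scalemxAl !mxE mulrDr.
by rewrite mulrCA.
Qed.
HB.instance Definition _ eta :=
  GRing.isLinear.Build R 'M[R]_4 'M[R]_4 *:%R (hodge eta) (hodge_is_linear eta).

(* No skew-symmetry condition is needed: hodge eta w is skew for every w. *)
Definition sd2 eta : {vspace 'M[R]_4} := lker (linfun (hodge eta) - \1)%VF.

Lemma mem_sd2 eta w : (w \in sd2 eta) = (hodge eta w == w).
Proof. by rewrite memv_ker add_lfunE opp_lfunE id_lfunE lfunE subr_eq0. Qed.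

Lemma hodge_skew eta w : (hodge eta w)^T = - hodge eta w.
Proof.
apply/matrixP => l k; rewrite !mxE -mulrN; congr (_ * _).
rewrite -sumrN; apply: eq_bigr => i _; rewrite -sumrN; apply: eq_bigr => j _.
rewrite -mulNr; congr (_ * _); rewrite /levi_civita.
set M := \matrix_(a, b) _; set N := \matrix_(a, b) _.
suff -> : M = xrow (inord 2) (inord 3) N.
  by rewrite -[xrow _ _ _]/(row_perm _ _) row_permE det_mulmx det_perm odd_tperm
             -val_eqE /= !inordK // expr1 mulN1r.
apply/matrixP => a b; rewrite !mxE; congr (_ == _)%:R.
case: tpermP => [->|->|/eqP + /eqP +]; rewrite ?(tnth_nth i) /= ?inordK //.
rewrite -!val_eqE /= !inordK //.
by case: a => [[|[|[|[|]]]]].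
Qed.

End SelfDual.

Section TorusFibration.
Variable R : realType.

Definition Z4 : set 'rV[R]_4 :=
  [set x | exists m : 'rV[int]_4, x = map_mx intr m].

Definition lattice_basis (W : vectType R) n (L : set W) (b : n.-tuple W) : Prop :=
  basis_of fullv b /\
  L = [set x | exists m : 'I_n -> int, x = \sum_(i < n) tnth b i *~ m i].

Record g2_torus_fibration := G2TorusFibration {
  eta : 'M[R]_4;
  eta_metric : is_metric eta;
  fib_lattice : set (subvs_of (sd2 eta));
  fib_latticeP : exists b : 3.-tuple (subvs_of (sd2 eta)),
                   lattice_basis fib_lattice b;
  alpha : 'Hom('rV[R]_4, subvs_of (sd2 eta))
}.

Variable S : g2_torus_fibration.

Definition totV : vectType R := ('rV[R]_4 * subvs_of (sd2 (eta S)))%type.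

Definition tilde_lattice : set totV :=
  [set p | exists mu nu, [/\ Z4 mu, fib_lattice nu & p = (mu, nu + alpha S mu)]].

(* f : totV / tilde_lattice -> R^4 / Z4 *)
Definition proj4 (v : totV) : 'rV[R]_4 := v.1.

Definition generator (b : 3.-tuple (subvs_of (sd2 (eta S)))) (i : 'I_(4 + 3)) : totV :=
  match fintype.split i with
  | inl j => (delta_mx 0 j, alpha S (delta_mx 0 j))
  | inr j => (0, tnth b j)
  end.

Implicit Types phi : kform 3 totV R.

Definition orthonormal_generators phi : Prop :=
  exists2 b, lattice_basis (@fib_lattice S) b &
    forall i j, g2_metric phi (generator b i) (generator b j) = (i == j)%:R.

Definition vertical : set totV := [set v | proj4 v = 0].
Definition horizontal phi : set totV :=
  [set v | forall w, vertical w -> g2_metric phi v w = 0].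

Definition riemannian_submersion phi (gB : 'M[R]_4) : Prop :=
  is_metric gB /\
  forall u v, horizontal phi u -> horizontal phi v ->
    g2_metric phi u v = (proj4 u *m gB *m (proj4 v)^T) 0 0.

(* phi|_P = dVol|_P.  The base R^4 / Z^4 has its standard orientation and the
   fibres are oriented so that the orientation of the total space (the one
   defined by phi) is that of the base followed by that of the fibre. *)
Definition associative_fibres phi : Prop :=
  forall (h : 'I_4 -> totV) (p : 'I_3 -> totV),
    0 < \det (\matrix_(i, j) proj4 (h i) 0 j) ->
    (forall i, vertical (p i)) ->
    (forall i j, g2_metric phi (p i) (p j) = (i == j)%:R) ->
    0 < g2_vol phi (fun i : 'I_(4 + 3) =>
          match fintype.split i with inl a => h a | inr a => p a end) ->
    phi p = 1.

(* phi is the constant G2-structure of the torus and gB the metric on the base.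
   As phi makes the generators of the lattice orthonormal, gB need not be eta,
   which only enters through the space Lambda^2_+. *)
Definition associative_fibration phi gB : Prop :=
  [/\ g2_structure phi, orthonormal_generators phi,
      riemannian_submersion phi gB & associative_fibres phi].

(* The summand Lambda^p(R^4) (x) Lambda^(k - p)(Lambda^2_+) of the k-forms, for
   the orthogonal splitting of totV, in which R^4 is the horizontal space. *)
Definition bidegree phi k (p : nat) (xi : kform k totV R) : Prop :=
  forall (I : {set 'I_k}) (v : 'I_k -> totV),
    (forall i, i \in I -> horizontal phi (v i)) ->
    (forall i, i \notin I -> vertical (v i)) ->
    #|I| <> p -> xi v = 0.

Definition xi_of phi dphi : kform 4 totV R :=
  g2_star (phi \+ dphi) \- g2_star phi.

(* a perturbation whose xi lies in Lambda^1(R^4) (x) Lambda^3(Lambda^2_+) *)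
Definition transverse_perturbation phi dphi : Prop :=
  [/\ g2_structure (phi \+ dphi), bidegree phi 1 (xi_of phi dphi)
    & xi_of phi dphi <> (fun=> 0)].

End TorusFibration.

Section Smooth.
Variables (R : realType) (W : vectType R).

Definition ddir (v : W) (f : W -> R) (x : W) : R :=
  derive1 (fun t : R => f (x + t *: v) : R^o) 0.

(* C^n: the directional derivatives exist and are C^(n-1) *)
Fixpoint Ck (n : nat) (f : W -> R) : Prop :=
  if n is m.+1 then
    forall v, (forall x, derivable (fun t : R => f (x + t *: v)) 0 1) /\
              Ck m (ddir v f)
  else continuous (fun z : 'rV[R]_(\dim {:W}) =>
         f (\sum_i z 0 i *: tnth (vbasis {:W}) i)).

Definition smooth (f : W -> R) : Prop := forall n, Ck n f.

Definition smooth_mx m n (f : W -> 'M[R[i]]_(m, n)) : Prop :=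
  forall i j, smooth (fun x => complex.Re (f x i j)) /\
              smooth (fun x => complex.Im (f x i j)).

Definition ddir_mx m n (v : W) (f : W -> 'M[R[i]]_(m, n)) (x : W) :
    'M[R[i]]_(m, n) :=
  \matrix_(i, j) (ddir v (fun y => complex.Re (f y i j)) x
                  +i* ddir v (fun y => complex.Im (f y i j)) x).

End Smooth.

Section StructureGroup.
Variables (R : realType) (r : nat).
Implicit Type G : set 'M[R[i]]_r.

Definition GL : set 'M[R[i]]_r := [set M | M \in unitmx].

Definition compact_group G : Prop :=
  [/\ G `<=` GL, G 1%:M,
      (forall M N, G M -> G N -> G (M *m N)), (forall M, G M -> G (invmx M))
    & compact ((fun M => (map_mx (@complex.Re R) M, map_mx (@complex.Im R) M)
                  : 'M[R]_r * 'M[R]_r) @` G)].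

Definition lie_algebra G : set 'M[R[i]]_r :=
  [set X | exists c : R^o -> 'M[R[i]]_r,
     [/\ smooth_mx c, (forall t, G (c t)), c 0 = 1%:M & X = ddir_mx (1 : R^o) c 0]].

End StructureGroup.

(* Bundles on W / Gam, Gam a lattice in W.  Since W is contractible, a vector
   bundle of rank r with structure group G is the quotient of W x C^r by
   (x, s) ~ (x + l, g l x s), l in Gam, for a cocycle g; sections, connections
   and gauge transformations are equivariant objects on W. *)
Section Bundles.
Variables (R : realType) (W : vectType R) (Gam : set W) (r : nat).
Local Notation M := 'M[R[i]]_r.

Definition bundle (G : set M) (g : W -> W -> M) : Prop :=
  [/\ forall l, Gam l -> smooth_mx (g l),
      forall l x, Gam l -> G (g l x)
    & forall l m x, Gam l -> Gam m -> g (l + m) x = g l (x + m) *m g m x].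

Variables (G : set M) (g : W -> W -> M).

(* the covariant derivative d + A, A x v being the value of A at x on v *)
Definition connection (A : W -> W -> M) : Prop :=
  [/\ forall v, smooth_mx (A ^~ v),
      forall x (c : R) u v, A x (c *: u + v) = c%:C *: A x u + A x v,
      forall x v, lie_algebra G (A x v)
    & forall l x v, Gam l ->
        A (x + l) v = g l x *m A x v *m invmx (g l x)
                      - ddir_mx v (g l) x *m invmx (g l x)].

Definition curvature (A : W -> W -> M) (x : W) : kform 2 W M := fun v =>
  let X := v 0 in let Y := v 1 in
  ddir_mx X (A ^~ Y) x - ddir_mx Y (A ^~ X) x + (A x X *m A x Y - A x Y *m A x X).

Definition gauge_transformation (u : W -> M) : Prop :=
  [/\ smooth_mx u, forall x, G (u x)
    & forall l x, Gam l -> u (x + l) *m g l x = g l x *m u x].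

Definition gauge_act (u : W -> M) (A : W -> W -> M) : W -> W -> M := fun x v =>
  u x *m A x v *m invmx (u x) - ddir_mx v u x *m invmx (u x).

Definition gauge_class (A : W -> W -> M) : set (W -> W -> M) :=
  [set gauge_act u A | u in gauge_transformation].

Definition moduli (P : (W -> W -> M) -> Prop) : set (set (W -> W -> M)) :=
  [set gauge_class A | A in [set A | connection A /\ P A]].

End Bundles.

Section Indecomposable.
Variables (R : realType) (W : vectType R) (Gam : set W).

Definition decomposable r (g : W -> W -> 'M[R[i]]_r) : Prop :=
  exists r1 r2 (e : (r1 + r2 = r)%N)
         (g1 : W -> W -> 'M[R[i]]_r1) (g2 : W -> W -> 'M[R[i]]_r2)
         (u : W -> 'M[R[i]]_r),
    [/\ (0 < r1)%N /\ (0 < r2)%N,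
        bundle Gam (@GL R r1) g1, bundle Gam (@GL R r2) g2,
        smooth_mx u /\ (forall x, GL (u x))
      & forall l x, Gam l ->
          u (x + l) *m g l x
          = castmx (e, e) (block_mx (g1 l x) 0 0 (g2 l x)) *m u x].

Definition indecomposable r (g : W -> W -> 'M[R[i]]_r) : Prop :=
  (0 < r)%N /\ ~ decomposable g.

End Indecomposable.

Section Pullback.
Variables (R : realType) (W W' : vectType R) (f : W -> W') (r : nat).
Local Notation M := 'M[R[i]]_r.

(* f is linear, hence its own differential *)
Definition pullback (A : W' -> W' -> M) : W -> W -> M := fun x v => A (f x) (f v).

Definition pullback_bundle (g : W' -> W' -> M) : W -> W -> M :=
  fun l x => g (f l) (f x).

(* [A] |-> [f^* A] *)
Definition pullback_class (Gam : set W) (G : set M) (g : W' -> W' -> M)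
    (c : set (W' -> W' -> M)) : set (W -> W -> M) :=
  \bigcup_(A in c) gauge_class Gam G (pullback_bundle g) (pullback A).

End Pullback.

Section FourTorus.
Variables (R : realType) (r : nat).
Local Notation M := 'M[R[i]]_r.
Local Notation R4 := 'rV[R]_4.
Local Notation mu := (@lebesgue_measure R).

Definition self_dual (gB : 'M[R]_4) (A : R4 -> R4 -> M) : Prop :=
  forall x (a b : 'I_r),
    let F k l := curvature A x (fun i : 'I_2 => delta_mx 0 (if i == 0 then k else l)) a b in
    let FRe := \matrix_(k, l) complex.Re (F k l) in
    let FIm := \matrix_(k, l) complex.Im (F k l) in
    hodge gB FRe = FRe /\ hodge gB FIm = FIm.

Definition torus_integral (h : R4 -> R) : R :=
  \int[mu]_(a in `[0, 1]) \int[mu]_(b in `[0, 1])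
    \int[mu]_(c in `[0, 1]) \int[mu]_(d in `[0, 1])
      h (\row_(i < 4) nth 0 [:: a; b; c; d] i).

(* Chern-Weil: c_2 is represented by the degree 4 part of det(1 + iF/2pi),
   which is (tr(F /\ F) - tr F /\ tr F) / (8 pi^2). *)
Definition chern2 (A : R4 -> R4 -> M) (x : R4) : R[i] :=
  let F := curvature A x in
  let e (i : 'I_4) : R4 := delta_mx 0 i in
  (8 * pi ^+ 2)%:C ^-1 *
  (\tr (wedge (@mulmx _ r r r) F F e)
   - wedge *%R (fun v => \tr (F v)) (fun v => \tr (F v)) e).

(* c_2(E)[R^4/Z^4], computed with some connection; it does not depend on it *)
Definition c2 (G : set M) (g : R4 -> R4 -> M) : R[i] :=
  xget 0 [set c | exists2 A, connection (@Z4 R) G g A &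
    c = torus_integral (fun x => complex.Re (chern2 A x))
        +i* torus_integral (fun x => complex.Im (chern2 A x))].

End FourTorus.

Section Instanton.
Variables (R : realType) (W : vectType R) (r : nat).

(* F_A /\ *_phi phi = 0 *)
Definition g2_instanton (phi : kform 3 W R) (A : W -> W -> 'M[R[i]]_r) : Prop :=
  forall x (v : 'I_(2 + 4) -> W),
    wedge (fun (X : 'M[R[i]]_r) (t : R) => t%:C *: X)
          (curvature A x) (g2_star phi) v = 0.

End Instanton.

(* Main.v *)
(* Part (i).  The horizontal lifts h_0, ..., h_3 of the standard basis of R^4 and
   the vertical generators p_0, p_1, p_2 form an orthonormal frame; since the
   fibres are associative, * phi equals 1 on the h_i.  The equality case of
   Cauchy-Schwarz then puts the forms h_0^* /\ h_i^* + h_j^* /\ h_k^* in g2, the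
   kernel of the product with * phi.

   Part (ii).  Let psi be the perturbed 4-form.  As * phi vanishes on all
   (h_a, p_0, p_1, p_2) and the perturbation is of type (IV), psi is nonzero on
   one of these quadruples.  With v = h_a and beta the invariant bilinear form of
   c_2, contracting F /\ psi = 0 with v gives
     beta(v _| F, F) /\ (v _| psi) = - beta(v _| F, v _| F) /\ psi = 0,
   where v _| beta(F, F) = 2 beta(v _| F, F).  By Chern-Simons transgression
   beta(F, F) differs from its value at the pullback of a connection on E, whose
   curvature has no vertical component, by derivatives of periodic functions,
   whose averages over the torus vanish.  Averaging the identity above on the six
   remaining vectors of the frame therefore leaves
   c_2(E) psi(h_a, p_0, p_1, p_2) = 0. *)
Require Import Defs.
From HB Require Import structures.
From mathcomp Require Import all_boot all_order all_algebra all_fingroup.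
From mathcomp Require Import all_classical all_reals all_analysis.
From mathcomp Require Import complex ring lra zify.

Set Implicit Arguments.
Unset Strict Implicit.
Unset Printing Implicit Defensive.

Import Order.TTheory GRing.Theory Num.Theory.
Import numFieldNormedType.Exports.
Local Open Scope classical_set_scope.
Local Open Scope ring_scope.
Local Open Scope complex_scope.

(** * Exterior products with a 2-form *)

(** The adapted coframe is merely chosen, and only a Gram matrix relates it to the lattice frame.
    The frame is therefore studied through its coframe coordinates: phi and its dual 4-form become
    polynomials in the cross product of R^7, and associativity of the fibres is carried to the
    horizontal vectors by an identity between complementary minors, the sign of the frame being
    tracked along the way. The frame vectors are lattice generators, hence at once orthonormal,
    directions of differentiation and periods. Exterior derivatives thus average to zero by a
    telescoping sum, and a function pulled back from the base has the same average on the total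
    space as on the base. The instanton equation is linear in F whereas c_2 is quadratic: pairing it
    with the contraction of F by one vector supplies the second factor. The pullback of a connection
    on E serves as reference because every component of its quadratic curvature form that involves a
    fibre vector vanishes, which leaves a single unknown component in the contracted identity. *)

Lemma reindex_lift_perm (S : zmodType) n (F : 'S_n.+1 -> S) :
  \sum_s F s = \sum_(i < n.+1) \sum_(s : 'S_n) F (lift_perm ord0 i s).
Proof.
rewrite pair_big /= (reindex (fun p : 'I_n.+1 * 'S_n => lift_perm ord0 p.1 p.2)) //.
apply/onW_bij/inj_card_bij.
  move=> [i s] [j t] /= E; have Eij : i = j.
    by move/permP: (E) => /(_ ord0); rewrite !lift_perm_id.
  rewrite -Eij in E *; congr pair; apply/permP => k.
  by move/permP: E => /(_ (lift ord0 k)); rewrite !lift_perm_lift => /lift_inj.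
by rewrite card_prod !card_Sn card_ord factS.
Qed.

(** An increasing [t] satisfies [i <= t i], by induction on [i]; applied to [s] and to its inverse,
    this bounds [s i] from both sides. *)
Lemma increasing_perm n (s : 'S_n) :
  (forall i j : 'I_n, (i < j)%N -> (s i < s j)%N) -> s = 1%g.
Proof.
move=> s_incr; suff ge_id (t : 'S_n) :
    (forall i j : 'I_n, (i < j)%N -> (t i < t j)%N) -> forall i : 'I_n, (i <= t i)%N.
  have sV_incr (i j : 'I_n) : (i < j)%N -> (s^-1%g i < s^-1%g j)%N.
    move=> ij; case: (ltngtP (s^-1%g i) (s^-1%g j)) => // [/s_incr|/val_inj].
      by rewrite !permKV ltnNge (ltnW ij).
    by move/perm_inj => E; rewrite E ltnn in ij.
  apply/permP => i; rewrite perm1; apply/val_inj/eqP; rewrite /= eqn_leq ge_id //.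
  by have := ge_id _ sV_incr (s i); rewrite permK => ->.
move=> t_incr i; have [k] := ubnP (i : nat).
elim: k i => // k IHk [[|i] ltin] // lik.
have lt_in : (i < n)%N by apply: ltnW.
have := IHk (Ordinal lt_in) lik; move/leq_ltn_trans; apply.
exact: t_incr.
Qed.

(* A shuffle of the first two indices with the others is determined by their images
   i and lift i j; shuffle_tail asserts the monotonicity of the other indices only. *)
Definition shuffle_tail l (s : 'S_(2 + l)) : bool :=
  [forall i : 'I_l, forall j : 'I_l,
     (i < j)%N ==> (s (rshift 2 i) < s (rshift 2 j))%N].

Definition shuffle2 l (i : 'I_l.+2) (j : 'I_l.+1) : 'S_(2 + l) :=
  lift_perm ord0 i (lift_perm ord0 j 1).

Lemma lift_mono n (h : 'I_n) (i j : 'I_n.-1) : (lift h i < lift h j)%N = (i < j)%N.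
Proof. by rewrite /= ltnNge leq_bump2 -ltnNge. Qed.

(** Two expansions along the image of the first index leave a permutation of the other indices,
    which [shuffle_tail] forces to be increasing, hence the identity. *)
Lemma sum_shuffle_tail (S : zmodType) l (F : 'S_(2 + l) -> S) :
  \sum_(s | shuffle_tail s) F s =
  \sum_(i < l.+2) \sum_(j < l.+1) F (shuffle2 i j).
Proof.
rewrite big_mkcond (@reindex_lift_perm _ l.+1) /=; apply: eq_bigr => i _.
rewrite reindex_lift_perm; apply: eq_bigr => j _.
rewrite (bigD1 1%g) //= [X in _ + X]big1 ?addr0 => [|t t1].
  rewrite ifT //; apply/'forall_forallP => a b; apply/implyP => ab.
  have r2 (c : 'I_l) : rshift 2 c = lift ord0 (lift ord0 c) by exact/val_inj.
  by rewrite !r2 !lift_perm_lift !lift_mono !perm1.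
rewrite ifF //; apply: contra_neqF t1 => /'forall_forallP tm.
apply: increasing_perm => a b ab; have := tm a b; rewrite ab.
have r2 (c : 'I_l) : rshift 2 c = lift ord0 (lift ord0 c) by exact/val_inj.
by rewrite !r2 !lift_perm_lift !lift_mono.
Qed.

Lemma shuffle2_0 l (i : 'I_l.+2) (j : 'I_l.+1) : shuffle2 i j ord0 = i.
Proof. by rewrite lift_perm_id. Qed.

Lemma shuffle2_1 l (i : 'I_l.+2) (j : 'I_l.+1) :
  shuffle2 i j (lift ord0 ord0) = lift i j.
Proof. by rewrite lift_perm_lift lift_perm_id. Qed.

Lemma shuffle2_rshift l (i : 'I_l.+2) (j : 'I_l.+1) k :
  shuffle2 i j (rshift 2 k) = lift i (lift j k).
Proof.
have -> : rshift 2 k = lift ord0 (lift ord0 k) by exact/val_inj.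
by rewrite !lift_perm_lift perm1.
Qed.

Lemma odd_shuffle2 l (i : 'I_l.+2) (j : 'I_l.+1) :
  odd_perm (shuffle2 i j) = odd i (+) odd j.
Proof. by rewrite !odd_lift_perm odd_perm1 addbF. Qed.

Lemma lshift2 l : ((lshift l (ord0 : 'I_2) = ord0) *
  (lshift l (lift ord0 ord0 : 'I_2) = lift ord0 ord0))%type.
Proof. by split; apply/val_inj. Qed.

Lemma shuffle_2E l (s : 'S_(2 + l)) :
  shuffle s = (s ord0 < s (lift ord0 ord0))%N && shuffle_tail s.
Proof.
rewrite /shuffle; congr (_ && _); apply/'forall_forallP/idP => [|s01 i j].
  by move=> /(_ ord0 (lift ord0 ord0)); rewrite !lshift2.
apply/implyP => ij; suff [-> ->] : i = ord0 /\ j = lift ord0 ord0.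
  by rewrite !lshift2.
by move: i j ij => [[|[|//]] ?] [[|[|//]] ?] //= _; split; apply/val_inj.
Qed.

(** The 2-form receives the vectors numbered [i] and [lift i j]; [i <= j] amounts to [i < lift i j],
    and the sign is that of [shuffle2 i j]. *)
Lemma wedge2E (W A B : Type) (S : zmodType) (mul : A -> B -> S) l
    (a : kform 2 W A) (b : kform l W B) (v : 'I_(2 + l) -> W) :
  wedge mul a b v =
  \sum_(i < l.+2) \sum_(j < l.+1 | (i <= j)%N)
    mul (a (fun k => if k == 0 then v i else v (lift i j)))
        (b (fun k => v (lift i (lift j k)))) *~ (-1) ^+ (i + j)%N.
Proof.
rewrite /wedge.
under eq_bigl do rewrite shuffle_2E andbC.
rewrite big_mkcondr sum_shuffle_tail; apply: eq_bigr => i _.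
rewrite [RHS]big_mkcond; apply: eq_bigr => j _.
rewrite shuffle2_0 shuffle2_1 odd_shuffle2 -oddD.
have -> : (i < lift i j)%N = (i <= j)%N.
  by rewrite /= /bump; case: (leqP i j) => h; rewrite ?add1n ?ltnS // add0n ltnNge ltnW.
case: ifP => // _; rewrite -[(-1) ^+ (i + j)]signr_odd.
congr (mul (a _) (b _) *~ _); apply/funext => k.
  have [->|->] : k = ord0 \/ k = lift ord0 ord0.
    by case: k => [[|[|//]] ?]; [left | right]; apply/val_inj.
    by rewrite lshift2 shuffle2_0.
  by rewrite lshift2 shuffle2_1.
by rewrite shuffle2_rshift.
Qed.

(** List counterpart of reindexing along [lift i]. Passing vectors as lists lets formulas with
    concrete indices reduce by computation. *)
Definition del T i (s : seq T) := take i s ++ drop i.+1 s.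

Lemma nth_del T (x0 : T) i s k : nth x0 (del i s) k = nth x0 s (bump i k).
Proof.
rewrite nth_cat size_take_min /bump; case: (leqP i k) => ki.
  rewrite ifF ?nth_drop; last by lia.
  case: (leqP i (size s)) => hi; first by congr (nth _ _ _); lia.
  by rewrite !nth_default //; lia.
case: ifP => hk; first by rewrite nth_take.
by rewrite !nth_default ?size_drop //; lia.
Qed.

Local Arguments emon {R W} e I _.

(** * Monomials in a coframe *)

Section MonomialForms.
Variables (R : realType) (W : vectType R).
Implicit Types (e : 7.-tuple 'Hom(W, R^o)) (I : seq nat) (s : seq W).

Definition coord_of e (a : nat) (v : W) : R := nth 0 e a.-1 v.

Definition emonl e I s : R := emon e I (fun i => nth 0 s i).

Lemma emon_cons e a I (v : 'I_(size I).+1 -> W) :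
  emon e (a :: I) v =
  \sum_(i < (size I).+1) (-1) ^+ i * coord_of e a (v i) *
    emon e I (fun k => v (lift i k)).
Proof.
rewrite /emon (expand_det_row _ ord0); apply: eq_bigr => i _.
rewrite !mxE /= /cofactor add0n mulrCA mulrA; congr (_ * \det _).
by apply/matrixP => p q; rewrite !mxE.
Qed.

Lemma emonl_cons e a I s :
  emonl e (a :: I) s =
  \sum_(0 <= i < (size I).+1) (-1) ^+ i * coord_of e a (nth 0 s i) *
    emonl e I (del i s).
Proof.
rewrite /emonl emon_cons big_mkord; apply: eq_bigr => i _; congr (_ * emon _ _ _).
by apply/funext => k; rewrite nth_del.
Qed.

Lemma emonl_nil e s : emonl e [::] s = 1.
Proof. by rewrite /emonl /emon det_mx00. Qed.

Lemma emon2 e a b (v : 'I_2 -> W) :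
  emon e [:: a; b] v =
  coord_of e a (v ord0) * coord_of e b (v (lift ord0 ord0)) -
  coord_of e a (v (lift ord0 ord0)) * coord_of e b (v ord0).
Proof.
rewrite emon_cons /= !big_ord_recl big_ord0 !emon_cons /= !big_ord_recl !big_ord0.
rewrite /emon !det_mx00 (_ : lift (lift ord0 ord0) ord0 = ord0); last exact/val_inj.
by rewrite /=; ring.
Qed.

(** Expanding the determinant along its first two rows gives a sum over all permutations increasing
    on the tail. Exchanging the images of the first two indices pairs the shuffles with the other
    permutations, and each pair adds up to a 2x2 minor. *)
Lemma wedge_emon2 e a b I :
  wedge *%R (emon e [:: a; b]) (emon e I) = emon e [:: a, b & I].
Proof.
apply/funext => v; pose X (s : 'S_(2 + size I)) : R :=
  coord_of e a (v (s ord0)) * coord_of e b (v (s (lift ord0 ord0))) *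
  emon e I (fun k => v (s (rshift 2 k))) *~ (-1) ^+ s.
transitivity (\sum_(s | shuffle_tail s) X s); last first.
  rewrite sum_shuffle_tail emon_cons; apply: eq_bigr => i _.
  rewrite emon_cons mulr_sumr; apply: eq_bigr => j _.
  rewrite /X shuffle2_0 shuffle2_1 odd_shuffle2 -oddD signr_odd exprD.
  rewrite (_ : (fun k => _) = (fun k => v (lift i (lift j k)))); last first.
    by apply/funext => k; rewrite shuffle2_rshift.
  by rewrite -mulrzr rmorphM !rmorphXn /= !rmorphN1; ring.
rewrite (bigID (fun s : 'S_(2 + size I) => (s ord0 < s (lift ord0 ord0))%N)) /=.
rewrite [X in _ + X](reindex_inj (mulgI (tperm ord0 (lift ord0 ord0 : 'I_(2 + size I))))) /=.
pose tp := tperm ord0 (lift ord0 ord0 : 'I_(2 + size I)).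
have tp_tail (s : 'S_(2 + size I)) k : (tp * s)%g (rshift 2 k) = s (rshift 2 k).
  by rewrite permM tpermD.
have tpS (s : 'S_(2 + size I)) : shuffle_tail (tp * s)%g = shuffle_tail s.
  by apply: eq_forallb => i; apply: eq_forallb => j; rewrite !tp_tail.
rewrite /wedge [X in _ + X](eq_bigl (fun s : 'S_(2 + size I) =>
    shuffle_tail s && (s ord0 < s (lift ord0 ord0))%N)); last first.
  move=> s; rewrite tpS !permM tpermL tpermR -leqNgt; congr (_ && _).
  by rewrite leq_eqVlt (inj_eq val_inj) (inj_eq perm_inj).
rewrite -big_split /=; apply: eq_big => [s|s _].
  by rewrite shuffle_2E andbC.
rewrite /X !permM tpermL tpermR odd_permM odd_tperm /=.
under [X in _ = _ + _ * emon e I X *~ _]eq_fun do rewrite tp_tail.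
rewrite emon2 !lshift2.
by case: (odd_perm s); rewrite /= ?addbF ?expr0 ?expr1 ?mulrN1z ?mulr1z; ring.
Qed.

Lemma emonl_swap e a b I s : emonl e [:: a, b & I] s = - emonl e [:: b, a & I] s.
Proof.
rewrite /emonl -(wedge_emon2 e a b I) -(wedge_emon2 e b a I) /wedge -sumrN; apply: eq_bigr => p _.
by rewrite -mulNrz -mulNr; congr (_ * _ *~ _); rewrite !emon2; ring.
Qed.

Lemma emonl_dup e I s : ~~ uniq I -> emonl e I s = 0.
Proof.
move=> /(uniqPn 0%N) [i [j [ij jI E]]].
apply: (@determinant_alternate _ _ _ (Ordinal (ltn_trans ij jI)) (Ordinal jI)).
  by rewrite -val_eqE /= neq_ltn ij.
by move=> k; rewrite !mxE /= E.
Qed.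

Fixpoint insert (a : nat) (I : seq nat) : bool * seq nat :=
  if I is b :: J then
    if (b < a)%N then let: (p, K) := insert a J in (~~ p, b :: K)
    else (false, a :: I)
  else (false, [:: a]).

(** Insertion sort that records the parity of its transpositions. On concrete index lists it
    computes, so monomials equal up to sign become syntactically equal. *)
Fixpoint signed_sort (I : seq nat) : bool * seq nat :=
  if I is a :: J then
    let: (p, K) := signed_sort J in let: (q, L) := insert a K in (p (+) q, L)
  else (false, [::]).

Lemma emonl_cons_congr e a I J (p : bool) :
  size I = size J -> (forall s, emonl e I s = (-1) ^+ p * emonl e J s) ->
  forall s, emonl e (a :: I) s = (-1) ^+ p * emonl e (a :: J) s.
Proof.
move=> sIJ E s; rewrite !emonl_cons sIJ mulr_sumr; apply: eq_bigr => i _.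
by rewrite E mulrCA.
Qed.

Lemma insertP e a I : size (insert a I).2 = (size I).+1 /\
  forall s, emonl e (a :: I) s = (-1) ^+ (insert a I).1 * emonl e (insert a I).2 s.
Proof.
elim: I => [|b I [IHs IHI]] /=; first by split=> // s; rewrite mul1r.
case: (ltnP b a) => _; last by split=> // s; rewrite mul1r.
move: IHs IHI; case: (insert a I) => p K /= sK EK; split; first by rewrite sK.
move=> s; rewrite emonl_swap (emonl_cons_congr _ _ EK) ?sK //.
by case: p {EK}; rewrite /= ?mulN1r ?mul1r ?opprK.
Qed.

Lemma signed_sortP e I : size (signed_sort I).2 = size I /\
  forall s, emonl e I s = (-1) ^+ (signed_sort I).1 * emonl e (signed_sort I).2 s.
Proof.
elim: I => [|a I [IHs IHI]] /=; first by split=> // s; rewrite mul1r.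
move: IHs IHI; case: (signed_sort I) => p K /= sK EK.
have [] := insertP e a K; case: (insert a K) => q L /= sL EL.
split=> [|s]; first by rewrite sL sK.
rewrite (emonl_cons_congr _ _ EK) ?sK // EL mulrA -signr_addb //.
Qed.

Lemma emonl_sort e I s :
  emonl e I s = (-1) ^+ (signed_sort I).1 * emonl e (signed_sort I).2 s.
Proof. by have [_ ->] := signed_sortP e I. Qed.

(** Expansion along the first row as a [foldr], which unlike the locked [\sum] simplifies to an
    explicit polynomial in the coordinates, ready for [ring]. *)
Fixpoint laplace (c : nat -> W -> R) (I : seq nat) (s : seq W) : R :=
  if I is a :: J then
    foldr (fun i S => (-1) ^+ i * c a (nth 0 s i) * laplace c J (del i s) + S) 0
      (iota 0 (size I))
  else 1.

Lemma emonl_laplace e I s : emonl e I s = laplace (coord_of e) I s.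
Proof.
elim: I s => [|a I IHI] s; first exact: emonl_nil.
rewrite emonl_cons unlock /reducebig /index_iota subn0 /=.
rewrite IHI; congr (_ + _); elim: (iota _ _) => //= k t ->.
by rewrite IHI.
Qed.

(** [true] marks a minus sign. The indices keep the order in which [omega1], [omega2], [omega3] list
    them, so that the expansion of [g2_form] involves no sorting. *)
Definition g2_monomials : seq (bool * seq nat) :=
  [:: (false, [:: 5; 6; 7]); (false, [:: 1; 2; 5]); (true, [:: 3; 4; 5]);
      (false, [:: 1; 3; 6]); (true, [:: 4; 2; 6]); (false, [:: 1; 4; 7]);
      (true, [:: 2; 3; 7])]%N.

Definition g2_dual_monomials : seq (bool * seq nat) :=
  [:: (false, [:: 1; 2; 3; 4]); (true, [:: 1; 2; 6; 7]); (false, [:: 3; 4; 6; 7]);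
      (true, [:: 1; 3; 7; 5]); (false, [:: 4; 2; 7; 5]); (true, [:: 1; 4; 5; 6]);
      (false, [:: 2; 3; 5; 6])]%N.

Definition emon_sum e (L : seq (bool * seq nat)) s : R :=
  \sum_(p <- L) (-1) ^+ p.1 * emonl e p.2 s.

Lemma wedgeBl (A : Type) (S : zmodType) k l (mul : R -> A -> S)
    (a b : kform k W R) (c : kform l W A) :
  (forall x y z, mul (x - y) z = mul x z - mul y z) ->
  wedge mul (a \- b) c = wedge mul a c \- wedge mul b c.
Proof.
move=> mulB; apply/funext => v; rewrite /wedge /= -sumrB; apply: eq_bigr => s _.
by rewrite /= mulB mulrzBl.
Qed.

Lemma nth_enum_fun k (v : 'I_k -> W) : v = fun i => nth 0 [seq v i | i <- enum 'I_k] i.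
Proof.
by apply/funext => i; rewrite (nth_map i) ?size_enum_ord // nth_ord_enum.
Qed.

Lemma g2_formE e s : g2_form e (fun i => nth 0 s i) = emon_sum e g2_monomials s.
Proof.
rewrite /g2_form /omega1 /omega2 /omega3.
rewrite !wedgeBl ?wedge_emon2; try by move=> x y z; rewrite mulrBl.
by rewrite /emon_sum unlock /= /emonl; ring.
Qed.

Lemma g2_dual_formE e s :
  g2_dual_form e (fun i => nth 0 s i) = emon_sum e g2_dual_monomials s.
Proof.
rewrite /g2_dual_form /omega1 /omega2 /omega3.
rewrite !wedgeBl ?wedge_emon2; try by move=> x y z; rewrite mulrBl.
by rewrite /emon_sum unlock /= /emonl; ring.
Qed.

End MonomialForms.

(** * The cross product of R^7 *)

Section CrossProduct.
Variable R : realType.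
Implicit Types x y z w : nat -> R.

Definition dot x y : R :=
  x 1%N * y 1%N + x 2%N * y 2%N + x 3%N * y 3%N + x 4%N * y 4%N +
  x 5%N * y 5%N + x 6%N * y 6%N + x 7%N * y 7%N.

Definition minor2 x y (i j : nat) : R := x i * y j - x j * y i.

(* cross is read off g2_form: dot (cross x y) z is the value of phi on the
   vectors with coordinates x, y, z. *)
Definition cross x y (a : nat) : R :=
  match a with
  | 1%N => minor2 x y 2 5 + minor2 x y 3 6 + minor2 x y 4 7
  | 2%N => minor2 x y 5 1 - minor2 x y 6 4 - minor2 x y 3 7
  | 3%N => minor2 x y 6 1 - minor2 x y 4 5 - minor2 x y 7 2
  | 4%N => minor2 x y 7 1 - minor2 x y 5 3 - minor2 x y 2 6
  | 5%N => minor2 x y 6 7 + minor2 x y 1 2 - minor2 x y 3 4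
  | 6%N => minor2 x y 7 5 + minor2 x y 1 3 - minor2 x y 4 2
  | 7%N => minor2 x y 5 6 + minor2 x y 1 4 - minor2 x y 2 3
  | _ => 0
  end.

(* The value of the 4-form * phi on the vectors with coordinates x, y, z, w, written
   with the iterated cross product. *)
Definition psi4 x y z w : R :=
  dot (cross x (cross y z)) w + dot x y * dot z w - dot x z * dot y w.

Lemma norm_cross x y :
  dot (cross x y) (cross x y) = dot x x * dot y y - dot x y ^+ 2.
Proof. by rewrite /dot /cross /minor2 /=; ring. Qed.

(** Polarised form of x × (x × z) = <x, z> x - |x|^2 z. *)
Lemma cross_cross_polar x y z a : (0 < a < 8)%N ->
  cross x (cross y z) a + cross y (cross x z) a =
  - 2 * dot x y * z a + dot x z * y a + dot y z * x a.
Proof. by do 8?[case: a => [|a] //=] => _; rewrite /dot /cross /minor2 /=; ring. Qed.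

Lemma psi4_cross x y w : psi4 x y (cross x y) w = 0.
Proof. by rewrite /psi4 /dot /cross /minor2 /=; ring. Qed.

Lemma psi4_swap12 x y z w : psi4 y x z w = - psi4 x y z w.
Proof. by rewrite /psi4 /dot /cross /minor2 /=; ring. Qed.

Lemma psi4_swap23 x y z w : psi4 x z y w = - psi4 x y z w.
Proof. by rewrite /psi4 /dot /cross /minor2 /=; ring. Qed.

Lemma psi4_swap34 x y z w : psi4 x y w z = - psi4 x y z w.
Proof. by rewrite /psi4 /dot /cross /minor2 /=; ring. Qed.

Lemma dot_eq0 x : dot x x = 0 -> forall a, (0 < a < 8)%N -> x a = 0.
Proof.
rewrite /dot -!expr2 => /eqP; rewrite !paddr_eq0 ?addr_ge0 ?sqr_ge0 //.
rewrite !sqrf_eq0 => /andP[/andP[/andP[/andP[/andP[/andP[x1 x2] x3] x4] x5] x6] x7].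
by move=> a; do 8?[case: a => [|a] //]; move=> _; apply/eqP.
Qed.

End CrossProduct.

Section Coordinates.
Variables (R : realType) (W : vectType R) (e : 7.-tuple 'Hom(W, R^o)).

Definition coord7 (v : W) : nat -> R := fun a => coord_of e a v.

Lemma emon_sum_g2 x y z :
  emon_sum e g2_monomials [:: x; y; z] = dot (cross (coord7 x) (coord7 y)) (coord7 z).
Proof.
rewrite /emon_sum unlock /= !emonl_laplace /= /dot /cross /minor2 /coord7.
by ring.
Qed.

Lemma emon_sum_g2_dual x y z w :
  emon_sum e g2_dual_monomials [:: x; y; z; w] =
  psi4 (coord7 x) (coord7 y) (coord7 z) (coord7 w).
Proof.
rewrite /emon_sum unlock /= !emonl_laplace /= /psi4 /dot /cross /minor2 /coord7.
by ring.
Qed.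

End Coordinates.

(** * Associative and coassociative frames *)

Section Calibrated.
Variable R : realType.
Implicit Types x y z w h : nat -> R.

Lemma cross_extr x y z a : (forall b, (0 < b < 8)%N -> y b = z b) ->
  cross x y a = cross x z a.
Proof.
by move=> E; do 8?[case: a => [|a] //=]; rewrite /minor2 !E.
Qed.

Lemma dotBZ c x y : dot (fun a => x a - c * y a) (fun a => x a - c * y a) =
  dot x x - 2 * c * dot x y + c ^+ 2 * dot y y.
Proof. by rewrite /dot; ring. Qed.

Lemma dotC x y : dot x y = dot y x.
Proof. by rewrite /dot; ring. Qed.

Lemma dot_ge0 x : 0 <= dot x x.
Proof. by rewrite /dot -!expr2 !addr_ge0 ?sqr_ge0. Qed.

(** Equality in Cauchy-Schwarz: |x × y| = 1, so z = ± x × y, and the dual 4-form vanishes on x, y, x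
    × y and any fourth vector. *)
Lemma psi4_associative x y z w :
  dot x x = 1 -> dot y y = 1 -> dot z z = 1 -> dot x y = 0 ->
  dot (cross x y) z ^+ 2 = 1 -> psi4 x y z w = 0.
Proof.
(* [s] is kept abstract, so that unfolding [dot] later leaves it as an atom for [ring]. *)
have [s sE] : exists s, s = dot (cross x y) z by eexists.
move=> xx yy zz xy; rewrite -sE => s1.
have zE : forall a, (0 < a < 8)%N -> z a = s * cross x y a.
  move=> a a8; apply/eqP; rewrite -subr_eq0; apply/eqP.
  apply: (dot_eq0 (x := fun a => z a - s * cross x y a)) => //.
  rewrite dotBZ norm_cross xx yy xy zz (dotC z) -sE expr0n /= subr0.
  by ring: s1.
suff -> : psi4 x y z w = s * psi4 x y (cross x y) w by rewrite psi4_cross mulr0.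
by rewrite /psi4 /dot /cross /minor2 /= !zE // /cross /minor2 /=; ring.
Qed.

Lemma crossC x y a : cross x y a = - cross y x a.
Proof. by do 8?[case: a => [|a] //=]; rewrite /minor2 ?oppr0 //; ring. Qed.

Lemma crossNr x y a : cross x (fun b => - y b) a = - cross x y a.
Proof. by do 8?[case: a => [|a] //=]; rewrite /minor2 ?oppr0 //; ring. Qed.

(* The equality case of Cauchy-Schwarz makes h4 the triple cross product of
   h1, h2, h3. *)
Lemma cross_coassociative h1 h2 h3 h4 :
  dot h1 h1 = 1 -> dot h2 h2 = 1 -> dot h3 h3 = 1 -> dot h4 h4 = 1 ->
  dot h1 h2 = 0 -> dot h1 h3 = 0 -> dot h2 h3 = 0 -> psi4 h1 h2 h3 h4 = 1 ->
  forall a, (0 < a < 8)%N -> cross h1 h2 a + cross h3 h4 a = 0.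
Proof.
move=> n1 n2 n3 n4 o12 o13 o23; rewrite /psi4 o12 o13 !mul0r addr0 subr0.
set d := cross h2 h3; set k := cross h1 d => k4.
have dd : dot d d = 1 by rewrite norm_cross n2 n3 o23 expr0n /= subr0 mulr1.
have kk : dot k k = 1 - dot h1 d ^+ 2 by rewrite norm_cross n1 dd mulr1.
(* [k4] says <k, h4> = 1. The squared distance from h4 to k is thus minus a square, so it vanishes
   together with <h1, d>. *)
have E : dot (fun a => h4 a - 1 * k a) (fun a => h4 a - 1 * k a) = - dot h1 d ^+ 2.
  by rewrite dotBZ n4 kk (dotC h4) k4; ring.
have p0 : dot h1 d = 0.
  by apply/eqP; rewrite -sqrf_eq0 -oppr_eq0 eq_le -{2}E dot_ge0 oppr_le0 sqr_ge0.
have h4E b : (0 < b < 8)%N -> h4 b = k b.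
  by move=> b8; apply/eqP; rewrite -subr_eq0 -[k b]mul1r; apply/eqP;
     apply: (dot_eq0 (x := fun a => h4 a - 1 * k a)); rewrite // E p0 expr0n /= oppr0.
(* On orthogonal vectors the double cross product is alternating, so its three factors may be
   permuted cyclically. *)
have kE b : (0 < b < 8)%N -> k b = cross h3 (cross h1 h2) b.
  move=> b8; have := cross_cross_polar h1 h3 h2 b8.
  rewrite o12 o13 (dotC h3) o23 !mul0r mulr0 mul0r !addr0 => /eqP.
  rewrite addrC addr_eq0 => /eqP ->; rewrite -crossNr.
  by apply: cross_extr => c _; rewrite /d crossC.
move=> a a8; rewrite (cross_extr _ _ h4E) (cross_extr _ _ kE).
(* The double product with the unit vector h3 is minus the identity on its orthogonal complement,
   which contains h1 × h2. *)
have := cross_cross_polar h3 h3 (cross h1 h2) a8.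
have -> : dot h3 (cross h1 h2) = dot h1 d by rewrite /d /dot /= /minor2; ring.
by rewrite n3 p0 => E2; lra.
Qed.

End Calibrated.

(** * The kernel of the product with the dual 4-form *)

Section SelfDualWedge.
Variables (R : realType) (W : vectType R) (e : 7.-tuple 'Hom(W, R^o)).
Local Arguments emon {R W} e I _.

Lemma wedgeBr (A : Type) (S : zmodType) k l (mul : A -> R -> S)
    (a : kform k W A) (b c : kform l W R) :
  (forall x y z, mul x (y - z) = mul x y - mul x z) ->
  wedge mul a (b \- c) = wedge mul a b \- wedge mul a c.
Proof.
move=> mulB; apply/funext => v; rewrite /wedge /= -sumrB; apply: eq_bigr => s _.
by rewrite /= mulB mulrzBl.
Qed.

Lemma wedge_sum_scale (J : Type) (r : seq J) k l (c : J -> R) (a : J -> kform k W R)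
    (b : kform l W R) v :
  wedge *%R (fun u => \sum_(j <- r) c j * a j u) b v =
  \sum_(j <- r) c j * wedge *%R (a j) b v.
Proof.
rewrite /wedge; under [RHS]eq_bigr do rewrite mulr_sumr.
rewrite exchange_big; apply: eq_bigr => s _ /=; rewrite mulr_suml mulrz_suml.
by apply: eq_bigr => j _; rewrite -mulrA mulrzAr.
Qed.

(** Normal form of a monomial, decided by computation on concrete indices; in degree 6 only seven
    monomials remain. *)
Definition sorted_emonl (I : seq nat) (s : seq W) : R :=
  if uniq I then (-1) ^+ (signed_sort I).1 * emonl e (signed_sort I).2 s else 0.

Lemma sorted_emonlE I s : sorted_emonl I s = emonl e I s.
Proof.
by rewrite /sorted_emonl; case: ifP => [_|/negbT/emonl_dup->]; rewrite -?emonl_sort.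
Qed.

Lemma wedge_emon_dual a b s :
  wedge *%R (emon e [:: a; b]) (g2_dual_form e) (fun i => nth 0 s i) =
  \sum_(q <- g2_dual_monomials) (-1) ^+ q.1 * sorted_emonl [:: a, b & q.2] s.
Proof.
rewrite /g2_dual_form /omega1 /omega2 /omega3.
rewrite !wedgeBl ?wedge_emon2; try by move=> x y z; rewrite mulrBl.
rewrite !wedgeBr; try by move=> x y z; rewrite mulrBr.
have E i j k l : wedge *%R (emon e [:: a; b]) (emon e [:: i; j; k; l] : kform 4 W R) =
    emon e [:: a; b; i; j; k; l] by exact: (wedge_emon2 e a b [:: i; j; k; l]).
rewrite !E unlock /= !sorted_emonlE /emonl; ring.
Qed.

Definition pairs7 : seq (nat * nat) :=
  [:: (1, 2); (1, 3); (1, 4); (1, 5); (1, 6); (1, 7); (2, 3); (2, 4); (2, 5);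
      (2, 6); (2, 7); (3, 4); (3, 5); (3, 6); (3, 7); (4, 5); (4, 6); (4, 7);
      (5, 6); (5, 7); (6, 7)]%N.

(* The seven equations define g2 inside so(7). *)
Lemma wedge_dual_eq0 (C : nat -> nat -> R) v :
  C 2%N 5%N + C 3%N 6%N + C 4%N 7%N = 0 ->
  - C 1%N 5%N + C 4%N 6%N - C 3%N 7%N = 0 ->
  - C 1%N 6%N - C 4%N 5%N + C 2%N 7%N = 0 ->
  - C 1%N 7%N + C 3%N 5%N - C 2%N 6%N = 0 ->
  C 6%N 7%N + C 1%N 2%N - C 3%N 4%N = 0 ->
  - C 5%N 7%N + C 1%N 3%N + C 2%N 4%N = 0 ->
  C 5%N 6%N + C 1%N 4%N - C 2%N 3%N = 0 ->
  wedge *%R (fun u : 'I_2 -> W => \sum_(p <- pairs7) C p.1 p.2 * emon e [:: p.1; p.2] u)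
    (g2_dual_form e) v = 0.
Proof.
move=> k1 k2 k3 k4 k5 k6 k7; rewrite wedge_sum_scale (nth_enum_fun v).
set s := [seq _ | _ <- _].
under eq_bigr do rewrite wedge_emon_dual.
rewrite unlock /=.
(* One monomial for each omitted index; its coefficient is, up to sign, one of the seven
   equations. *)
transitivity (emonl e [:: 2; 3; 4; 5; 6; 7]%N s * (C 2%N 5%N + C 3%N 6%N + C 4%N 7%N)
 - emonl e [:: 1; 3; 4; 5; 6; 7]%N s * (- C 1%N 5%N + C 4%N 6%N - C 3%N 7%N)
 + emonl e [:: 1; 2; 4; 5; 6; 7]%N s * (- C 1%N 6%N - C 4%N 5%N + C 2%N 7%N)
 - emonl e [:: 1; 2; 3; 5; 6; 7]%N s * (- C 1%N 7%N + C 3%N 5%N - C 2%N 6%N)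
 + emonl e [:: 1; 2; 3; 4; 6; 7]%N s * (C 6%N 7%N + C 1%N 2%N - C 3%N 4%N)
 - emonl e [:: 1; 2; 3; 4; 5; 7]%N s * (- C 5%N 7%N + C 1%N 3%N + C 2%N 4%N)
 + emonl e [:: 1; 2; 3; 4; 5; 6]%N s * (C 5%N 6%N + C 1%N 4%N - C 2%N 3%N)).
  rewrite /sorted_emonl /=; ring.
by rewrite k1 k2 k3 k4 k5 k6 k7 !mulr0; ring.
Qed.

End SelfDualWedge.

(** * Complementary minors of an orthonormal frame *)

Section OrthonormalFrame.
Variables (R : realType) (W : vectType R) (e : 7.-tuple 'Hom(W, R^o)).
Local Notation c := (coord7 e).

(** A block triangular determinant: the covectors of [I] vanish on [t], so expanding along their
    rows only removes vectors of [s]. *)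
Lemma emonl_block (I J : seq nat) (s t : seq W) : size s = size I ->
  (forall i x, i \in I -> x \in t -> c x i = 0) ->
  emonl e (I ++ J) (s ++ t) = emonl e I s * emonl e J t.
Proof.
elim: I s => [|i I IHI] s /= => [/size0nil -> _|sI It].
  by rewrite emonl_nil mul1r.
have It' j x : j \in I -> x \in t -> c x j = 0.
  by move=> jI; apply: It; rewrite inE jI orbT.
rewrite !emonl_cons (big_cat_nat (n := (size I).+1)) //=; last first.
  by rewrite size_cat ltnS leq_addr.
rewrite [X in _ + X]big_nat_cond [X in _ + X]big1 ?addr0 => [|k]; last first.
  rewrite andbT => /andP[Ik kIJ]; rewrite nth_cat sI ltnNge Ik /=.
  have [ts|ts] := ltnP (k - (size I).+1)%N (size t).
    by rewrite -/(coord7 e _ i) It ?mem_head ?mem_nth // mulr0 mul0r.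
  (* Past the end of [t], [nth] returns the default vector 0, which every covector kills. *)
  by rewrite nth_default // /coord_of linear0 mulr0 mul0r.
rewrite mulr_suml; apply: eq_big_nat => k /andP[_ kI].
rewrite nth_cat sI kI -[RHS]mulrA -IHI //; last first.
  by rewrite /del size_cat size_take size_drop sI kI; lia.
congr (_ * emonl e _ _); rewrite /del take_cat drop_cat sI kI.
case: ltnP => sk; first by rewrite catA.
rewrite (eqP (_ : (k.+1 - (size I).+1 == 0)%N)) ?drop0; last by lia.
by rewrite (drop_oversize (_ : size s <= k.+1)%N) ?sI // cats0.
Qed.

Lemma dotE x y : dot (c x) (c y) = \sum_(a < 7) tnth e a x * tnth e a y.
Proof.
rewrite !big_ord_recl big_ord0 /dot /coord7 /coord_of /=.
by rewrite !(tnth_nth 0) /= addr0 !addrA.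
Qed.

Variables (v : 'I_7 -> W).
Hypothesis v_orth : forall i j, dot (c (v i)) (c (v j)) = (i == j)%:R.

Definition frame_mx : 'M[R]_7 := \matrix_(a < 7, b < 7) (tnth e a (v b) : R).

Lemma frame_mxTM : frame_mx^T *m frame_mx = 1%:M.
Proof.
apply/matrixP => i j; rewrite !mxE -v_orth dotE; apply: eq_bigr => a _.
by rewrite !mxE.
Qed.

Lemma det_frame_sqr : \det frame_mx ^+ 2 = 1.
Proof. by rewrite expr2 -{1}det_tr -det_mulmx frame_mxTM det1. Qed.

(** The vector dual to the covector number [a]: an orthogonal matrix also has orthonormal rows,
    whence [coord_dual_vec]. *)
Definition dual_vec (a : nat) : W := \sum_b c (v b) a *: v b.

Lemma coord_dual_vec a b : (0 < a < 8)%N -> (0 < b < 8)%N ->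
  c (dual_vec a) b = (a == b)%:R.
Proof.
case/andP; case: a => // a _; rewrite ltnS => a7.
case/andP; case: b => // b _; rewrite ltnS => b7.
have /matrixP/(_ (Ordinal b7) (Ordinal a7)) := mulmx1C frame_mxTM.
rewrite !mxE -val_eqE /= eqSS eq_sym => <-.
rewrite /c /coord_of /dual_vec linear_sum; apply: eq_bigr => i _.
by rewrite linearZ /= !mxE !(tnth_nth 0) mulrC.
Qed.

Lemma dot_dual_vec w a : (0 < a < 8)%N -> dot (c w) (c (dual_vec a)) = c w a.
Proof.
move=> a8; rewrite /dot !coord_dual_vec //.
by case: a a8 => [|[|[|[|[|[|[|[|//]]]]]]]] //= _; ring.
Qed.

Definition frame_seq : seq W := [seq v (inord i) | i <- iota 0 7].

(** The transposed frame matrix turns coordinates into inner products with the frame. *)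
Lemma emonl_frame_mul (u : seq W) :
  \det frame_mx * emonl e (iota 1 7) u =
  \det (\matrix_(i < 7, j < 7) dot (c (v i)) (c (nth 0 u j))).
Proof.
rewrite -det_tr -det_mulmx; congr (\det _); apply/matrixP => i j.
rewrite !mxE dotE; apply: eq_bigr => a _; rewrite !mxE; congr (_ * _).
by rewrite (tnth_nth 0) nth_iota ?add1n.
Qed.

(* Jacobi's identity relating complementary minors of an orthogonal matrix. *)
Lemma jacobi_minor i1 i2 i3 i4 a1 a2 a3 :
  let I := [:: i1; i2; i3; i4] in let A := [:: a1; a2; a3] in
  all (fun i => 0 < i < 8)%N (I ++ A) -> uniq (I ++ A) ->
  (signed_sort (I ++ A)).2 = iota 1 7 ->
  emonl e I (take 4 frame_seq) =
  (-1) ^+ (signed_sort (I ++ A)).1 * \det frame_mx * emonl e A (drop 4 frame_seq).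
Proof.
move=> I A; rewrite all_cat cat_uniq => /andP[I8 A8] /and3P[_ AI uA] IA.
(* The full determinant on the first four frame vectors followed by these dual vectors is the minor
   with rows [I]. Multiplied by the transposed frame matrix it becomes block triangular and displays
   the complementary minor. *)
pose f := [seq dual_vec a | a <- A].
have If i x : i \in I -> x \in f -> c x i = 0.
  move=> iI /mapP[a aA ->]; rewrite coord_dual_vec ?(allP A8 a) ?(allP I8 i) //.
  by case: eqP => // ai; case/hasP: AI; exists a => //; rewrite ai.
have Af : emonl e A f = 1.
  move: uA; rewrite /= !inE !negb_or andbT => /andP[/andP[n12 n13] n23].
  move: A8 => /= /and4P[a18 a28 a38 _].
  rewrite emonl_laplace /= -!/(coord7 e _ _) !coord_dual_vec // !eqxx.
  rewrite (negbTE n12) (negbTE n13) (negbTE n23).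
  by rewrite ![_ == a1]eq_sym (negbTE n12) (negbTE n13) ![_ == a2]eq_sym (negbTE n23) /=; ring.
have blk := emonl_block A (erefl : size (take 4 frame_seq) = size I) If.
rewrite Af mulr1 emonl_sort IA in blk.
rewrite -blk -mulrA; congr (_ * _).
(* Since the squared determinant is 1, it is inserted twice: one copy is the sign in the formula,
   the other produces the Gram matrix. *)
rewrite -[LHS]mul1r -det_frame_sqr expr2 -mulrA emonl_frame_mul; congr (_ * _).
transitivity (\det (block_mx 1%:M
    (\matrix_(i < 4, j < 3) dot (c (v (lshift 3 i))) (c (nth 0 f j)))
    0 (\matrix_(i < 3, j < 3) dot (c (v (rshift 4 i))) (c (nth 0 f j)))
    : 'M[R]_(4 + 3))); last first.
  rewrite det_ublock det1 mul1r -det_tr; congr (\det _); apply/matrixP => i j.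
  rewrite !mxE /f (nth_map 0%N) // dot_dual_vec ?(allP A8) ?mem_nth //.
  rewrite /coord7 /coord_of; congr (_ _).
  rewrite (_ : rshift 4 j = inord (4 + j)); last first.
    by apply/val_inj; rewrite /= inordK // ltn_add2l.
  by case: j => [[|[|[|//]]] ?].
have hb (b : 'I_4) : [:: v (inord 0), v (inord 1), v (inord 2), v (inord 3) & f]`_b =
    v (lshift 3 b).
  have -> : lshift 3 b = inord b.
    by apply/val_inj; rewrite /= inordK // (leq_trans (ltn_ord b)).
  by case: b => [[|[|[|[|//]]]] ?].
have sl (a : 'I_4) : fintype.split (lshift 3 a) = inl a := unsplitK (inl a).
have sr (a : 'I_3) : fintype.split (rshift 4 a) = inr a := unsplitK (inr a).
congr (\det _); apply/matrixP => i j; rewrite -(@splitK 4 3 i) -(@splitK 4 3 j).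
case: (fintype.split (i : 'I_(4 + 3))) => a; case: (fintype.split (j : 'I_(4 + 3))) => b;
  rewrite !mxE /= ?(sl, sr) !mxE ?(sl, sr) ?mxE.
- by rewrite hb v_orth -val_eqE.
- by [].
- by rewrite hb v_orth -val_eqE /= gtn_eqF // ltn_addr.
- by [].
Qed.

(** Hodge duality term by term: each monomial of the dual 4-form is matched with the complementary
    monomial of phi, and the determinant is the orientation of the frame. *)
Lemma psi4_frame : let u i := c (v (inord i)) in
  psi4 (u 0%N) (u 1%N) (u 2%N) (u 3%N) =
  \det frame_mx * dot (cross (u 4%N) (u 5%N)) (u 6%N).
Proof.
move=> u; rewrite -emon_sum_g2_dual -emon_sum_g2 /emon_sum unlock /=.
have := jacobi_minor (i1 := 1) (i2 := 2) (i3 := 3) (i4 := 4) (a1 := 5) (a2 := 6) (a3 := 7).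
have := jacobi_minor (i1 := 1) (i2 := 2) (i3 := 6) (i4 := 7) (a1 := 3) (a2 := 4) (a3 := 5).
have := jacobi_minor (i1 := 3) (i2 := 4) (i3 := 6) (i4 := 7) (a1 := 1) (a2 := 2) (a3 := 5).
have := jacobi_minor (i1 := 1) (i2 := 3) (i3 := 7) (i4 := 5) (a1 := 4) (a2 := 2) (a3 := 6).
have := jacobi_minor (i1 := 4) (i2 := 2) (i3 := 7) (i4 := 5) (a1 := 1) (a2 := 3) (a3 := 6).
have := jacobi_minor (i1 := 1) (i2 := 4) (i3 := 5) (i4 := 6) (a1 := 2) (a2 := 3) (a3 := 7).
have := jacobi_minor (i1 := 2) (i2 := 3) (i3 := 5) (i4 := 6) (a1 := 1) (a2 := 4) (a3 := 7).
rewrite /= => -> // -> // -> // -> // -> // -> // -> //.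
by ring.
Qed.

End OrthonormalFrame.

(** * Smooth functions and directional derivatives *)

Section SmoothFunctions.
Variable R : realType.

Lemma continuous_rV (T : topologicalType) n (F : T -> 'rV[R]_n) :
  (forall k, continuous (fun x => F x 0 k)) -> continuous F.
Proof.
move=> Fc x A [P nP PA]; rewrite /nbhs /=.
have : \forall y \near x, forall k, P 0 k (F y 0 k).
  apply: (filter_forall (I := 'I_n) (f := fun k y => P 0 k (F y 0 k))) => k.
  exact: (Fc k x _ (nP 0 k)).
by apply: filterS => y Py; apply: PA => i j; rewrite ord1.
Qed.

Lemma continuous_sum (T : topologicalType) (I : Type) (r : seq I) (F : I -> T -> R) :
  (forall i, continuous (F i)) -> continuous (fun x => \sum_(i <- r) F i x).
Proof.
move=> Fc; elim: r => [|i r IHr].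
  under eq_fun do rewrite big_nil.
  by move=> x; exact: cst_continuous.
under eq_fun do rewrite big_cons.
by move=> x; apply: continuousD; [exact: Fc | exact: IHr].
Qed.

Variable W : vectType R.
Implicit Types (f g : W -> R) (u v x : W).

(** The difference quotient at [t] on the line through [x] is the one at 0 on the line through
    [x + t *: v]. *)
Lemma derivable_line v f :
  (forall x, derivable (fun t : R => f (x + t *: v)) 0 1) ->
  forall x (t : R), is_derive t 1 (fun t : R => f (x + t *: v)) (ddir v f (x + t *: v)).
Proof.
move=> df x t.
have E : (fun h : R => h^-1 *: (((fun t : R => f (x + t *: v)) \o shift t) (h *: 1) -
      f (x + t *: v))) =
    (fun h : R => h^-1 *: (((fun s : R => f (x + t *: v + s *: v)) \o shift 0) (h *: 1) -
      f (x + t *: v + 0 *: v))).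
  apply/funext => h /=; rewrite scale0r !addr0 [h%:A]mulr1.
  by rewrite scalerDl addrA addrAC.
apply: DeriveDef; first by rewrite /derivable /= E; exact: df.
by rewrite /ddir derive1E /derive /= E.
Qed.

Lemma Ck0_affine f n (b : 'I_n -> W) x : Ck 0 f ->
  continuous (fun z : 'rV[R]_n => f (x + \sum_i z 0 i *: b i)).
Proof.
move=> fc; pose c (w : W) : 'rV[R]_(\dim {:W}) := \row_k coord (vbasis {:W}) k w.
have E : (fun z : 'rV[R]_n => f (x + \sum_i z 0 i *: b i)) =
    (fun z : 'rV[R]_(\dim {:W}) => f (\sum_i z 0 i *: tnth (vbasis {:W}) i)) \o
    (fun z : 'rV[R]_n => c (x + \sum_i z 0 i *: b i)).
  apply/funext => z /=; congr f; rewrite {1}(coord_vbasis (memvf (x + _))).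
  by apply: eq_bigr => k _; rewrite mxE (tnth_nth 0).
rewrite E => z; apply: continuous_comp; last exact: fc.
apply: continuous_rV => {z E} k.
rewrite [X in continuous X](_ : _ = fun z : 'rV[R]_n => coord (vbasis {:W}) k x +
    \sum_i z 0 i * coord (vbasis {:W}) k (b i)); last first.
  apply/funext => z; rewrite mxE linearD linear_sum; congr (_ + _).
  by apply: eq_bigr => i _; rewrite linearZ.
move=> z; apply: continuousD; first exact: cst_continuous.
apply: (continuous_sum (F := fun i (z : 'rV[R]_n) => z 0 i * _)) => i {}z.
by apply: continuousM; [exact: coord_continuous | exact: cst_continuous].
Qed.

Lemma Ck0_eps f u v x (e : R) : Ck 0 f -> 0 < e -> exists2 d : R, 0 < d &
  forall s t, `|s| < d -> `|t| < d -> `|f (x + s *: u + t *: v) - f x| < e.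
Proof.
move=> fc e0.
have /(_ 0) := @Ck0_affine f 2 (fun i => if i == 0 then u else v) x fc.
move=> /cvgrPdist_lt /(_ e e0) /nbhs_ballP [d /= d0 dP]; exists d => // s t sd td.
have := dP (\row_i (if i == 0 then s else t)) => /=.
rewrite !big_ord_recl !big_ord0 !mxE /= !scale0r !addr0 addrA distrC; apply.
split => // i j; rewrite !mxE /ball /= sub0r normrN; by case: ifP.
Qed.

End SmoothFunctions.

Section DirectionalDerivatives.
Variables (R : realType) (W : vectType R).
Implicit Types (f g : W -> R) (u v x : W).

Lemma smooth_Ck0 f : smooth f -> Ck 0 f.
Proof. by move=> /(_ 0%N). Qed.

Lemma smooth_derivable f v : smooth f ->
  forall x, derivable (fun t : R => f (x + t *: v)) 0 1.
Proof. by move=> /(_ 1%N) /(_ v) []. Qed.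

Lemma smooth_ddir f v : smooth f -> smooth (ddir v f).
Proof. by move=> sf n; have [] := sf n.+1 v. Qed.

Lemma smooth_is_derive f v x (t : R) : smooth f ->
  is_derive t 1 (fun s : R => f (x + s *: v)) (ddir v f (x + t *: v)).
Proof. by move=> sf; apply: derivable_line => y; exact: smooth_derivable. Qed.

Lemma ddirE f v x d : is_derive (0 : R) 1 (fun s : R => f (x + s *: v)) d ->
  ddir v f x = d.
Proof. by move=> fd; rewrite /ddir derive1E derive_val. Qed.

Lemma is_derive_ddir f v x : (forall x, derivable (fun t : R => f (x + t *: v)) 0 1) ->
  is_derive (0 : R) 1 (fun s : R => f (x + s *: v)) (ddir v f x).
Proof. by move=> df; have := derivable_line df x 0; rewrite scale0r addr0. Qed.

Lemma smooth_is_derive0 f v x : smooth f ->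
  is_derive (0 : R) 1 (fun s : R => f (x + s *: v)) (ddir v f x).
Proof. by move=> sf; apply: is_derive_ddir; exact: smooth_derivable. Qed.

Lemma CkD n f g : Ck n f -> Ck n g -> Ck n (fun x => f x + g x).
Proof.
elim: n f g => [|n IHn] f g fn gn.
  by move=> z; apply: continuousD; [exact: fn | exact: gn].
move=> v; have [df fn'] := fn v; have [dg gn'] := gn v.
have D x : is_derive (0 : R) 1 (fun s : R => f (x + s *: v) + g (x + s *: v))
    (ddir v f x + ddir v g x).
  exact: (is_deriveD (is_derive_ddir x df) (is_derive_ddir x dg)).
split=> [x|]; first by have [] := D x.
rewrite (_ : ddir v _ = fun x => ddir v f x + ddir v g x); first exact: IHn.
by apply/funext => x; exact/ddirE.
Qed.

Lemma smoothD f g : smooth f -> smooth g -> smooth (fun x => f x + g x).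
Proof. by move=> sf sg n; apply: CkD. Qed.

Lemma ddirD v f g x : smooth f -> smooth g ->
  ddir v (fun x => f x + g x) x = ddir v f x + ddir v g x.
Proof.
move=> sf sg; apply/ddirE.
exact: (is_deriveD (smooth_is_derive0 v x sf) (smooth_is_derive0 v x sg)).
Qed.

Lemma is_derive_mulr (p q : R -> R) (dp dq : R) : is_derive (0 : R) 1 p dp ->
  is_derive (0 : R) 1 q dq -> is_derive (0 : R) 1 (fun s => p s * q s) (dp * q 0 + p 0 * dq).
Proof.
move=> Dp Dq; have := is_deriveM Dp Dq.
by rewrite /GRing.scale /= addrC [q 0 * _]mulrC.
Qed.

Lemma smoothM f g : smooth f -> smooth g -> smooth (fun x => f x * g x).
Proof.
move=> sf sg n; elim: n f g sf sg => [|n IHn] f g sf sg.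
  move=> z; apply: continuousM; [exact: (smooth_Ck0 sf) | exact: (smooth_Ck0 sg)].
move=> v; have D x : is_derive (0 : R) 1 (fun s : R => f (x + s *: v) * g (x + s *: v))
    (ddir v f x * g x + f x * ddir v g x).
  have := is_derive_mulr (smooth_is_derive0 v x sf)
                         (smooth_is_derive0 v x sg).
  by rewrite scale0r addr0.
split=> [x|]; first by have [] := D x.
rewrite (_ : ddir v _ = fun x => ddir v f x * g x + f x * ddir v g x).
  by apply: CkD; apply: IHn => //; exact: smooth_ddir.
by apply/funext => x; exact/ddirE.
Qed.

Lemma ddirM v f g x : smooth f -> smooth g ->
  ddir v (fun x => f x * g x) x = ddir v f x * g x + f x * ddir v g x.
Proof.
move=> sf sg; apply/ddirE.
have := is_derive_mulr (smooth_is_derive0 v x sf)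
                       (smooth_is_derive0 v x sg).
by rewrite scale0r addr0.
Qed.

Lemma ddir_cst v (c : R) : ddir v (fun=> c) = fun=> 0.
Proof. by apply/funext => x; apply/ddirE; exact: is_derive_cst. Qed.

Lemma smooth_cst (c : R) : smooth (fun _ : W => c).
Proof.
move=> n; elim: n c => [|n IHn] c; first by move=> z; exact: cst_continuous.
by move=> v; rewrite ddir_cst; split=> // x; exact: derivable_cst.
Qed.

Lemma line_mvt f v x (t : R) : smooth f -> exists2 s : R, `|s| <= `|t| &
  f (x + t *: v) - f x = t * ddir v f (x + s *: v).
Proof.
move=> sf; pose p s := f (x + s *: v); have p0 : p 0 = f x by rewrite /p scale0r addr0.
have dp (s : R) : is_derive s 1 p (ddir v f (x + s *: v)) by exact: smooth_is_derive.
have cp a b : {within `[a, b], continuous p}.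
  by apply: derivable_within_continuous => s _; have [] := dp s.
rewrite -p0 -/(p t); case: (leP 0 t) => t0.
  have [s + E] := MVT_segment t0 (fun s _ => dp s) (cp 0 t).
  rewrite in_itv /= => /andP[s0 st]; exists s; first by rewrite !ger0_norm.
  by rewrite E subr0 mulrC.
have [s + E] := MVT_segment (ltW t0) (fun s _ => dp s) (cp t 0).
rewrite in_itv /= => /andP[ts s0]; exists s.
  by rewrite !ler0_norm ?lerN2 // ltW.
by rewrite -opprB E sub0r mulrN opprK mulrC.
Qed.

End DirectionalDerivatives.

Section LinearPullback.
Variables (R : realType) (W W' : vectType R) (L : W -> W').
Hypothesis L_linear : forall c u v, L (c *: u + v) = c *: L u + L v.

Let LD u v : L (u + v) = L u + L v.
Proof. by rewrite -[u]scale1r L_linear !scale1r. Qed.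

Let L0 : L 0 = 0.
Proof. by apply: (addrI (L 0)); rewrite -LD !addr0. Qed.

Let LZ c u : L (c *: u) = c *: L u.
Proof. by rewrite -[c *: u]addr0 L_linear L0 addr0. Qed.

Lemma ddir_affine v (f : W' -> R) (a : W') x :
  ddir v (fun y => f (L y + a)) x = ddir (L v) f (L x + a).
Proof.
rewrite /ddir (_ : (fun t : R => f (L (x + t *: v) + a)) =
  fun t : R => f (L x + a + t *: L v)) //.
by apply/funext => t; rewrite LD LZ addrAC.
Qed.

Lemma smooth_affine (f : W' -> R) (a : W') : smooth f -> smooth (fun y => f (L y + a)).
Proof.
move=> + n; elim: n f => [|n IHn] f sf.
  have E : (fun z : 'rV[R]_(\dim {:W}) =>
              f (L (\sum_i z 0 i *: tnth (vbasis {:W}) i) + a)) =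
           (fun z => f (a + \sum_i z 0 i *: L (tnth (vbasis {:W}) i))).
    apply/funext => z; rewrite addrC (big_morph L LD L0); congr (f (_ + _)).
    by apply: eq_bigr => i _; rewrite LZ.
  rewrite /= E.
  exact: (Ck0_affine (b := fun i => L (tnth (vbasis {:W}) i)) (x := a) (smooth_Ck0 sf)).
move=> v; split=> [x|].
  rewrite (_ : (fun t => _) = (fun t => f (L x + a + t *: L v))).
    exact: smooth_derivable.
  by apply/funext => t; rewrite LD LZ addrAC.
rewrite (_ : ddir v _ = fun y => ddir (L v) f (L y + a)); first exact/IHn/smooth_ddir.
by apply/funext => x; exact: ddir_affine.
Qed.

Lemma ddir_pullback v (f : W' -> R) x : ddir v (fun y => f (L y)) x = ddir (L v) f (L x).
Proof. by have := ddir_affine v f 0 x; under eq_fun do rewrite addr0; rewrite addr0. Qed.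

Lemma smooth_pullback (f : W' -> R) : smooth f -> smooth (fun y => f (L y)).
Proof. by move=> /(smooth_affine 0); under eq_fun do rewrite addr0. Qed.

End LinearPullback.

Section Translation.
Variables (R : realType) (W : vectType R) (l : W).

Lemma ddir_shift v (f : W -> R) x : ddir v (fun y => f (y + l)) x = ddir v f (x + l).
Proof. exact: (ddir_affine (L := id)). Qed.

Lemma smooth_shift (f : W -> R) : smooth f -> smooth (fun y => f (y + l)).
Proof. exact: (smooth_affine (L := id)). Qed.

End Translation.

(* Keeps unification from unfolding limits and complex arithmetic. *)
#[local] Opaque ddir.

(** * Linearity in the direction and symmetry of second derivatives *)

Section SecondDerivatives.
Variables (R : realType) (W : vectType R).
Implicit Types (f g : W -> R) (u v x : W).

Lemma eq_eps (a b : R) : (forall e, 0 < e -> `|a - b| < e) -> a = b.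
Proof.
move=> ab; apply/eqP; rewrite -subr_eq0 -normr_le0 leNgt; apply/negP => /ab.
by rewrite ltxx.
Qed.

Lemma eps2 (p a b e : R) : `|p - a| < e / 2 -> `|p - b| < e / 2 -> `|a - b| < e.
Proof. by rewrite !ltr_norml => /andP[? ?] /andP[? ?]; apply/andP; split; lra. Qed.

Lemma eps3 (p q a b c e : R) :
  `|p + q - a| < e / 3 -> `|p - b| < e / 3 -> `|q - c| < e / 3 -> `|a - (b + c)| < e.
Proof.
by rewrite !ltr_norml => /andP[? ?] /andP[? ?] /andP[? ?]; apply/andP; split; lra.
Qed.

Lemma ddirZr (c : R) v f x : smooth f -> ddir (c *: v) f x = c * ddir v f x.
Proof.
move=> sf; apply: ddirE.
have -> : (fun s : R => f (x + s *: (c *: v))) =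
    (fun s : R => f (x + s *: v)) \o (fun s : R => s * c).
  by apply/funext => s; rewrite /= scalerA.
have D : is_derive (0 : R) 1 (fun s : R => s * c) c.
  have := is_derive_mulr (is_derive_id (0 : R) 1) (is_derive_cst c (0 : R) 1).
  by rewrite mul1r mul0r addr0.
have := @is_derive1_comp _ (fun s : R => f (x + s *: v)) (fun s : R => s * c) 0 _ _
   (smooth_is_derive v x (0 * c) sf) D.
by rewrite mul0r scale0r addr0 mulrC.
Qed.

(** [Ck] only provides derivatives along lines, so additivity needs an argument: the mean value
    theorem along [u + v] and along the broken path [u], then [v], the intermediate points being
    brought to [x] by continuity of the derivatives. *)
Lemma ddirDr u v f x : smooth f -> ddir (u + v) f x = ddir u f x + ddir v f x.
Proof.
move=> sf; apply: eq_eps => e e0; have e3 : 0 < e / 3 by rewrite divr_gt0.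
have [d1 d10 D1] := @Ck0_eps _ _ _ (u + v) 0 x _ (smooth_Ck0 (smooth_ddir (u + v) sf)) e3.
have [d2 d20 D2] := @Ck0_eps _ _ _ u v x _ (smooth_Ck0 (smooth_ddir u sf)) e3.
have [d3 d30 D3] := @Ck0_eps _ _ _ u v x _ (smooth_Ck0 (smooth_ddir v sf)) e3.
pose t := Num.min d1 (Num.min d2 d3) / 2.
have t0 : 0 < t by rewrite divr_gt0 // !lt_min d10 d20 d30.
have td : t < Num.min d1 (Num.min d2 d3).
  by rewrite /t ltr_pdivrMr // ltr_pMr ?ltr1n // !lt_min d10 d20 d30.
move: td; rewrite !lt_min => /and3P[td1 td2 td3].
have [s1 s1t E1] := line_mvt (u + v) x t sf.
have [s2 s2t E2] := line_mvt u x t sf.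
have [s3 s3t E3] := line_mvt v (x + t *: u) t sf.
rewrite (gtr0_norm t0) in s1t s2t s3t.
have E : ddir (u + v) f (x + s1 *: (u + v)) =
    ddir u f (x + s2 *: u) + ddir v f (x + t *: u + s3 *: v).
  apply: (mulfI (lt0r_neq0 t0)); rewrite mulrDr -E1 -E2 -E3 scalerDr addrA.
  by ring.
have := D1 s1 0 (le_lt_trans s1t td1); rewrite normr0 scaler0 addr0 => /(_ d10) F1.
have := D2 s2 0 (le_lt_trans s2t td2); rewrite normr0 scale0r addr0 => /(_ d20) F2.
have := D3 t s3; rewrite (gtr0_norm t0) => /(_ td3 (le_lt_trans s3t td3)) F3.
by rewrite E in F1; exact: eps3 F1 F2 F3.
Qed.

Lemma second_difference u v f x (t : R) : smooth f ->
  exists s1 s2 : R, [/\ `|s1| <= `|t|, `|s2| <= `|t| &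
  f (x + t *: u + t *: v) - f (x + t *: u) - (f (x + t *: v) - f x) =
  t * t * ddir v (ddir u f) (x + s1 *: u + s2 *: v)].
Proof.
move=> sf; pose p s := f (x + t *: v + s *: u) - f (x + s *: u).
pose dp s := ddir u f (x + t *: v + s *: u) - ddir u f (x + s *: u).
have Dp (s : R) : is_derive s 1 p (dp s).
  exact: (is_deriveB (smooth_is_derive u _ s sf) (smooth_is_derive u x s sf)).
have cp a b : {within `[a, b], continuous p}.
  by apply: derivable_within_continuous => s _; have [] := Dp s.
have [s1 s1t E1] : exists2 s, `|s| <= `|t| & p t - p 0 = t * dp s.
  case: (leP 0 t) => t0.
    have [s + E] := MVT_segment t0 (fun s _ => Dp s) (cp 0 t).
    rewrite in_itv /= => /andP[s0 st]; exists s; first by rewrite !ger0_norm.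
    by rewrite E subr0 mulrC.
  have [s + E] := MVT_segment (ltW t0) (fun s _ => Dp s) (cp t 0).
  rewrite in_itv /= => /andP[ts s0]; exists s.
    by rewrite !ler0_norm ?lerN2 // ltW.
  by rewrite -opprB E sub0r mulrN opprK mulrC.
have [s2 s2t E2] := line_mvt v (x + s1 *: u) t (smooth_ddir u sf).
exists s1, s2; split=> //; rewrite -mulrA -E2.
move: E1; rewrite /p /dp scale0r !addr0 [x + t *: v + t *: u]addrAC.
by rewrite [x + t *: v + s1 *: u]addrAC.
Qed.

(** Schwarz's theorem: the second difference is symmetric in [u] and [v], and for small [t] its
    quotient by t^2 is close to either mixed derivative at [x]. *)
Lemma ddir_comm u v f x : smooth f -> ddir u (ddir v f) x = ddir v (ddir u f) x.
Proof.
move=> sf; apply: eq_eps => e e0; have e2 : 0 < e / 2 by rewrite divr_gt0.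
have [d1 d10 D1] := @Ck0_eps _ _ _ u v x _ (smooth_Ck0 (smooth_ddir v (smooth_ddir u sf))) e2.
have [d2 d20 D2] := @Ck0_eps _ _ _ v u x _ (smooth_Ck0 (smooth_ddir u (smooth_ddir v sf))) e2.
pose t := Num.min d1 d2 / 2.
have t0 : 0 < t by rewrite divr_gt0 // !lt_min d10 d20.
have td : t < Num.min d1 d2.
  by rewrite /t ltr_pdivrMr // ltr_pMr ?ltr1n // !lt_min d10 d20.
move: td; rewrite !lt_min => /andP[td1 td2].
have [s1 [s2 [s1t s2t E1]]] := second_difference u v x t sf.
have [s3 [s4 [s3t s4t E2]]] := second_difference v u x t sf.
rewrite (gtr0_norm t0) in s1t s2t s3t s4t.
have E : ddir v (ddir u f) (x + s1 *: u + s2 *: v) =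
         ddir u (ddir v f) (x + s3 *: v + s4 *: u).
  apply: (mulfI (lt0r_neq0 (mulr_gt0 t0 t0))).
  apply: etrans (esym E1) (etrans _ E2).
  by rewrite [x + t *: v + t *: u]addrAC !opprB addrACA [RHS]addrACA [- _ + - _]addrC.
have F1 := D1 s1 s2 (le_lt_trans s1t td1) (le_lt_trans s2t td1).
have F2 := D2 s3 s4 (le_lt_trans s3t td2) (le_lt_trans s4t td2).
by rewrite E in F1; exact: eps2 F2 F1.
Qed.

End SecondDerivatives.

(** * Complex-valued and matrix-valued functions *)

Section ComplexFunctions.
Variables (R : realType) (W : vectType R).
Local Notation C := R[i].
Implicit Types (f g : W -> C) (v x : W).

Definition csmooth f : Prop :=
  smooth (fun x => complex.Re (f x)) /\ smooth (fun x => complex.Im (f x)).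

Definition cdir v f x : C :=
  ddir v (fun y => complex.Re (f y)) x +i* ddir v (fun y => complex.Im (f y)) x.

Lemma ReD (a b : C) : complex.Re (a + b) = complex.Re a + complex.Re b.
Proof. by case: a; case: b. Qed.

Lemma ImD (a b : C) : complex.Im (a + b) = complex.Im a + complex.Im b.
Proof. by case: a; case: b. Qed.

(** The difference is written with a factor [- 1], so that sums and products are the only operations
    to differentiate. *)
Lemma ReM (a b : C) :
  complex.Re (a * b) = complex.Re a * complex.Re b + - 1 * (complex.Im a * complex.Im b).
Proof. by rewrite mulN1r; case: a; case: b. Qed.

Lemma ImM (a b : C) :
  complex.Im (a * b) = complex.Re a * complex.Im b + complex.Im a * complex.Re b.
Proof. by case: a; case: b. Qed.

Lemma csmooth_cst (c : C) : csmooth (fun=> c).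
Proof. by split; exact: smooth_cst. Qed.

Lemma csmoothD f g : csmooth f -> csmooth g -> csmooth (fun x => f x + g x).
Proof.
move=> [fr fi] [gr gi]; split.
  by under eq_fun do rewrite ReD; exact: smoothD.
by under eq_fun do rewrite ImD; exact: smoothD.
Qed.

Lemma csmoothM f g : csmooth f -> csmooth g -> csmooth (fun x => f x * g x).
Proof.
move=> [fr fi] [gr gi]; split.
  under eq_fun do rewrite ReM; apply: smoothD; first exact: smoothM.
  by apply: smoothM; [exact: smooth_cst | exact: smoothM].
by under eq_fun do rewrite ImM; apply: smoothD; exact: smoothM.
Qed.

Lemma csmoothN f : csmooth f -> csmooth (fun x => - f x).
Proof.
move=> sf; under eq_fun do rewrite -mulN1r.
exact: csmoothM (csmooth_cst _) sf.
Qed.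

Lemma csmooth_sum (I : Type) (r : seq I) (P : pred I) (F : I -> W -> C) :
  (forall i, csmooth (F i)) -> csmooth (fun x => \sum_(i <- r | P i) F i x).
Proof.
move=> sF; elim: r => [|i r IHr].
  by under eq_fun do rewrite big_nil; exact: csmooth_cst.
under eq_fun do rewrite big_cons; case: (P i) => //.
exact: csmoothD.
Qed.

Lemma csmooth_cdir v f : csmooth f -> csmooth (cdir v f).
Proof. by move=> [fr fi]; split; exact: smooth_ddir. Qed.

Lemma cdirD v f g x : csmooth f -> csmooth g ->
  cdir v (fun x => f x + g x) x = cdir v f x + cdir v g x.
Proof.
move=> [fr fi] [gr gi]; rewrite /cdir.
under eq_fun do rewrite ReD; under [X in _ +i* ddir _ X _]eq_fun do rewrite ImD.
by rewrite !ddirD.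
Qed.

Lemma cdirM v f g x : csmooth f -> csmooth g ->
  cdir v (fun x => f x * g x) x = cdir v f x * g x + f x * cdir v g x.
Proof.
move=> [fr fi] [gr gi]; rewrite /cdir.
under eq_fun do rewrite ReM; under [X in _ +i* ddir _ X _]eq_fun do rewrite ImM.
have s1 := smooth_cst W (- 1 : R); have sii := smoothM fi gi.
rewrite ddirD; [|exact: smoothM|exact: smoothM].
rewrite ddirD; [|exact: smoothM|exact: smoothM].
rewrite !ddirM // ddir_cst.
case: (f x) => a b; case: (g x) => c d; apply/eqP; rewrite eq_complex /=.
by apply/andP; split; apply/eqP; ring.
Qed.

Lemma cdir_cst v (c : C) x : cdir v (fun=> c) x = 0.
Proof. by rewrite /cdir !ddir_cst. Qed.

Lemma cdirN v f x : csmooth f -> cdir v (fun x => - f x) x = - cdir v f x.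
Proof.
move=> sf; under eq_fun do rewrite -mulN1r.
by rewrite cdirM //; [rewrite cdir_cst mul0r add0r mulN1r | exact: csmooth_cst].
Qed.

Lemma cdir_sum v (I : Type) (r : seq I) (F : I -> W -> C) x :
  (forall i, csmooth (F i)) ->
  cdir v (fun x => \sum_(i <- r) F i x) x = \sum_(i <- r) cdir v (F i) x.
Proof.
move=> sF; elim: r => [|i r IHr].
  by under eq_fun do rewrite big_nil; rewrite cdir_cst big_nil.
under eq_fun do rewrite big_cons; rewrite big_cons cdirD ?IHr //.
exact: csmooth_sum.
Qed.

Lemma cdir_comm u v f x : csmooth f -> cdir u (cdir v f) x = cdir v (cdir u f) x.
Proof.
move=> [fr fi].
exact: (f_equal2 (fun a b => a +i* b) (ddir_comm u v x fr) (ddir_comm u v x fi)).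
Qed.

End ComplexFunctions.

Section MatrixFunctions.
Variables (R : realType) (W : vectType R).
Local Notation C := R[i].
Implicit Types (v x : W).

Lemma ddir_mxE m n v (f : W -> 'M[C]_(m, n)) x i j :
  ddir_mx v f x i j = cdir v (fun y => f y i j) x.
Proof. by rewrite mxE. Qed.

Lemma smooth_mxP m n (f : W -> 'M[C]_(m, n)) :
  smooth_mx f <-> forall i j, csmooth (fun x => f x i j).
Proof. by []. Qed.

Lemma smooth_mx_cst m n (A : 'M[C]_(m, n)) : smooth_mx (fun _ : W => A).
Proof. by move=> i j; exact: csmooth_cst. Qed.

Lemma smooth_mxD m n (f g : W -> 'M[C]_(m, n)) :
  smooth_mx f -> smooth_mx g -> smooth_mx (fun x => f x + g x).
Proof.
move=> sf sg; apply/smooth_mxP => i j; under eq_fun do rewrite mxE.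
exact: csmoothD (sf i j) (sg i j).
Qed.

Lemma smooth_mxN m n (f : W -> 'M[C]_(m, n)) :
  smooth_mx f -> smooth_mx (fun x => - f x).
Proof.
move=> sf; apply/smooth_mxP => i j; under eq_fun do rewrite mxE.
exact: csmoothN (sf i j).
Qed.

Lemma smooth_mxB m n (f g : W -> 'M[C]_(m, n)) :
  smooth_mx f -> smooth_mx g -> smooth_mx (fun x => f x - g x).
Proof. by move=> sf sg; apply: smooth_mxD => //; exact: smooth_mxN. Qed.

Lemma smooth_mxM m n p (f : W -> 'M[C]_(m, n)) (g : W -> 'M[C]_(n, p)) :
  smooth_mx f -> smooth_mx g -> smooth_mx (fun x => f x *m g x).
Proof.
move=> sf sg; apply/smooth_mxP => i j; under eq_fun do rewrite mxE.
by apply: csmooth_sum => k; exact: csmoothM (sf i k) (sg k j).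
Qed.

Lemma csmooth_tr n (f : W -> 'M[C]_n) : smooth_mx f -> csmooth (fun x => \tr (f x)).
Proof. by move=> sf; apply: csmooth_sum => k; exact: sf. Qed.

Lemma smooth_ddir_mx m n v (f : W -> 'M[C]_(m, n)) :
  smooth_mx f -> smooth_mx (ddir_mx v f).
Proof.
move=> sf; apply/smooth_mxP => i j; under eq_fun do rewrite ddir_mxE.
exact: csmooth_cdir (sf i j).
Qed.

Lemma ddir_mxD m n v (f g : W -> 'M[C]_(m, n)) x : smooth_mx f -> smooth_mx g ->
  ddir_mx v (fun x => f x + g x) x = ddir_mx v f x + ddir_mx v g x.
Proof.
move=> sf sg; apply/matrixP => i j; rewrite [RHS]mxE !ddir_mxE.
under eq_fun do rewrite mxE.
exact: cdirD (sf i j) (sg i j).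
Qed.

Lemma ddir_mxN m n v (f : W -> 'M[C]_(m, n)) x : smooth_mx f ->
  ddir_mx v (fun x => - f x) x = - ddir_mx v f x.
Proof.
move=> sf; apply/matrixP => i j; rewrite [RHS]mxE !ddir_mxE.
under eq_fun do rewrite mxE.
exact: cdirN (sf i j).
Qed.

Lemma ddir_mxB m n v (f g : W -> 'M[C]_(m, n)) x : smooth_mx f -> smooth_mx g ->
  ddir_mx v (fun x => f x - g x) x = ddir_mx v f x - ddir_mx v g x.
Proof. by move=> sf sg; rewrite ddir_mxD ?ddir_mxN //; exact: smooth_mxN. Qed.

Lemma ddir_mxM m n p v (f : W -> 'M[C]_(m, n)) (g : W -> 'M[C]_(n, p)) x :
  smooth_mx f -> smooth_mx g ->
  ddir_mx v (fun x => f x *m g x) x = ddir_mx v f x *m g x + f x *m ddir_mx v g x.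
Proof.
move=> sf sg; apply/matrixP => i j; rewrite ddir_mxE !mxE.
under eq_fun do rewrite mxE.
rewrite cdir_sum => [|k]; last exact: csmoothM (sf i k) (sg k j).
rewrite -big_split; apply: eq_bigr => k _ /=.
by rewrite cdirM ?ddir_mxE.
Qed.

Lemma ddir_mx_cst m n v (A : 'M[C]_(m, n)) x : ddir_mx v (fun=> A) x = 0.
Proof. by apply/matrixP => i j; rewrite ddir_mxE mxE cdir_cst. Qed.

Lemma cdir_tr n v (f : W -> 'M[C]_n) x : smooth_mx f ->
  cdir v (fun x => \tr (f x)) x = \tr (ddir_mx v f x).
Proof.
move=> sf; rewrite /mxtrace cdir_sum => [|k]; last exact: sf.
by apply: eq_bigr => k _; rewrite ddir_mxE.
Qed.

Lemma ddir_mxDr m n u v (f : W -> 'M[C]_(m, n)) x : smooth_mx f ->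
  ddir_mx (u + v) f x = ddir_mx u f x + ddir_mx v f x.
Proof.
move=> sf; apply/matrixP => i j; rewrite !mxE; have [sr si] := sf i j.
by rewrite !ddirDr.
Qed.

Lemma ddir_mxZr m n (c : R) v (f : W -> 'M[C]_(m, n)) x : smooth_mx f ->
  ddir_mx (c *: v) f x = c%:C *: ddir_mx v f x.
Proof.
move=> sf; apply/matrixP => i j; rewrite !mxE; have [sr si] := sf i j.
rewrite !ddirZr //; apply/eqP; rewrite eq_complex /=.
by apply/andP; split; apply/eqP; ring.
Qed.

Lemma ddir_mx_shift m n l v (f : W -> 'M[C]_(m, n)) x :
  ddir_mx v (fun y => f (y + l)) x = ddir_mx v f (x + l).
Proof.
apply/matrixP => i j; rewrite !mxE.
rewrite (ddir_shift l v (fun y => complex.Re (f y i j))).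
by rewrite (ddir_shift l v (fun y => complex.Im (f y i j))).
Qed.

Lemma smooth_mx_shift m n l (f : W -> 'M[C]_(m, n)) :
  smooth_mx f -> smooth_mx (fun y => f (y + l)).
Proof.
move=> sf i j; have [sr si] := sf i j; split.
  exact: (smooth_shift l sr).
exact: (smooth_shift l si).
Qed.

End MatrixFunctions.

Section MatrixPullback.
Variables (R : realType) (W W' : vectType R) (L : W -> W').
Hypothesis L_linear : forall c u v, L (c *: u + v) = c *: L u + L v.

Lemma ddir_mx_pullback m n v (f : W' -> 'M[R[i]]_(m, n)) x :
  ddir_mx v (fun y => f (L y)) x = ddir_mx (L v) f (L x).
Proof.
apply/matrixP => i j; rewrite !mxE.
rewrite (ddir_pullback L_linear v (fun y => complex.Re (f y i j))).
by rewrite (ddir_pullback L_linear v (fun y => complex.Im (f y i j))).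
Qed.

Lemma smooth_mx_pullback m n (f : W' -> 'M[R[i]]_(m, n)) :
  smooth_mx f -> smooth_mx (fun y => f (L y)).
Proof.
move=> sf i j; have [sr si] := sf i j.
by split; [exact: (smooth_pullback L_linear sr) | exact: (smooth_pullback L_linear si)].
Qed.

End MatrixPullback.

#[local] Opaque ddir_mx cdir.

Lemma ddir_mx_comm (R : realType) (W : vectType R) m n u v (f : W -> 'M[R[i]]_(m, n)) x :
  smooth_mx f -> ddir_mx u (ddir_mx v f) x = ddir_mx v (ddir_mx u f) x.
Proof.
move=> sf; apply/matrixP => i j.
have E w : (fun y => ddir_mx w f y i j) = cdir w (fun y => f y i j).
  by apply/funext => y; rewrite ddir_mxE.
have H := cdir_comm (f := fun y => f y i j) u v x (sf i j).
have H1 := ddir_mxE u (ddir_mx v f) x i j.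
have H2 := ddir_mxE v (ddir_mx u f) x i j.
have H3 := f_equal (fun g => cdir u g x) (E v).
have H4 := f_equal (fun g => cdir v g x) (E u).
exact: (etrans H1 (etrans H3 (etrans H (etrans (esym H4) (esym H2))))).
Qed.

(** * Curvature and Chern-Simons transgression *)

Section Curvature.
Variables (R : realType) (W : vectType R) (r : nat).
Local Notation C := R[i].
Local Notation M := 'M[C]_r.
Implicit Types (A B : W -> W -> M) (X Y Z x : W) (N P Q : W -> M).

Definition curv A X Y x : M :=
  ddir_mx X (A ^~ Y) x - ddir_mx Y (A ^~ X) x + (A x X *m A x Y - A x Y *m A x X).

Lemma curvatureE A x (v : 'I_2 -> W) : curvature A x v = curv A (v 0) (v 1) x.
Proof. by []. Qed.

Definition smooth_form A := forall v, smooth_mx (A ^~ v).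

(** Covariant derivative of an endomorphism of the bundle, on which A acts by commutator. *)
Definition cov A X N x : M := ddir_mx X N x + (A x X *m N x - N x *m A x X).

Lemma smooth_curv A X Y : smooth_form A -> smooth_mx (curv A X Y).
Proof.
move=> sA; apply: smooth_mxD; first by apply: smooth_mxB; exact/smooth_ddir_mx/sA.
by apply: smooth_mxB; exact: smooth_mxM (sA _) (sA _).
Qed.

Lemma curvC A X Y x : curv A Y X x = - curv A X Y x.
Proof. by rewrite /curv opprD !opprB. Qed.

Lemma tr_derivation (a n p dn dp : M) : \tr (dn *m p + n *m dp) =
  \tr ((dn + (a *m n - n *m a)) *m p) + \tr (n *m (dp + (a *m p - p *m a))).
Proof.
rewrite !(mulmxDl, mulmxDr, mulNmx, mulmxN, raddfD, raddfN, mulmxA) /=.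
by rewrite [\tr (n *m p *m a)]mxtrace_mulC mulmxA; ring.
Qed.

Lemma cov_tr A X N x : smooth_mx N -> cdir X (fun y => \tr (N y)) x = \tr (cov A X N x).
Proof.
by move=> sN; rewrite cdir_tr // raddfD raddfB /= [\tr (N x *m _)]mxtrace_mulC subrr addr0.
Qed.

Lemma cov_tr2 A X N P x : smooth_mx N -> smooth_mx P ->
  cdir X (fun y => \tr (N y *m P y)) x = \tr (cov A X N x *m P x) + \tr (N x *m cov A X P x).
Proof.
move=> sN sP; rewrite cdir_tr ?ddir_mxM //; last exact: smooth_mxM.
exact: tr_derivation.
Qed.

Lemma covM A X N P x : smooth_mx N -> smooth_mx P ->
  cov A X (fun y => N y *m P y) x = cov A X N x *m P x + N x *m cov A X P x.
Proof.
move=> sN sP; rewrite /cov ddir_mxM // mulmxDl mulmxDr mulmxBl mulmxBr !mulmxA.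
by rewrite [RHS]addrACA [X in _ = _ + X]addrA subrK.
Qed.

(** [a], [b], [c] are the values of A on X, Y, Z; [ab] is the derivative along X of A on Y; [s],
    [t], [u] are the mixed second derivatives of A on Z, Y, X, each occurring twice because
    derivatives commute. *)
Lemma bianchi_algebra (a b c s t u ab ac ba bc ca cb : M) :
  (s - t + (ab *m c + b *m ac - (ac *m b + c *m ab))) +
    (a *m (bc - cb + (b *m c - c *m b)) - (bc - cb + (b *m c - c *m b)) *m a) +
  ((u - s + (bc *m a + c *m ba - (ba *m c + a *m bc))) +
    (b *m (ca - ac + (c *m a - a *m c)) - (ca - ac + (c *m a - a *m c)) *m b)) +
  ((t - u + (ca *m b + a *m cb - (cb *m a + b *m ca))) +
    (c *m (ab - ba + (a *m b - b *m a)) - (ab - ba + (a *m b - b *m a)) *m c)) = 0.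
Proof.
rewrite !(mulmxDl, mulmxDr, mulNmx, mulmxN, mulmxA).
have D (m n : M) i j : (m + n) i j = m i j + n i j by rewrite mxE.
have N (m : M) i j : (- m) i j = - m i j by rewrite mxE.
by apply/matrixP => i j; rewrite !(D, N) [RHS]mxE; ring.
Qed.

(** The second Bianchi identity; constant vector fields commute, so no bracket terms appear. *)
Lemma cov_curv A X Y Z x : smooth_form A ->
  cov A X (curv A Y Z) x + cov A Y (curv A Z X) x + cov A Z (curv A X Y) x = 0.
Proof.
move=> sA; have sd U V : smooth_mx (ddir_mx U (A ^~ V)) by exact: smooth_ddir_mx.
have sm U V : smooth_mx (fun y => A y U *m A y V) by exact: smooth_mxM (sA U) (sA V).
have D U V T : ddir_mx U (curv A V T) x = ddir_mx U (ddir_mx V (A ^~ T)) x -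
    ddir_mx U (ddir_mx T (A ^~ V)) x +
    (ddir_mx U (A ^~ V) x *m A x T + A x V *m ddir_mx U (A ^~ T) x -
     (ddir_mx U (A ^~ T) x *m A x V + A x T *m ddir_mx U (A ^~ V) x)).
  rewrite ddir_mxD; [|exact: smooth_mxB|exact: smooth_mxB].
  by rewrite !ddir_mxB // !ddir_mxM //.
have E : ddir_mx Y (ddir_mx X (A ^~ Z)) x = ddir_mx X (ddir_mx Y (A ^~ Z)) x.
  exact: ddir_mx_comm.
have E' : ddir_mx Z (ddir_mx X (A ^~ Y)) x = ddir_mx X (ddir_mx Z (A ^~ Y)) x.
  exact: ddir_mx_comm.
have E'' : ddir_mx Z (ddir_mx Y (A ^~ X)) x = ddir_mx Y (ddir_mx Z (A ^~ X)) x.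
  exact: ddir_mx_comm.
by rewrite /cov !D /curv E E' E''; exact: bianchi_algebra.
Qed.

End Curvature.

(** * Algebra of the transgression *)

Section TransgressionAlgebra.
Variables (K : comNzRingType) (M : zmodType) (b : M -> M -> K).
Hypotheses (bC : forall X Y, b X Y = b Y X)
  (bDl : forall X Y Z, b (X + Y) Z = b X Z + b Y Z)
  (bNl : forall X Y, b (- X) Y = - b X Y).

Lemma bilinDr X Y Z : b X (Y + Z) = b X Y + b X Z.
Proof. by rewrite bC bDl !(bC X). Qed.

Lemma bilinNr X Y : b X (- Y) = - b X Y.
Proof. by rewrite bC bNl bC. Qed.

(** Half the value of b(F /\ F) on the vectors numbered i, j, k, l, for a 2-form F. *)
Definition pfaffian (F : nat -> nat -> M) i j k l : K :=
  b (F i j) (F k l) - b (F i k) (F j l) + b (F i l) (F j k).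

(* With alpha = A - B, the letters stand for alpha_i, the commutators
   [alpha_i, alpha_j], the covariant derivatives of alpha and of the two
   curvatures; w3 and w4 are traces of words of length 3 and 4. *)
Variables (al : nat -> M) (cm Dm Fb : nat -> nat -> M) (dA dB : nat -> nat -> nat -> M).
Variables (w3 : nat -> nat -> M -> K) (w4 : nat -> nat -> nat -> nat -> K).
Hypotheses (b_cm : forall i j X, b (cm i j) X = w3 i j X - w3 j i X)
  (w3_cm : forall i j k l, w3 i j (cm k l) = w4 i j k l - w4 i j l k)
  (w4_rot : forall i j k l, w4 i j k l = w4 j k l i)
  (bianchiA : forall i j k, dA i j k - dA j i k + dA k i j = 0)
  (bianchiB : forall i j k, dB i j k - dB j i k + dB k i j = 0).

(** The curvature of B + alpha: F_B plus the B-covariant exterior derivative of alpha plus alpha /\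
    alpha. *)
Definition alt_curv i j : M := Fb i j + Dm i j - Dm j i + cm i j.

(** What Leibniz' rule gives for the derivative along i of [transgression] on j, k, l;
    [Dm i j + cm i j] is the A-covariant derivative of alpha_j. *)
Definition dtransgression i j k l : K :=
  let t j k l :=
    b (Dm i j + cm i j) (alt_curv k l) + b (al j) (dA i k l) +
    (b (Dm i j) (Fb k l) + b (al j) (dB i k l)) in
  t j k l - t k j l + t l j k -
  (w3 k l (Dm i j) + w3 l j (Dm i k) + w3 j k (Dm i l)
   - (w3 l k (Dm i j) + w3 k j (Dm i l) + w3 j l (Dm i k))).

Lemma transgression_algebra :
  2 * (pfaffian alt_curv 0 1 2 3 - pfaffian Fb 0 1 2 3) =
  dtransgression 0 1 2 3 - dtransgression 1 0 2 3 +
  dtransgression 2 0 1 3 - dtransgression 3 0 1 2.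
Proof.
have EA i j k : dA k i j = dA j i k - dA i j k.
  by apply/eqP; rewrite -subr_eq0 opprB addrA [dA k i j + _]addrC addrAC bianchiA.
have EB i j k : dB k i j = dB j i k - dB i j k.
  by apply/eqP; rewrite -subr_eq0 opprB addrA [dB k i j + _]addrC addrAC bianchiB.
(* The rewrites that follow pick one representative for each pair exchanged by the symmetry of [b],
   and for each cyclic word of length 4 the rotation that starts with 0; then [ring] sees equal
   atoms. *)
have sw i j k l : b (Fb i j) (Dm k l) = b (Dm k l) (Fb i j) by [].
have sw1 i j l : b (Dm i.+1 j) (Dm 0%N l) = b (Dm 0%N l) (Dm i.+1 j) by [].
have sw2 i j l : b (Dm i.+1 j.+1) (Dm l 0%N) = b (Dm l 0%N) (Dm i.+1 j.+1) by [].
have cmXr i j X : b X (cm i j) = w3 i j X - w3 j i X by rewrite bC b_cm.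
have r1 i j k : w4 i.+1 0 j k = w4 0 j k i.+1 by rewrite w4_rot.
have r2 i j k : w4 i.+1 j.+1 0 k = w4 0 k i.+1 j.+1 by rewrite 2!w4_rot.
have r3 i j k : w4 i.+1 j.+1 k.+1 0 = w4 0 i.+1 j.+1 k.+1 by rewrite 3!w4_rot.
rewrite /dtransgression /pfaffian /alt_curv.
rewrite (EA 0 1 2)%N (EA 0 1 3)%N (EA 0 2 3)%N (EA 1 2 3)%N.
rewrite (EB 0 1 2)%N (EB 0 1 3)%N (EB 0 2 3)%N (EB 1 2 3)%N.
rewrite !(bDl, bilinDr, bNl, bilinNr).
rewrite !(b_cm, cmXr) !w3_cm.
rewrite !(sw, sw1, sw2).
rewrite !(r1, r2, r3).
ring.
Qed.

End TransgressionAlgebra.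

Section Transgression.
Variables (R : realType) (W : vectType R) (r : nat).
Local Notation C := R[i].
Local Notation M := 'M[C]_r.

Lemma mxDE (X Y : M) i j : (X + Y) i j = X i j + Y i j.
Proof. exact: mxE. Qed.

Lemma mxNE (X : M) i j : (- X) i j = - X i j.
Proof. exact: mxE. Qed.

Definition beta (X Y : M) : C := \tr (X *m Y) - \tr X * \tr Y.

Lemma betaC X Y : beta X Y = beta Y X.
Proof. by rewrite /beta mxtrace_mulC mulrC. Qed.

Lemma betaDl X Y Z : beta (X + Y) Z = beta X Z + beta Y Z.
Proof. by rewrite /beta mulmxDl !mxtraceD mulrDl opprD addrACA. Qed.

Lemma mxtraceN (X : M) : \tr (- X) = - \tr X.
Proof. exact: raddfN. Qed.

Lemma betaNl X Y : beta (- X) Y = - beta X Y.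
Proof. by rewrite /beta mulNmx !mxtraceN mulNr opprD. Qed.

Lemma betaDr X Y Z : beta X (Y + Z) = beta X Y + beta X Z.
Proof. by rewrite betaC betaDl !(betaC X). Qed.

Lemma betaZr (c : C) X Y : beta X (c *: Y) = c * beta X Y.
Proof. by rewrite /beta -scalemxAr !mxtraceZ mulrBr [\tr X * _]mulrCA. Qed.

Lemma beta0r X : beta X 0 = 0.
Proof. by rewrite -(scale0r 0) betaZr mul0r. Qed.

Lemma wedge_beta (F : kform 2 W M) (v : 'I_(2 + 2) -> W) :
  \tr (wedge (@mulmx _ r r r) F F v) -
  wedge *%R (fun u => \tr (F u)) (fun u => \tr (F u)) v = wedge beta F F v.
Proof.
rewrite /wedge raddf_sum -sumrB; apply: eq_bigr => s _.
by rewrite raddfMz /= -mulrzBl.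
Qed.

Lemma beta_comml X Y Z : beta (X *m Y - Y *m X) Z = \tr (X *m Y *m Z) - \tr (Y *m X *m Z).
Proof.
rewrite /beta mulmxBl !mxtraceD !mxtraceN [\tr (Y *m X)]mxtrace_mulC.
by rewrite (subrr (\tr (X *m Y))) mul0r subr0.
Qed.

Lemma mxtrace_conj (P Q g : M) : g \in unitmx -> P *m g = g *m Q -> \tr P = \tr Q.
Proof.
by move=> gu E; rewrite -[P](mulmxK gu) E -mulmxA mxtrace_mulC mulmxKV.
Qed.

Lemma conj_mulmx (P Q P' Q' g : M) : P *m g = g *m P' -> Q *m g = g *m Q' ->
  (P *m Q) *m g = g *m (P' *m Q').
Proof. by move=> EP EQ; rewrite -mulmxA EQ mulmxA EP mulmxA. Qed.

Lemma beta_conj (P Q P' Q' g : M) : g \in unitmx ->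
  P *m g = g *m P' -> Q *m g = g *m Q' -> beta P Q = beta P' Q'.
Proof.
move=> gu EP EQ; rewrite /beta (mxtrace_conj gu EP) (mxtrace_conj gu EQ).
by rewrite (mxtrace_conj gu (conj_mulmx EP EQ)).
Qed.

Implicit Types (A B : W -> W -> M) (X Y Z V x : W) (N P Q : W -> M).

Lemma tr_leibniz (p q s dp dq ds : M) :
  \tr (dp *m (q *m s)) + \tr (p *m (dq *m s + q *m ds)) =
  \tr (q *m s *m dp) + \tr (s *m p *m dq) + \tr (p *m q *m ds).
Proof.
rewrite mulmxDr mxtraceD (mxtrace_mulC dp) (mulmxA p q ds) (mulmxA p dq s).
by rewrite (mxtrace_mulC (p *m dq)) (mulmxA s p dq) addrA.
Qed.

(** The transformation law of a connection multiplied by [g] on the right, which is free of inverses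
    and easy to differentiate. *)
Definition equivariant (l : W) (g : W -> M) A := forall x v,
  A (x + l) v *m g x = g x *m A x v - ddir_mx v g x.

Lemma csmooth_beta N P : smooth_mx N -> smooth_mx P -> csmooth (fun x => beta (N x) (P x)).
Proof.
move=> sN sP; apply: csmoothD; first exact/csmooth_tr/smooth_mxM.
by apply: csmoothN; apply: csmoothM; exact: csmooth_tr.
Qed.

Lemma cdir_beta A X N P x : smooth_mx N -> smooth_mx P ->
  cdir X (fun y => beta (N y) (P y)) x = beta (cov A X N x) (P x) + beta (N x) (cov A X P x).
Proof.
move=> sN sP; have [tN tP] := (csmooth_tr sN, csmooth_tr sP).
rewrite cdirD; [|exact/csmooth_tr/smooth_mxM|exact/csmoothN/csmoothM].
rewrite cdirN ?cdirM //; last exact: csmoothM.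
by rewrite (cov_tr2 A) // !(cov_tr A) // opprD addrACA.
Qed.

Variables (A B : W -> W -> M).
Hypotheses (sA : smooth_form A) (sB : smooth_form B).

Definition form_diff Y x : M := A x Y - B x Y.

Lemma smooth_form_diff Y : smooth_mx (form_diff Y).
Proof. exact: smooth_mxB (sA Y) (sB Y). Qed.

Lemma form_diff_equivariant l (g : W -> M) Y x : equivariant l g A -> equivariant l g B ->
  form_diff Y (x + l) *m g x = g x *m form_diff Y x.
Proof.
move=> eA eB; rewrite /form_diff mulmxBl eA eB mulmxBr.
by apply/matrixP => i j; rewrite !(mxDE, mxNE); ring.
Qed.

(** The Chern-Simons form beta(alpha, F_A + F_B) - 1/3 tr(alpha^3) with alpha = A - B, which is the
    integral of 2 beta(alpha, F_t) over the segment from B to A. On three vectors tr(alpha^3) is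
    three times the difference of the two cyclic words, which absorbs the 1/3; the product of traces
    in beta adds no cubic term, as tr(alpha /\ alpha) = 0. *)
Definition transgression Y Z V x : C :=
  let t Y Z V := beta (form_diff Y x) (curv A Z V x) + beta (form_diff Y x) (curv B Z V x) in
  t Y Z V - t Z Y V + t V Y Z -
  (\tr (form_diff Y x *m (form_diff Z x *m form_diff V x)) -
   \tr (form_diff Y x *m (form_diff V x *m form_diff Z x))).

Lemma cov_alt X N x : smooth_mx N ->
  cov A X N x = cov B X N x + (form_diff X x *m N x - N x *m form_diff X x).
Proof.
move=> sN; rewrite /cov /form_diff mulmxBl mulmxBr.
by apply/matrixP => i j; rewrite !(mxDE, mxNE); ring.
Qed.

Lemma curv_alt X Y x : curv A X Y x =
  curv B X Y x + cov B X (form_diff Y) x - cov B Y (form_diff X) x +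
  (form_diff X x *m form_diff Y x - form_diff Y x *m form_diff X x).
Proof.
have E U V : ddir_mx U (form_diff V) x = ddir_mx U (A ^~ V) x - ddir_mx U (B ^~ V) x.
  exact: ddir_mxB (sA V) (sB V).
rewrite /cov !E /curv /form_diff !(mulmxBl, mulmxBr).
by apply/matrixP => i j; rewrite !(mxDE, mxNE); ring.
Qed.

Lemma cov_curv_sorted (D : W -> W -> M) X Y Z x : smooth_form D ->
  cov D X (curv D Y Z) x - cov D Y (curv D X Z) x + cov D Z (curv D X Y) x = 0.
Proof.
move=> sD; rewrite -(cov_curv X Y Z x sD); congr (_ + _ + _).
have -> : curv D Z X = fun y => - curv D X Z y by apply/funext => y; exact: curvC.
rewrite /cov ddir_mxN; last exact: smooth_curv.
by rewrite mulmxN mulNmx !opprD opprK.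
Qed.

Lemma eq_alt_sum (K : zmodType) (a1 a2 a3 a4 a5 b1 b2 b3 b4 b5 : K) :
  a1 = b1 -> a2 = b2 -> a3 = b3 -> a4 = b4 -> a5 = b5 ->
  a1 - a2 + a3 - (a4 - a5) = b1 - b2 + b3 - (b4 - b5).
Proof. by move=> -> -> -> -> ->. Qed.

Lemma cdir_comb X (f1 f2 f3 g1 g2 : W -> C) x :
  csmooth f1 -> csmooth f2 -> csmooth f3 -> csmooth g1 -> csmooth g2 ->
  cdir X (fun y => f1 y - f2 y + f3 y - (g1 y - g2 y)) x =
  cdir X f1 x - cdir X f2 x + cdir X f3 x - (cdir X g1 x - cdir X g2 x).
Proof.
move=> s1 s2 s3 t1 t2.
rewrite (cdirD X (f := fun y => f1 y - f2 y + f3 y) (g := fun y => - (g1 y - g2 y)) x).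
- rewrite (cdirN X (f := fun y => g1 y - g2 y) x); last exact: csmoothD t1 (csmoothN t2).
  rewrite (cdirD X (f := g1) (g := fun y => - g2 y) x) //; last exact: csmoothN.
  rewrite (cdirD X (f := fun y => f1 y - f2 y) (g := f3) x) //;
    last exact: csmoothD s1 (csmoothN s2).
  rewrite (cdirD X (f := f1) (g := fun y => - f2 y) x) //; last exact: csmoothN.
  by rewrite !cdirN.
- exact: csmoothD (csmoothD s1 (csmoothN s2)) s3.
- exact: csmoothN (csmoothD t1 (csmoothN t2)).
Qed.

#[local] Opaque beta curv cov form_diff.

(** By invariance of the traces, Leibniz' rule holds with the covariant derivative of any
    connection: A is used on the products with F_A, B on those with F_B and on the cubic words, so
    that the Bianchi identity applies to each curvature. *)
Lemma cdir_transgression (v : nat -> W) i j k l x :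
  cdir (v i) (transgression (v j) (v k) (v l)) x =
  dtransgression beta (fun i => form_diff (v i) x)
    (fun i j => form_diff (v i) x *m form_diff (v j) x - form_diff (v j) x *m form_diff (v i) x)
    (fun i j => cov B (v i) (form_diff (v j)) x)
    (fun i j => curv B (v i) (v j) x)
    (fun i j k => cov A (v i) (curv A (v j) (v k)) x)
    (fun i j k => cov B (v i) (curv B (v j) (v k)) x)
    (fun i j (U : M) => \tr (form_diff (v i) x *m form_diff (v j) x *m U)) i j k l.
Proof.
have sd := smooth_form_diff; have sKA X Y := smooth_curv X Y sA.
have sKB X Y := smooth_curv X Y sB.
have scA Y Z V := csmooth_beta (sd Y) (sKA Z V).
have scB Y Z V := csmooth_beta (sd Y) (sKB Z V).
have sc Y Z V := csmoothD (scA Y Z V) (scB Y Z V).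
have sw Y Z V := csmooth_tr (smooth_mxM (sd Y) (smooth_mxM (sd Z) (sd V))).
have E X Y Z V : cdir X (fun y => beta (form_diff Y y) (curv A Z V y) +
      beta (form_diff Y y) (curv B Z V y)) x =
    beta (cov B X (form_diff Y) x +
        (form_diff X x *m form_diff Y x - form_diff Y x *m form_diff X x))
      (curv B Z V x + cov B Z (form_diff V) x - cov B V (form_diff Z) x +
        (form_diff Z x *m form_diff V x - form_diff V x *m form_diff Z x)) +
      beta (form_diff Y x) (cov A X (curv A Z V) x) +
    (beta (cov B X (form_diff Y) x) (curv B Z V x) +
      beta (form_diff Y x) (cov B X (curv B Z V) x)).
  rewrite -(cov_alt X x (sd Y)) -curv_alt.
  apply: etrans (cdirD X x (scA Y Z V) (scB Y Z V)) _.
  exact: (f_equal2 (fun a b => a + b) (cdir_beta A X x (sd Y) (sKA Z V))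
            (cdir_beta B X x (sd Y) (sKB Z V))).
have E3 X Y Z V : cdir X (fun y => \tr (form_diff Y y *m (form_diff Z y *m form_diff V y))) x =
    \tr (form_diff Z x *m form_diff V x *m cov B X (form_diff Y) x) +
    \tr (form_diff V x *m form_diff Y x *m cov B X (form_diff Z) x) +
    \tr (form_diff Y x *m form_diff Z x *m cov B X (form_diff V) x).
  apply: etrans (cov_tr2 B X x (sd Y) (smooth_mxM (sd Z) (sd V))) _.
  rewrite (covM B X x (sd Z) (sd V)); exact: tr_leibniz.
have H := cdir_comb (v i) x (sc (v j) (v k) (v l)) (sc (v k) (v j) (v l))
  (sc (v l) (v j) (v k)) (sw (v j) (v k) (v l)) (sw (v j) (v l) (v k)).
apply: etrans H _.
exact: (eq_alt_sum (E (v i) (v j) (v k) (v l)) (E (v i) (v k) (v j) (v l))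
  (E (v i) (v l) (v j) (v k)) (E3 (v i) (v j) (v k) (v l)) (E3 (v i) (v j) (v l) (v k))).
Qed.

End Transgression.

Section TransgressionFormula.
Variables (R : realType) (W : vectType R) (r : nat).
Local Notation C := R[i].
Local Notation M := 'M[C]_r.
Implicit Types (A B : W -> W -> M) (X Y Z V x : W) (g : W -> M).

Lemma csmooth_transgression A B X Y Z : smooth_form A -> smooth_form B ->
  csmooth (transgression A B X Y Z).
Proof.
move=> sA sB; have sd := smooth_form_diff sA sB.
have sc U V T := csmoothD (csmooth_beta (sd U) (smooth_curv V T sA))
                          (csmooth_beta (sd U) (smooth_curv V T sB)).
have sw U V T := csmooth_tr (smooth_mxM (sd U) (smooth_mxM (sd V) (sd T))).
apply: csmoothD; first exact: csmoothD (csmoothD (sc _ _ _) (csmoothN (sc _ _ _))) (sc _ _ _).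
exact: csmoothN (csmoothD (sw _ _ _) (csmoothN (sw _ _ _))).
Qed.

Lemma transgression_formula A B (v : nat -> W) x : smooth_form A -> smooth_form B ->
  2 * (pfaffian (@beta R r) (fun i j => curv A (v i) (v j) x) 0 1 2 3 -
       pfaffian (@beta R r) (fun i j => curv B (v i) (v j) x) 0 1 2 3) =
  cdir (v 0%N) (transgression A B (v 1%N) (v 2%N) (v 3%N)) x -
  cdir (v 1%N) (transgression A B (v 0%N) (v 2%N) (v 3%N)) x +
  cdir (v 2%N) (transgression A B (v 0%N) (v 1%N) (v 3%N)) x -
  cdir (v 3%N) (transgression A B (v 0%N) (v 1%N) (v 2%N)) x.
Proof.
move=> sA sB; rewrite !(cdir_transgression sA sB).
pose al i := form_diff A B (v i) x.
have b_cm i j (U : M) : beta (al i *m al j - al j *m al i) U =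
    \tr (al i *m al j *m U) - \tr (al j *m al i *m U) by exact: beta_comml.
have w3_cm i j k l : \tr (al i *m al j *m (al k *m al l - al l *m al k)) =
    \tr (al i *m al j *m (al k *m al l)) - \tr (al i *m al j *m (al l *m al k)) :> C.
  by rewrite mulmxBr mxtraceD mxtraceN.
have w4_rot i j k l : \tr (al i *m al j *m (al k *m al l)) =
    \tr (al j *m al k *m (al l *m al i)) :> C.
  by rewrite -!mulmxA mxtrace_mulC !mulmxA.
have biA i j k := cov_curv_sorted (v i) (v j) (v k) x sA.
have biB i j k := cov_curv_sorted (v i) (v j) (v k) x sB.
rewrite -(transgression_algebra (@betaC R r) (@betaDl R r) (@betaNl R r) al
  (fun i j => cov B (v i) (form_diff A B (v j)) x) (fun i j => curv B (v i) (v j) x)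
  b_cm w3_cm w4_rot biA biB).
by congr (2 * (_ - _)); rewrite /pfaffian /alt_curv !(curv_alt sA sB).
Qed.

(** Primes denote values at the translated point; [gx], [gy], [gxy] are derivatives of the cocycle.
    The last two hypotheses are the derivatives of the first two, and [gxy] cancels between them. *)
Lemma curv_equivariant_algebra (a b a' b' g gx gy gxy ab ba ab' ba' : M) :
  a' *m g = g *m a - gx -> b' *m g = g *m b - gy ->
  ab' *m g + b' *m gx = gx *m b + g *m ab - gxy ->
  ba' *m g + a' *m gy = gy *m a + g *m ba - gxy ->
  (ab' - ba' + (a' *m b' - b' *m a')) *m g = g *m (ab - ba + (a *m b - b *m a)).
Proof.
move=> Ea Eb /eqP; rewrite -(inj_eq (addIr (- (b' *m gx)))) addrK => /eqP Eab.
move=> /eqP; rewrite -(inj_eq (addIr (- (a' *m gy)))) addrK => /eqP Eba.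
rewrite !(mulmxDl, mulNmx) -!mulmxA Ea Eb Eab Eba !(mulmxBr, mulmxDr, mulmxA, mulmxN).
rewrite Ea Eb !(mulmxDl, mulNmx).
by apply/matrixP => i j; rewrite !(mxDE, mxNE); ring.
Qed.

Lemma curv_equivariant A l g X Y x : smooth_form A -> smooth_mx g ->
  equivariant l g A -> curv A X Y (x + l) *m g x = g x *m curv A X Y x.
Proof.
move=> sA sg eA.
have D U V : ddir_mx U (A ^~ V) (x + l) *m g x + A (x + l) V *m ddir_mx U g x =
    ddir_mx U g x *m A x V + g x *m ddir_mx U (A ^~ V) x - ddir_mx U (ddir_mx V g) x.
  have E : (fun y => A (y + l) V *m g y) = (fun y => g y *m A y V - ddir_mx V g y).
    by apply/funext => y; exact: eA.
  have := f_equal (fun h => ddir_mx U h x) E.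
  move=> H; apply: etrans (etrans H _).
    by rewrite (ddir_mxM U x (smooth_mx_shift l (sA V)) sg) (ddir_mx_shift l U (A ^~ V)).
  rewrite (ddir_mxB U x (smooth_mxM sg (sA V)) (smooth_ddir_mx V sg)).
  by rewrite (ddir_mxM U x sg (sA V)).
have D2 := D Y X; rewrite (ddir_mx_comm Y X x sg) in D2.
exact: curv_equivariant_algebra (eA x X) (eA x Y) (D X Y) D2.
Qed.

(** The inhomogeneous terms of A and B cancel in A - B, so a translation acts by conjugation only,
    under which traces are invariant. *)
Lemma transgression_periodic A B l g X Y Z x : smooth_form A -> smooth_form B ->
  smooth_mx g -> (forall x, g x \in unitmx) -> equivariant l g A -> equivariant l g B ->
  transgression A B X Y Z (x + l) = transgression A B X Y Z x.
Proof.
move=> sA sB sg gu eA eB.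
have ed V := form_diff_equivariant V x eA eB.
have eKA U V := curv_equivariant U V x sA sg eA.
have eKB U V := curv_equivariant U V x sB sg eB.
have t3 U V T := mxtrace_conj (gu x) (conj_mulmx (ed U) (conj_mulmx (ed V) (ed T))).
have e U V T := f_equal2 (fun a b => a + b) (beta_conj (gu x) (ed U) (eKA V T))
                                            (beta_conj (gu x) (ed U) (eKB V T)).
exact: (eq_alt_sum (e X Y Z) (e Y X Z) (e Z X Y) (t3 X Y Z) (t3 X Z Y)).
Qed.

End TransgressionFormula.

(** * Averages over tori *)

Section Averages.
Variable R : realType.
Local Notation mu := (@lebesgue_measure R).
Implicit Types (g : R -> R) (F G : seq R -> R) (s t : seq R).

Lemma continuous_itv_integrable g (a b : R) :
  {within `[a, b], continuous g} -> mu.-integrable `[a, b] (EFin \o g).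
Proof. by move=> cg; apply: continuous_compact_integrable => //; exact: segment_compact. Qed.

Lemma Rintegral_itv_cst (a b c : R) : a <= b ->
  \int[mu]_(x in `[a, b]) c = c * (b - a).
Proof.
move=> ab; rewrite Rintegral_cst //= lebesgue_measure_itv /= lte_fin.
by move: ab; rewrite le_eqVlt => /predU1P[->|->] //; rewrite ltxx subrr mulr0.
Qed.

Lemma Rintegral_itv_bound g (a b c e : R) : a <= b ->
  {within `[a, b], continuous g} -> (forall x, a <= x <= b -> `|g x - c| <= e) ->
  `|\int[mu]_(x in `[a, b]) g x - c * (b - a)| <= e * (b - a).
Proof.
move=> ab cg ge; have ig := continuous_itv_integrable cg.
have ic d : mu.-integrable `[a, b] (EFin \o (fun=> d)).
  by apply: continuous_itv_integrable => x; exact: cst_continuous.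
have up : \int[mu]_(x in `[a, b]) g x <= \int[mu]_(x in `[a, b]) (c + e).
  apply: le_Rintegral => // x /=; rewrite in_itv /= => /ge.
  by rewrite ler_norml lerBlDl => /andP[].
have lo : \int[mu]_(x in `[a, b]) (c - e) <= \int[mu]_(x in `[a, b]) g x.
  apply: le_Rintegral => // x /=; rewrite in_itv /= => /ge.
  by rewrite ler_norml lerBrDl => /andP[].
rewrite !Rintegral_itv_cst // in up lo.
rewrite mulrDl in up; rewrite mulrBl in lo.
move: up lo; move: (Rintegral _ _ _) (c * _) (e * _) => I p q up lo.
by rewrite ler_norml; apply/andP; split; lra.
Qed.

(* Averages over the grid (1/N) Z^n replace integrals over the n-torus, which avoids
   iterated integrals in seven variables. *)
Definition mean1 (N : nat) g : R := N%:R^-1 * \sum_(k < N) g (k%:R / N%:R).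

Lemma within_continuous_subitv g (a b c d : R) : a <= c -> d <= b ->
  {within `[a, b], continuous g} -> {within `[c, d], continuous g}.
Proof.
move=> ac db; apply: continuous_subspaceW => x /=; rewrite !in_itv /= => /andP[cx xd].
by rewrite (le_trans ac) ?(le_trans xd).
Qed.

Lemma mean1_Rintegral N g (e : R) : (0 < N)%N -> {within `[0, 1], continuous g} ->
  (forall x y, 0 <= x <= 1 -> 0 <= y <= 1 -> `|x - y| <= N%:R^-1 -> `|g x - g y| <= e) ->
  `|\int[mu]_(x in `[0, 1]) g x - mean1 N g| <= e.
Proof.
move=> N0 cg ge; have NR : 0 < N%:R :> R by rewrite ltr0n.
have Nn : N%:R != 0 :> R by rewrite gt_eqF.
suff claim k : (k <= N)%N ->
    `|\int[mu]_(x in `[0, k%:R / N%:R]) g x - N%:R^-1 * \sum_(j < k) g (j%:R / N%:R)| <=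
    e * (k%:R / N%:R).
  by have := claim N (leqnn N); rewrite divff // mulr1.
elim: k => [|k IHk] kN.
  by rewrite mul0r set_itv1 Rintegral_set1 big_ord0 !mulr0 subr0 normr0.
have k0 : 0 <= k%:R / N%:R :> R by rewrite divr_ge0.
have kk : k%:R / N%:R <= k.+1%:R / N%:R :> R by rewrite ler_pM2r ?invr_gt0 // ler_nat.
have k1 : k.+1%:R / N%:R <= 1 :> R by rewrite ler_pdivrMr // mul1r ler_nat.
have c01 := within_continuous_subitv (lexx 0) k1 cg.
have dk : k.+1%:R / N%:R - k%:R / N%:R = N%:R^-1 :> R.
  by rewrite -mulrBl -natrB // subSnn mul1r.
have := Rintegral_itvB (continuous_itv_integrable c01) (x := k%:R / N%:R).
rewrite !bnd_simp => /(_ k0 kk).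
rewrite Rintegral_itv_obnd_cbnd; last first.
  apply: integrableS (continuous_itv_integrable c01) => //.
  by apply: subset_itvr; rewrite bnd_simp.
move/eqP; rewrite subr_eq [X in _ == X]addrC => /eqP ->.
have ck := within_continuous_subitv k0 k1 cg.
have := Rintegral_itv_bound (c := g (k%:R / N%:R)) (e := e) kk ck.
rewrite dk => /(_ _)/wrap[x /andP[kx xk]|B].
  have x1 : x <= 1 by exact: le_trans k1.
  have x0 : 0 <= x by exact: le_trans kx.
  apply: ge; rewrite ?x0 ?x1 ?k0 ?(le_trans kk) //.
  by rewrite ger0_norm ?subr_ge0 // -[X in _ <= X]dk lerD2r.
rewrite big_ord_recr /= mulrDr (mulrC _ (g _)) opprD addrACA.
apply: le_trans (ler_normD _ _) _.
have -> : e * (k.+1%:R / N%:R) = e * (k%:R / N%:R) + e * N%:R^-1.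
  by rewrite -dk; ring.
apply: lerD; last exact: B.
exact/IHk/ltnW.
Qed.

Fixpoint mean n (N : nat) F : R :=
  if n is m.+1 then mean1 N (fun x => mean m N (fun s => F (x :: s))) else F [::].

Fixpoint iterated_integral n F : R :=
  if n is m.+1 then \int[mu]_(x in `[0, 1]) iterated_integral m (fun s => F (x :: s))
  else F [::].

Definition in_cube n s := size s = n /\ forall i, 0 <= nth 0 s i <= 1.

Definition cube_close n F (d e : R) := forall s t, in_cube n s -> in_cube n t ->
  (forall i, `|nth 0 s i - nth 0 t i| <= d) -> `|F s - F t| <= e.

Definition cube_unif_continuous n F :=
  forall e, 0 < e -> exists2 d, 0 < d & cube_close n F d e.

Lemma in_cube_cons n (x : R) s : 0 <= x <= 1 -> in_cube n s -> in_cube n.+1 (x :: s).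
Proof. by move=> x01 [<- s01]; split=> // -[|i] /=. Qed.

Lemma cube_close_cons n F d e (x : R) : 0 <= d -> 0 <= x <= 1 -> cube_close n.+1 F d e ->
  cube_close n (fun s => F (x :: s)) d e.
Proof.
move=> d0 x01 cF s s' cs cs' ss'; apply: cF; try exact: in_cube_cons.
by case=> [|i] //=; rewrite subrr normr0.
Qed.

Lemma cube_unif_continuous_cons n F (x : R) : 0 <= x <= 1 ->
  cube_unif_continuous n.+1 F -> cube_unif_continuous n (fun s => F (x :: s)).
Proof.
move=> x01 uF e /uF [d d0 dF]; exists d => //.
exact: cube_close_cons (ltW d0) x01 dF.
Qed.

Lemma within_continuous_eps g :
  (forall e, 0 < e -> exists2 d, 0 < d & forall x y, 0 <= x <= 1 -> 0 <= y <= 1 ->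
     `|x - y| <= d -> `|g x - g y| <= e) -> {within `[0, 1], continuous g}.
Proof.
move=> gc; apply/subspace_continuousP => x x01.
apply/cvgrPdist_le => e /gc [d d0 dg].
rewrite near_withinE; apply/nbhs_ballP; exists d => //= y xy y01.
move: x01 y01; rewrite /= !in_itv /= => x01 y01; apply: dg => //.
exact: ltW.
Qed.

Lemma Rintegral_dist (g h : R -> R) (e : R) : {within `[0, 1], continuous g} ->
  {within `[0, 1], continuous h} -> (forall x, 0 <= x <= 1 -> `|g x - h x| <= e) ->
  `|\int[mu]_(x in `[0, 1]) g x - \int[mu]_(x in `[0, 1]) h x| <= e.
Proof.
move=> cg ch gh; rewrite -RintegralB //; try exact: continuous_itv_integrable.
have cgh : {within `[0, 1], continuous (g \- h)}.
  by move=> x; apply: continuousB; [exact: cg | exact: ch].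
have := Rintegral_itv_bound (c := 0) (e := e) ler01 cgh.
rewrite mul0r !subr0 mulr1; apply => x /gh.
by rewrite subr0.
Qed.

(** The hypothesis on pairs [F], [G] is [iterated_integral_dist] in dimension n, whose induction
    needs this continuity to reach dimension n + 1. *)
Lemma iterated_integral_continuous n F : cube_unif_continuous n.+1 F ->
  (forall F G e, cube_unif_continuous n F -> cube_unif_continuous n G ->
    (forall s, in_cube n s -> `|F s - G s| <= e) ->
    `|iterated_integral n F - iterated_integral n G| <= e) ->
  forall d e, 0 < d -> cube_close n.+1 F d e -> forall x y, 0 <= x <= 1 -> 0 <= y <= 1 ->
  `|x - y| <= d -> `|iterated_integral n (fun s => F (x :: s)) -
                     iterated_integral n (fun s => F (y :: s))| <= e.
Proof.
move=> uF IHn d e d0 dF x y x01 y01 xy.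
apply: IHn; try exact: cube_unif_continuous_cons.
move=> s cs; apply: dF; try exact: in_cube_cons.
by case=> [|i] //=; rewrite subrr normr0 ltW.
Qed.

Lemma iterated_integral_dist n F G e : cube_unif_continuous n F ->
  cube_unif_continuous n G -> (forall s, in_cube n s -> `|F s - G s| <= e) ->
  `|iterated_integral n F - iterated_integral n G| <= e.
Proof.
elim: n F G e => [|n IHn] F G e uF uG FG /=.
  by apply: FG; split=> // i; rewrite nth_nil lexx ler01.
have cc H : cube_unif_continuous n.+1 H ->
    {within `[0, 1], continuous fun x => iterated_integral n (fun s => H (x :: s))}.
  move=> uH; apply: within_continuous_eps => d d0; have [c c0 cH] := uH _ d0.
  by exists c => // x y x01 y01; exact: iterated_integral_continuous cH _ _ x01 y01.
apply: Rintegral_dist; [exact: cc|exact: cc|] => x x01.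
apply: IHn; try exact: cube_unif_continuous_cons.
by move=> s cs; apply: FG; exact: in_cube_cons.
Qed.

Lemma mean1_dist N (g h : R -> R) (e : R) : (0 < N)%N ->
  (forall x, 0 <= x <= 1 - N%:R^-1 -> `|g x - h x| <= e) -> `|mean1 N g - mean1 N h| <= e.
Proof.
move=> N0 gh; have NR : 0 < N%:R :> R by rewrite ltr0n.
rewrite /mean1 -mulrBr -sumrB normrM ger0_norm ?invr_ge0 ?ler0n // ler_pdivrMl //.
apply: le_trans (ler_norm_sum _ _ _) _.
apply: (@le_trans _ _ (\sum_(k < N) e)); last by rewrite sumr_const card_ord mulr_natl.
apply: ler_sum => k _; apply: gh; rewrite divr_ge0 //= lerBrDr.
by rewrite -[X in _ + X]mul1r -mulrDl natr1 ler_pdivrMr // mul1r ler_nat.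
Qed.

(** Stopping at 1 - 1/N keeps the next grid point in every direction inside the cube. *)
Definition in_grid N n s := size s = n /\ forall i, 0 <= nth 0 s i <= 1 - N%:R^-1.

Lemma grid_le1 N (x : R) : 0 <= x <= 1 - N%:R^-1 -> 0 <= x <= 1.
Proof.
case/andP=> -> /= /le_trans; apply.
by rewrite lerBlDr lerDl invr_ge0.
Qed.

Lemma mean_dist n N F G (e : R) : (0 < N)%N ->
  (forall s, in_grid N n s -> `|F s - G s| <= e) -> `|mean n N F - mean n N G| <= e.
Proof.
move=> N0; elim: n F G => [|n IHn] F G FG /=.
  apply: FG; split=> // i; rewrite nth_nil lexx subr_ge0 /=.
  by rewrite invf_le1 ?ltr0n // ler1n.
apply: mean1_dist => // x x01; apply: IHn => s [sn sg].
by apply: FG; split=> [|[|i]] //=; rewrite sn.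
Qed.

(** Replacing one integral by a grid mean costs at most [e], and averaging does not enlarge the
    errors already made; hence n times [e]. *)
Lemma mean_iterated_integral n N F (d e : R) : (0 < N)%N -> N%:R^-1 <= d -> 0 <= e ->
  cube_unif_continuous n F -> cube_close n F d e ->
  `|iterated_integral n F - mean n N F| <= n%:R * e.
Proof.
move=> N0 Nd e0; have d0 : 0 < d by rewrite (lt_le_trans _ Nd) // invr_gt0 ltr0n.
elim: n F => [|n IHn] F uF dF /=; first by rewrite subrr normr0 mul0r.
pose g x := iterated_integral n (fun s => F (x :: s)).
have gd c b : 0 < c -> cube_close n.+1 F c b -> forall x y, 0 <= x <= 1 ->
    0 <= y <= 1 -> `|x - y| <= c -> `|g x - g y| <= b.
  by move=> c0 cF; apply: iterated_integral_continuous cF => // *; exact: iterated_integral_dist.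
have cg : {within `[0, 1], continuous g}.
  by apply: within_continuous_eps => b /uF [c c0 cF]; exists c => //; exact: gd cF.
rewrite -(subrKA (mean1 N g)); apply: le_trans (ler_normD _ _) _.
rewrite -natr1 mulrDl mul1r addrC; apply: lerD.
  apply: mean1_dist => // x /grid_le1 x01; apply: IHn; first exact: cube_unif_continuous_cons.
  exact: cube_close_cons (ltW d0) x01 dF.
apply: mean1_Rintegral => // x y x01 y01 xy.
by apply: gd dF _ _ x01 y01 _ => //; exact: le_trans Nd.
Qed.

Lemma meanD n N F G : mean n N (fun s => F s + G s) = mean n N F + mean n N G.
Proof.
elim: n F G => [|n IHn] F G //=; rewrite /mean1 -mulrDr -big_split /=.
by congr (_ * _); apply: eq_bigr => k _; exact: IHn.
Qed.

Lemma meanZ n N (c : R) F : mean n N (fun s => c * F s) = c * mean n N F.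
Proof.
elim: n F => [|n IHn] F //=; rewrite /mean1 mulrCA; congr (_ * _).
by rewrite mulr_sumr; apply: eq_bigr => k _; exact: IHn.
Qed.

Lemma mean_cst n N (c : R) : (0 < N)%N -> mean n N (fun=> c) = c.
Proof.
move=> N0; elim: n => //= n IHn; rewrite IHn /mean1 sumr_const card_ord.
by rewrite -[c *+ N]mulr_natr mulrCA mulVf ?mulr1 // pnatr_eq0 -lt0n.
Qed.

Lemma mean_cat m n N F :
  mean (m + n) N F = mean m N (fun s => mean n N (fun t => F (s ++ t))).
Proof.
elim: m F => [|m IHm] F //=; rewrite /mean1; congr (_ * _).
by apply: eq_bigr => k _; rewrite IHm.
Qed.

Lemma eq_mean n N F G : (forall s, size s = n -> F s = G s) -> mean n N F = mean n N G.
Proof.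
elim: n F G => [|n IHn] F G FG /=; first exact: FG.
rewrite /mean1; congr (_ * _); apply: eq_bigr => k _.
by apply: IHn => s sn; apply: FG; rewrite /= sn.
Qed.

Definition mean_null n F := forall e, 0 < e -> exists N0 : nat,
  forall N, (N0 < N)%N -> `|mean n N F| <= e.

Lemma mean_nullD n F G : mean_null n F -> mean_null n G ->
  mean_null n (fun s => F s + G s).
Proof.
move=> nF nG e e0; have e2 : 0 < e / 2 by rewrite divr_gt0.
have [N1 F1] := nF _ e2; have [N2 G2] := nG _ e2; exists (maxn N1 N2) => N.
rewrite gtn_max => /andP[/F1 F1' /G2 G2']; rewrite meanD [e]splitr.
exact: le_trans (ler_normD _ _) (lerD F1' G2').
Qed.

Lemma mean_nullZ n (c : R) F : mean_null n F -> mean_null n (fun s => c * F s).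
Proof.
move=> nF e e0; have c1 : 0 < `|c| + 1 by rewrite ltr_wpDl.
have [N0 FN] := nF (e / (`|c| + 1)) (divr_gt0 e0 c1); exists N0 => N /FN.
rewrite ler_pdivlMr // meanZ normrM => h; apply: le_trans h.
by rewrite mulrC ler_wpM2l // lerDl.
Qed.

(* The increments over the grid telescope, and by the mean value theorem they
   are the values of the derivative up to the modulus of continuity. *)
Lemma mean_null_derivative i m F DF :
  (forall s t (x : R), size s = i -> size t = m ->
     is_derive x 1 (fun y => F (s ++ y :: t)) (DF (s ++ x :: t))) ->
  (forall s t, size s = i -> size t = m -> F (s ++ 1 :: t) = F (s ++ 0 :: t)) ->
  cube_unif_continuous (i + m.+1) DF -> mean_null (i + m.+1) DF.
Proof.
move=> dF pF uDF e e0; have [d d0 dDF] := uDF _ e0.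
have [N0 N0d] : exists N0 : nat, d^-1 < N0%:R.
  by exists (Num.truncn d^-1).+1; rewrite truncnS_gt.
exists N0 => N N0N; have Ngt0 : (0 < N)%N by exact: leq_ltn_trans N0N.
have NR : 0 < N%:R :> R by rewrite ltr0n.
have Nd : N%:R^-1 <= d.
  rewrite -[d]invrK lef_pV2 ?posrE ?invr_gt0 //; apply: ltW; apply: lt_trans N0d _.
  by rewrite ltr_nat.
pose q s := N%:R * (F (take i s ++ (nth 0 s i + N%:R^-1) :: drop i.+1 s) - F s).
have q0 : mean (i + m.+1) N q = 0.
  rewrite mean_cat (eq_mean N (G := fun=> 0)) ?mean_cst // => s si.
  rewrite /= /mean1 (eq_bigr (fun k : 'I_N =>
     N%:R * (mean m N (fun t => F (s ++ k.+1%:R / N%:R :: t)) -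
             mean m N (fun t => F (s ++ (k : nat)%:R / N%:R :: t))))); last first.
    move=> k _; rewrite -[_ - _]addr0 -mulN1r -meanZ addr0 -meanD -meanZ.
    apply: eq_mean => t tm; rewrite /q mulN1r take_size_cat // nth_cat si ltnn subnn /=.
    by rewrite drop_cat si ltnNge leqnSn /= subSnn /= drop0 -natr1 mulrDl mul1r.
  rewrite -mulr_sumr -(big_mkord predT (fun k => mean m N (fun t => F (s ++ k.+1%:R / N%:R :: t)) -
             mean m N (fun t => F (s ++ k%:R / N%:R :: t)))).
  rewrite telescope_sumr // divff ?gt_eqF // mul0r.
  rewrite (eq_mean N (G := fun t => F (s ++ 0 :: t))); last by move=> t tm; exact: pF.
  by rewrite subrr !mulr0.
rewrite -[mean _ _ _]subr0 -q0; apply: mean_dist => // s [sz sg].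
have im : (i < size s)%N by rewrite sz addnS ltnS leq_addr.
pose p := take i s; pose t := drop i.+1 s; pose x := nth 0 s i.
have sE : s = p ++ x :: t by rewrite -[LHS](cat_take_drop i) (drop_nth 0 im).
have sp : size p = i by rewrite size_takel // ltnW.
have st : size t = m by rewrite size_drop sz addnS subSS addKn.
pose f y := F (p ++ y :: t).
have df (y : R) : is_derive y 1 f (DF (p ++ y :: t)) by exact: dF.
have /andP[x0 x1] := sg i; rewrite -/x in x0 x1.
have xN : x <= x + N%:R^-1 by rewrite lerDl invr_ge0 ltW.
have cf : {within `[x, x + N%:R^-1], continuous f}.
  by apply: derivable_within_continuous => y _; have [] := df y.
have [y + yE] := MVT_segment xN (fun y _ => df y) cf.
rewrite in_itv /= => /andP[xy yx].
have -> : q s = DF (p ++ y :: t).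
  have -> : q s = N%:R * (f (x + N%:R^-1) - f x) by rewrite /q (f_equal F sE).
  by rewrite yE [x + _]addrC addrK mulrC mulfVK // gt_eqF.
have y01 : 0 <= y <= 1.
  rewrite (le_trans x0 xy) /= (le_trans yx) //.
  by rewrite -lerBrDr.
have cs : in_cube (i + m.+1) s by split=> // j; exact: grid_le1 (sg j).
apply: dDF => // [|j].
  split=> [|j]; first by rewrite size_cat /= sp st.
  have [_ /(_ j)] := cs; rewrite {1 2}sE !nth_cat; case: ifP => // _.
  by case: (j - size p)%N.
rewrite {1}sE !nth_cat; case: ifP => _; first by rewrite subrr normr0 ltW.
case: (j - size p)%N => [|k] /=; last by rewrite subrr normr0 ltW.
by rewrite distrC ger0_norm ?subr_ge0 // (le_trans _ Nd) // lerBlDl.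
Qed.

End Averages.

(** * Averages along a basis of periods *)

Section TorusAverages.
Variables (R : realType) (W : vectType R).
Implicit Types (b : nat -> W) (h : W -> R) (s t : seq R).

Definition cube_point n b s : W := \sum_(i < n) nth 0 s i *: b i.

(** Heine-Cantor theorem: compactness of the cube is used in its near-covering form, the modulus [d]
    tending to 0 from the right being the parameter. *)
Lemma Ck0_cube n b h : Ck 0 h -> cube_unif_continuous n (fun s => h (cube_point n b s)).
Proof.
move=> ch e e0; have e2 : 0 < e / 2 by rewrite divr_gt0.
pose G (z : 'rV[R]_n) := h (0 + \sum_i z 0 i *: b i).
have cG : continuous G by exact: (Ck0_affine (b := fun i : 'I_n => b i) (x := 0) ch).
have /compact_near_coveringP cov : compact [set z : 'rV[R]_n | forall i, `[0, 1]%classic (z 0 i)].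
  exact: (@rV_compact R n (fun=> `[0, 1]%classic) (fun=> @segment_compact R 0 1)).
have near_d : \forall d \near (0 : R)^'+, [set z : 'rV[R]_n | forall i, `[0, 1]%classic (z 0 i)]
    `<=` (fun z => forall z' : 'rV[R]_n, (forall i, `|z 0 i - z' 0 i| <= d) -> `|G z - G z'| <= e).
  apply: cov => z _.
  have /cvgrPdist_lt /(_ _ e2) /nbhs_ballP [d /= d0 dG] := cG z.
  have d2 : 0 < d / 2 by rewrite divr_gt0.
  exists (ball z (d / 2), [set c | c < d / 2]) => /=.
    by split; [exact: nbhsx_ballx | exact: nbhs_right_lt].
  move=> [y c] /= [[_ zy] cd] y' yy'.
  rewrite -(subrKA (G z)) (le_trans (ler_normD _ _)) // [e]splitr lerD // ltW //.
    rewrite distrC; apply: dG; split=> // i j; have := zy i j.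
    rewrite /ball /= => /lt_le_trans; apply; by rewrite ler_pdivrMr // ler_pMr ?ler1n.
  apply: dG; split=> // i j; rewrite /ball /= !ord1.
  rewrite -(subrKA (y 0 j)) (le_lt_trans (ler_normD _ _)) // [d]splitr.
  have := zy 0 j; rewrite /ball /= => zj.
  by rewrite ltrD // (le_lt_trans (yy' j)).
have [d [d0 dP]] := filter_ex (filterI (nbhs_right_gt (0 : R)) near_d).
exists d => // s t [_ s01] [_ t01] st.
have E u : h (cube_point n b u) = G (\row_i nth 0 u i).
  by rewrite /G add0r; congr h; apply: eq_bigr => i _; rewrite mxE.
rewrite !E; apply: dP => i; rewrite !mxE //= ?in_itv /=; first exact: s01.
Qed.

Lemma cube_point_insert i m b s t (y : R) : size s = i ->
  cube_point (i + m.+1) b (s ++ y :: t) = cube_point (i + m.+1) b (s ++ 0 :: t) + y *: b i.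
Proof.
move=> si; have im : (i < i + m.+1)%N by rewrite addnS ltnS leq_addr.
rewrite /cube_point (bigD1 (Ordinal im)) //= [in RHS](bigD1 (Ordinal im)) //=.
rewrite !nth_cat si ltnn subnn /= scale0r add0r addrC.
congr (_ + _); apply: eq_bigr => j; rewrite -val_eqE /= => ji.
rewrite !nth_cat si; case: ltnP => // ij; case E : (j - i)%N => [|k] //.
by move: ji; rewrite eqn_leq ij -subn_eq0 E.
Qed.

Lemma mean_null_ddir i m b h : smooth h -> (forall x, h (x + b i) = h x) ->
  mean_null (i + m.+1) (fun s => ddir (b i) h (cube_point (i + m.+1) b s)).
Proof.
move=> sh ph; pose F s := h (cube_point (i + m.+1) b s).
apply: (mean_null_derivative (F := F)).
- move=> s t x si tm; rewrite cube_point_insert // /F.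
  rewrite (_ : (fun y => _) =
    fun y => h (cube_point (i + m.+1) b (s ++ 0 :: t) + y *: b i)).
    exact: smooth_is_derive.
  by apply/funext => y; rewrite cube_point_insert.
- by move=> s t si tm; rewrite /F cube_point_insert // scale1r ph.
- exact/Ck0_cube/smooth_Ck0/smooth_ddir.
Qed.

End TorusAverages.

(** The integrand depends on the first four coordinates only, so its mean over the larger grid is a
    four-dimensional mean, which approximates the integral. *)
Lemma torus_integral_mean_null (R : realType) (W : vectType R) m (b : nat -> W)
    (L : W -> 'rV[R]_4) (q : 'rV[R]_4 -> R) : Ck 0 q ->
  (forall s, L (cube_point (4 + m) b s) = \row_(i < 4) nth 0 s i) ->
  mean_null (4 + m) (fun s => q (L (cube_point (4 + m) b s))) -> torus_integral q = 0.
Proof.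
move=> cq Lb nq; pose F s := q (\row_(i < 4) nth 0 s i).
have FE : F = fun s => q (cube_point 4 (fun i => delta_mx 0 (inord i)) s).
  apply/funext => s; congr q; rewrite [LHS]row_sum_delta.
  by apply: eq_bigr => i _; rewrite mxE inord_val.
have uF : cube_unif_continuous 4 F by rewrite FE; exact: Ck0_cube.
rewrite -[torus_integral q]/(iterated_integral 4 F); apply: eq_eps => e e0.
(* Four coordinates cost e/8 each and the mean itself at most e/8, in all 5e/8 < e. *)
have e8 : 0 < e / 8 by rewrite divr_gt0.
have [d d0 dF] := uF _ e8; have [N1 N1F] := nq _ e8.
pose N := maxn N1.+1 (Num.truncn d^-1).+1.
have N0 : (0 < N)%N by rewrite leq_max.
have Nd : N%:R^-1 <= d.
  rewrite -[d]invrK lef_pV2 ?posrE ?invr_gt0 ?ltr0n //.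
  apply/ltW/(lt_le_trans (truncnS_gt _)); rewrite ler_nat leq_max leqnn orbT //.
have := mean_iterated_integral N0 Nd (ltW e8) uF dF.
have := N1F N (leq_trans (leqnn _) (leq_maxl _ _)).
have -> : mean (4 + m) N (fun s => q (L (cube_point (4 + m) b s))) = mean 4 N F.
  rewrite mean_cat; apply: eq_mean => s s4; rewrite -[RHS](mean_cst m _ N0).
  apply: eq_mean => t _; rewrite Lb /F; congr q; apply/rowP => i.
  by rewrite !mxE nth_cat s4 ltn_ord.
rewrite subr0; move: (iterated_integral _ _) (mean _ _ _) => I J hJ hI.
have : `|I| <= `|I - J| + `|J| by rewrite -{1}(subrK J I) ler_normD.
move: hI hJ; lra.
Qed.

(* The value of Q /\ (v_0 _| psi) on v_1, ..., v_6. *)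
Definition contraction20 (K : comNzRingType) (Q : nat -> nat -> nat -> K)
    (q : nat -> nat -> nat -> nat -> K) : K :=
  Q 1 2 3 * q 0 4 5 6 - Q 1 2 4 * q 0 3 5 6 + Q 1 2 5 * q 0 3 4 6 - Q 1 2 6 * q 0 3 4 5
  + Q 1 3 4 * q 0 2 5 6 - Q 1 3 5 * q 0 2 4 6 + Q 1 3 6 * q 0 2 4 5
  + Q 1 4 5 * q 0 2 3 6 - Q 1 4 6 * q 0 2 3 5 + Q 1 5 6 * q 0 2 3 4
  - Q 2 3 4 * q 0 1 5 6 + Q 2 3 5 * q 0 1 4 6 - Q 2 3 6 * q 0 1 4 5
  - Q 2 4 5 * q 0 1 3 6 + Q 2 4 6 * q 0 1 3 5 - Q 2 5 6 * q 0 1 3 4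
  + Q 3 4 5 * q 0 1 2 6 - Q 3 4 6 * q 0 1 2 5 + Q 3 5 6 * q 0 1 2 4
  - Q 4 5 6 * q 0 1 2 3.

Section Contraction.
Variables (K : comNzRingType) (M : lmodType K) (b : M -> M -> K).
Hypotheses (bC : forall X Y, b X Y = b Y X)
  (bD : forall X Y Z, b X (Y + Z) = b X Y + b X Z)
  (bZ : forall c X Y, b X (c *: Y) = c * b X Y) (b0 : forall X, b X 0 = 0).
Variables (p : nat -> nat -> M) (q : nat -> nat -> nat -> nat -> K).

(* The value of F /\ psi on six vectors, p and q being the values of the
   2-form F and of the 4-form psi. *)
Definition wedge24 a0 a1 a2 a3 a4 a5 : M :=
  q a2 a3 a4 a5 *: p a0 a1 + (- q a1 a3 a4 a5) *: p a0 a2 + q a1 a2 a4 a5 *: p a0 a3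
  + (- q a1 a2 a3 a5) *: p a0 a4 + q a1 a2 a3 a4 *: p a0 a5 + q a0 a3 a4 a5 *: p a1 a2
  + (- q a0 a2 a4 a5) *: p a1 a3 + q a0 a2 a3 a5 *: p a1 a4 + (- q a0 a2 a3 a4) *: p a1 a5
  + q a0 a1 a4 a5 *: p a2 a3 + (- q a0 a1 a3 a5) *: p a2 a4 + q a0 a1 a3 a4 *: p a2 a5
  + q a0 a1 a2 a5 *: p a3 a4 + (- q a0 a1 a2 a4) *: p a3 a5 + q a0 a1 a2 a3 *: p a4 a5.

(* b(v _| F, F) /\ (v _| psi) = - b(v _| F, v _| F) /\ psi = 0, v being the vector
   number 0; b(v _| F, F) takes the values pfaffian b p 0 i j k. *)
Lemma wedge24_contraction :
  wedge24 0 2 3 4 5 6 = 0 -> wedge24 0 1 3 4 5 6 = 0 -> wedge24 0 1 2 4 5 6 = 0 ->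
  wedge24 0 1 2 3 5 6 = 0 -> wedge24 0 1 2 3 4 6 = 0 -> wedge24 0 1 2 3 4 5 = 0 ->
  contraction20 (fun i j k => pfaffian b p 0 i j k) q = 0.
Proof.
move=> E1 E2 E3 E4 E5 E6.
(* The component [p 0 k] is paired with F /\ psi on the six vectors other than number k, with
   alternating signs; the products of [p 0 i] and [p 0 j] cancel by symmetry of [b]. *)
transitivity (b (p 0 1)%N (wedge24 0 2 3 4 5 6) - b (p 0 2)%N (wedge24 0 1 3 4 5 6)
  + b (p 0 3)%N (wedge24 0 1 2 4 5 6) - b (p 0 4)%N (wedge24 0 1 2 3 5 6)
  + b (p 0 5)%N (wedge24 0 1 2 3 4 6) - b (p 0 6)%N (wedge24 0 1 2 3 4 5)).
  rewrite /contraction20 /pfaffian /wedge24 !bD !bZ.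
  rewrite (bC (p 0 2)%N (p 0 1)%N) (bC (p 0 3)%N (p 0 1)%N) (bC (p 0 4)%N (p 0 1)%N).
  rewrite (bC (p 0 5)%N (p 0 1)%N) (bC (p 0 6)%N (p 0 1)%N) (bC (p 0 3)%N (p 0 2)%N).
  rewrite (bC (p 0 4)%N (p 0 2)%N) (bC (p 0 5)%N (p 0 2)%N) (bC (p 0 6)%N (p 0 2)%N).
  rewrite (bC (p 0 4)%N (p 0 3)%N) (bC (p 0 5)%N (p 0 3)%N) (bC (p 0 6)%N (p 0 3)%N).
  rewrite (bC (p 0 5)%N (p 0 4)%N) (bC (p 0 6)%N (p 0 4)%N) (bC (p 0 6)%N (p 0 5)%N).
  by ring.
by rewrite E1 E2 E3 E4 E5 E6 !b0; ring.
Qed.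

End Contraction.

Lemma mulrz_sign (V : zmodType) (X : V) n : X *~ (-1) ^+ n = if odd n then - X else X.
Proof. by rewrite -signr_odd; case: (odd n); rewrite ?expr0 ?expr1 ?mulr1z ?mulrN1z. Qed.

Lemma sum_pairs6 (V : zmodType) (G : nat -> nat -> V) :
  \sum_(0 <= i < 6) \sum_(0 <= j < 5 | (i <= j)%N) G i j =
  G 0 0 + G 0 1 + G 0 2 + G 0 3 + G 0 4 + G 1 1 + G 1 2 + G 1 3 + G 1 4 +
   G 2 2 + G 2 3 + G 2 4 + G 3 3 + G 3 4 + G 4 4.
Proof. by rewrite unlock /= !addr0 !addrA. Qed.

Lemma sum_pairs4 (V : zmodType) (G : nat -> nat -> V) :
  \sum_(0 <= i < 4) \sum_(0 <= j < 3 | (i <= j)%N) G i j =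
  G 0 0 + G 0 1 + G 0 2 + G 1 1 + G 1 2 + G 2 2.
Proof. by rewrite unlock /= !addr0 !addrA. Qed.

Lemma sum_pairs4_wedge (V : Type) (S : zmodType) (mul : V -> V -> S) (F : nat -> nat -> V) :
  \sum_(i < 4) \sum_(j < 3 | (i <= j)%N)
    mul (F i (bump i j)) (F (bump i (bump j 0)) (bump i (bump j 1))) *~ (-1) ^+ (i + j)%N =
  mul (F 0 1) (F 2 3) - mul (F 0 2) (F 1 3) + mul (F 0 3) (F 1 2) +
  mul (F 1 2) (F 0 3) - mul (F 1 3) (F 0 2) + mul (F 2 3) (F 0 1).
Proof.
pose G i j : S := mul (F i (bump i j)) (F (bump i (bump j 0)) (bump i (bump j 1)))
   *~ (-1) ^+ (i + j)%N.
transitivity (\sum_(0 <= i < 4) \sum_(0 <= j < 3 | (i <= j)%N) G i j).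
  by rewrite big_mkord; apply: eq_bigr => i _; rewrite big_mkord.
by rewrite sum_pairs4 /G !mulrz_sign.
Qed.

Section WedgeExpansion.
Variables (R : realType) (W : vectType R) (r : nat).
Local Notation M := 'M[R[i]]_r.

Lemma wedge24E (f : W -> W -> M) (psi : kform 4 W R) (u : nat -> W) a0 a1 a2 a3 a4 a5 :
  wedge (fun (X : M) (t : R) => t%:C *: X) (fun v : 'I_2 -> W => f (v 0) (v 1)) psi
    (fun i : 'I_(2 + 4) => nth 0 [:: u a0; u a1; u a2; u a3; u a4; u a5] i) =
  wedge24 (fun i j => f (u i) (u j))
    (fun i j k l => (psi (fun n => nth 0 [:: u i; u j; u k; u l] n))%:C) a0 a1 a2 a3 a4 a5.
Proof.
set s := [:: u a0; _; _; _; _; _].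
pose G i j : M := (psi (fun k => nth 0 (del j (del i s)) k))%:C *:
  f (nth 0 s i) (nth 0 (del i s) j) *~ (-1) ^+ (i + j)%N.
rewrite wedge2E.
transitivity (\sum_(0 <= i < 6) \sum_(0 <= j < 5 | (i <= j)%N) G i j).
  rewrite big_mkord; apply: eq_bigr => i _; rewrite big_mkord; apply: eq_bigr => j _.
  have -> : (fun k : 'I_4 => nth 0 s (lift i (lift j k))) = fun k => nth 0 (del j (del i s)) k.
    by apply/funext => k; rewrite !nth_del.
  by rewrite /G nth_del.
rewrite sum_pairs6 /G /s !mulrz_sign /del /=.
by rewrite /wedge24 !scaleNr.
Qed.

End WedgeExpansion.

Section SecondChern.
Variables (R : realType) (r : nat) (A : 'rV[R]_4 -> 'rV[R]_4 -> 'M[R[i]]_r).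

Definition std_vec (i : nat) : 'rV[R]_4 := delta_mx 0 (inord i).

(** The six shuffles coincide in pairs by symmetry of [beta], hence the factor 2. *)
Lemma chern2E x : chern2 A x = (8 * pi ^+ 2)%:C ^-1 *
  (2 * pfaffian (@beta R r) (fun i j => curv A (std_vec i) (std_vec j) x) 0 1 2 3).
Proof.
have dE (i : 'I_4) : delta_mx 0 i = std_vec i by rewrite /std_vec inord_val.
set F := fun i j => curv A (std_vec i) (std_vec j) x.
rewrite /chern2 wedge_beta wedge2E; congr (_ * _).
transitivity (\sum_(i < 4) \sum_(j < 3 | (i <= j)%N)
    beta (F i (bump i j)) (F (bump i (bump j 0)) (bump i (bump j 1))) *~ (-1) ^+ (i + j)%N).
  apply: eq_bigr => i _; apply: eq_bigr => j _.
  by rewrite !curvatureE /= !dE.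
rewrite sum_pairs4_wedge /pfaffian; clearbody F.
rewrite (betaC (F 1 2)%N) (betaC (F 1 3)%N) (betaC (F 2 3)%N).
move: (beta _ (F 2 3)%N) (beta _ (F 1 3)%N) (beta _ (F 1 2)%N) => a b c.
by ring.
Qed.

Lemma csmooth_chern2 : smooth_form A -> csmooth (chern2 A).
Proof.
move=> sA; rewrite (_ : chern2 A = fun x => chern2 A x) //; under eq_fun do rewrite chern2E.
have sb i j k l := csmooth_beta (smooth_curv (std_vec i) (std_vec j) sA)
                                (smooth_curv (std_vec k) (std_vec l) sA).
apply: csmoothM; first exact: csmooth_cst.
apply: csmoothM; first exact: csmooth_cst.
exact: csmoothD (csmoothD (sb _ _ _ _) (csmoothN (sb _ _ _ _))) (sb _ _ _ _).
Qed.

End SecondChern.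

(** * The frame of a fibration *)

Section FibrationFrame.
Variables (R : realType) (S : g2_torus_fibration R) (phi : kform 3 (totV S) R).
Variables (gB : 'M[R]_4) (b : 3.-tuple (subvs_of (sd2 (Defs.eta S)))).
Hypothesis b_basis : lattice_basis (@fib_lattice R S) b.
Local Notation v := (@generator R S b).
Local Notation e := (g2_coframe phi).
Local Notation c := (coord7 e).

Lemma generator_lshift (j : 'I_4) :
  v (lshift 3 j) = (delta_mx 0 j, alpha S (delta_mx 0 j)).
Proof. by rewrite /generator (unsplitK (inl j)). Qed.

Lemma generator_rshift (j : 'I_3) : v (rshift 4 j) = (0, tnth b j).
Proof. by rewrite /generator (unsplitK (inr j)). Qed.

Lemma generator_span (w : totV S) : exists k : 'I_(4 + 3) -> R,
  w = \sum_i k i *: v i /\ forall j, k (lshift 3 j) = proj4 w 0 j.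
Proof.
have [bb _] := b_basis.
pose d := w.2 - alpha S w.1.
exists (fun i => match fintype.split i with inl j => w.1 0 j | inr j => coord b j d end).
split; last by move=> j; rewrite (unsplitK (inl j)).
rewrite big_split_ord /=.
under eq_bigr do rewrite (unsplitK (inl _)) generator_lshift.
under [X in _ + X]eq_bigr do rewrite (unsplitK (inr _)) generator_rshift.
have E1 : \sum_(j < 4) w.1 0 j *: ((delta_mx 0 j, alpha S (delta_mx 0 j)) : totV S) =
    (w.1, alpha S w.1).
  rewrite [w.1 in RHS]row_sum_delta linear_sum /=.
  elim/big_rec3: _ => [|j x y z _ ->] //.
  by rewrite linearZ.
have E2 : \sum_(j < 3) coord b j d *: ((0, tnth b j) : totV S) = (0, d).
  have {2}-> : d = \sum_(j < 3) coord b j d *: tnth b j.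
    rewrite {1}(coord_basis bb (memvf d)); apply: eq_bigr => j _.
    by rewrite (tnth_nth 0).
  elim/big_rec2: _ => [|j x y _ ->] //.
  by apply: injective_projections => //=; rewrite scaler0 addr0.
apply: etrans (esym (f_equal2 (fun x y : totV S => x + y) E1 E2)).
rewrite [w in LHS]surjective_pairing.
by apply: (f_equal2 pair); [rewrite addr0 | rewrite addrC subrK].
Qed.

Hypothesis fibration : associative_fibration phi gB.
Hypothesis v_metric : forall i j, g2_metric phi (v i) (v j) = (i == j)%:R.

Lemma g2_metricE x y : g2_metric phi x y = dot (c x) (c y).
Proof. by rewrite dotE. Qed.

Lemma g2_formE_coframe : phi = g2_form e.
Proof.
have [[e0 e0P] _ _ _] := fibration.
have ex : exists e, [set e | adapted phi e] e by exists e0.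
by have [] := xgetPex [tuple 0 | _ < 7] ex.
Qed.

Lemma g2_metric_sum x (k : 'I_(4 + 3) -> R) :
  g2_metric phi x (\sum_i k i *: v i) = \sum_i k i * g2_metric phi x (v i).
Proof.
rewrite /g2_metric; under eq_bigr do rewrite linear_sum mulr_sumr.
rewrite exchange_big /=; apply: eq_bigr => i _; rewrite mulr_sumr.
by apply: eq_bigr => a _; rewrite linearZ /= mulrCA.
Qed.

(** Inner products with an orthonormal frame read off coefficients, and the first four are the base
    coordinates. The first four generators are therefore horizontal, whatever the shear [alpha]. *)
Lemma metric_horizontal j w : g2_metric phi (v (lshift 3 j)) w = proj4 w 0 j.
Proof.
have [k [wE kj]] := generator_span w; rewrite -kj {1}wE g2_metric_sum.
rewrite (bigD1 (lshift 3 j)) //= v_metric eqxx mulr1 big1 ?addr0 // => i ij.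
by rewrite v_metric eq_sym (negbTE ij) mulr0.
Qed.

Lemma generator_vertical j : vertical (v (rshift 4 j)).
Proof. by rewrite /vertical /= /proj4 generator_rshift. Qed.

Lemma generator_horizontal j : horizontal phi (v (lshift 3 j)).
Proof. by move=> w; rewrite /vertical /= metric_horizontal => ->; rewrite mxE. Qed.

(** The standard basis of the base has orthonormal horizontal lifts, and the projection is a
    Riemannian submersion. *)
Lemma base_metric1 : gB = 1%:M.
Proof.
have [_ _ [_ sub] _] := fibration; apply/matrixP => i j.
have := sub _ _ (generator_horizontal i) (generator_horizontal j).
rewrite metric_horizontal /proj4 !generator_lshift /= => E.
move: E; rewrite trmx_delta -rowE -colE !mxE.
by rewrite eqxx /= => <-.
Qed.

Definition frame_vec (n : nat) : totV S := v (inord n).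

Lemma frame_vec_lshift (j : 'I_4) : v (lshift 3 j) = frame_vec j.
Proof. by congr v; apply/val_inj; rewrite /= inordK // (ltn_trans (ltn_ord j)). Qed.

Lemma frame_vec_rshift (j : 'I_3) : v (rshift 4 j) = frame_vec (4 + j).
Proof. by congr v; apply/val_inj; rewrite /= inordK // ltn_add2l. Qed.

Lemma g2_form_dot (x y z : totV S) :
  phi (fun n : 'I_3 => nth 0 [:: x; y; z] n) = dot (cross (c x) (c y)) (c z).
Proof. by rewrite {1}g2_formE_coframe g2_formE emon_sum_g2. Qed.

Let det_proj : \det (\matrix_(i < 4, j < 4) proj4 (v (lshift 3 i)) 0 j) = 1.
Proof.
rewrite (_ : \matrix_(i, j) _ = 1%:M) ?det1 //; apply/matrixP => i j.
by rewrite !mxE generator_lshift /= mxE eqxx eq_sym.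
Qed.

Let fibre_form (t : 'S_3) :
  0 < g2_vol phi (fun i : 'I_(4 + 3) => match fintype.split i with
    inl a => v (lshift 3 a) | inr a => v (rshift 4 (t a)) end) ->
  phi (fun j => v (rshift 4 (t j))) = 1.
Proof.
move=> vol0; have [_ _ _ assoc] := fibration.
apply: (assoc (fun i => v (lshift 3 i))) => //; first by rewrite det_proj.
- by move=> i; exact: generator_vertical.
- by move=> i j; rewrite v_metric (inj_eq (@rshift_inj 4 3)) (inj_eq perm_inj).
Qed.

Let i01 : 'S_3 := tperm 0 1.

Let vol_id : g2_vol phi (fun i : 'I_(4 + 3) => match fintype.split i with
    inl a => v (lshift 3 a) | inr a => v (rshift 4 ((1%g : 'S_3) a)) end) =
  \det (frame_mx e v).
Proof.
congr (\det _); apply/matrixP => a i; rewrite !mxE; congr (tnth e a _).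
transitivity (v (unsplit (fintype.split (i : 'I_(4 + 3))))); last by rewrite splitK.
by case: fintype.split => d //=; rewrite perm1.
Qed.

Let vol_swap : g2_vol phi (fun i : 'I_(4 + 3) => match fintype.split i with
    inl a => v (lshift 3 a) | inr a => v (rshift 4 (i01 a)) end) =
  - \det (frame_mx e v).
Proof.
pose s : 'S_(4 + 3) := tperm (rshift 4 (0 : 'I_3)) (rshift 4 (1 : 'I_3)).
rewrite [LHS](_ : _ = \det (col_perm s (frame_mx e v))).
  by rewrite col_permE det_mulmx det_perm odd_permV odd_tperm mulrN1.
congr (\det _); apply/matrixP => a i; rewrite !mxE; congr (tnth e a _).
transitivity (v (s (unsplit (fintype.split (i : 'I_(4 + 3)))))); last by rewrite splitK.
case: fintype.split => d /=; congr v.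
  by rewrite tpermD // -val_eqE /= gtn_eqF // ltn_addr.
exact: (inj_tperm _ _ _ (@rshift_inj 4 3)).
Qed.

(** [associative_fibres] concerns positively oriented frames. If the determinant is -1, exchanging
    two fibre vectors makes it 1, and phi is then -1 on the original triple; in both cases [P]
    equals the determinant. *)
Lemma det_frame_fibre :
  let P := dot (cross (c (frame_vec 4)) (c (frame_vec 5))) (c (frame_vec 6)) in
  P ^+ 2 = 1 /\ \det (frame_mx e v) * P = 1.
Proof.
move=> P; have orth i j : dot (c (v i)) (c (v j)) = (i == j)%:R by rewrite -g2_metricE v_metric.
have d1 := det_frame_sqr orth.
have E (t : 'S_3) : phi (fun j => v (rshift 4 (t j))) =
    dot (cross (c (v (rshift 4 (t 0)))) (c (v (rshift 4 (t 1))))) (c (v (rshift 4 (t 2)))).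
  rewrite -g2_form_dot; congr phi; apply/funext => j.
  have [->|[->|->]] : j = 0 \/ j = 1 \/ j = 2; rewrite //=.
  by case: j => [[|[|[|//]]] ?]; [left|right; left|right; right]; exact/val_inj.
have F4 : frame_vec 4 = v (rshift 4 0) by rewrite frame_vec_rshift.
have F5 : frame_vec 5 = v (rshift 4 1) by rewrite frame_vec_rshift.
have F6 : frame_vec 6 = v (rshift 4 2) by rewrite frame_vec_rshift.
have sgn : \det (frame_mx e v) = 1 \/ \det (frame_mx e v) = -1.
  by move/eqP: d1; rewrite sqrf_eq1 => /orP[]/eqP ->; [left|right].
have Q : P = \det (frame_mx e v).
  case: sgn => d; rewrite d.
    have := E 1%g; rewrite fibre_form; last by rewrite vol_id d.
    by rewrite !perm1 -F4 -F5 -F6 => ->.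
  have := E i01; rewrite fibre_form; last by rewrite vol_swap d opprK.
  rewrite tpermL tpermR tpermD // -F4 -F5 -F6 => h.
  apply: oppr_inj; rewrite opprK h /P /dot /cross /minor2 /=; ring.
by rewrite Q d1 -expr2 d1.
Qed.

Let metric_dot i j : dot (c (v i)) (c (v j)) = (i == j)%:R.
Proof. by rewrite -g2_metricE v_metric. Qed.

Lemma frame_vec_dot i j : (i < 7)%N -> (j < 7)%N ->
  dot (c (frame_vec i)) (c (frame_vec j)) = (i == j)%:R.
Proof. by move=> i7 j7; rewrite metric_dot -val_eqE /= !inordK. Qed.

Lemma psi4_horizontal :
  psi4 (c (frame_vec 0)) (c (frame_vec 1)) (c (frame_vec 2)) (c (frame_vec 3)) = 1.
Proof. by have [_ <-] := det_frame_fibre; apply: psi4_frame. Qed.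

Lemma psi4_fibre w :
  psi4 (c (frame_vec 4)) (c (frame_vec 5)) (c (frame_vec 6)) w = 0.
Proof. by have [P2 _] := det_frame_fibre; apply: psi4_associative; rewrite ?frame_vec_dot. Qed.

End FibrationFrame.

(** When exactly one index is below 4 it can be moved to the front; the other three then repeat or
    are a permutation of 4, 5, 6. *)
Lemma alternating4_eq0 (R : realType) (N : nat -> nat -> nat -> nat -> R) :
  (forall i j k l, N j i k l = - N i j k l) ->
  (forall i j k l, N i k j l = - N i j k l) ->
  (forall i j k l, N i j l k = - N i j k l) ->
  (forall i j k l, [&& i < 7, j < 7, k < 7 & l < 7]%N ->
     ((i < 4) + (j < 4) + (k < 4) + (l < 4))%N <> 1%N -> N i j k l = 0) ->
  (forall i, (i < 4)%N -> N i 4%N 5%N 6%N = 0) ->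
  forall i j k l, [&& i < 7, j < 7, k < 7 & l < 7]%N -> N i j k l = 0.
Proof.
move=> s12 s23 s34 N0 N1.
have eqN0 (x : R) : x = - x -> x = 0 by move=> h; lra.
have d23 i j l : N i j j l = 0 by apply: eqN0; rewrite {1}s23.
have d34 i j l : N i j l l = 0 by apply: eqN0; rewrite {1}s34.
have d24 i j l : N i j l j = 0 by rewrite s34 d23 oppr0.
have front i j k l : (i < 4)%N -> [&& 3 < j < 7, 3 < k < 7 & 3 < l < 7]%N -> N i j k l = 0.
  move=> i4 /and3P[].
  do 7?[case: j => [|j] //]; move=> _; do 7?[case: k => [|k] //]; move=> _;
  do 7?[case: l => [|l] //]; move=> _; rewrite ?(d23, d34, d24) //.
  - exact: N1.
  - by rewrite s34 N1 ?oppr0.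
  - by rewrite s23 N1 ?oppr0.
  - by rewrite s34 s23 N1 ?oppr0.
  - by rewrite s23 s34 N1 ?oppr0.
  - by rewrite s34 s23 s34 N1 ?oppr0.
move=> i j k l ijkl; have [|h] := eqVneq ((i < 4) + (j < 4) + (k < 4) + (l < 4))%N 1%N; last first.
  by apply: N0 => //; exact/eqP.
have [i7 j7 k7 l7] := and4P ijkl.
case: (ltnP i 4) => i4; case: (ltnP j 4) => j4; case: (ltnP k 4) => k4;
  case: (ltnP l 4) => l4 // _.
- by rewrite front ?i4 ?j4 ?j7 ?k4 ?k7 ?l4 ?l7.
- by rewrite s12 front ?i4 ?j4 ?i7 ?k4 ?k7 ?l4 ?l7 ?oppr0.
- by rewrite s23 s12 front ?i4 ?i7 ?j4 ?j7 ?k4 ?k7 ?l4 ?l7 ?oppr0.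
- by rewrite s34 s23 s12 front ?i4 ?i7 ?j4 ?j7 ?k4 ?k7 ?l4 ?l7 ?oppr0.
Qed.

Section Psi4Form.
Variables (R : realType) (W : vectType R).
Implicit Type e : 7.-tuple 'Hom(W, R^o).

Definition dual4 e (x y z w : W) : R :=
  psi4 (coord7 e x) (coord7 e y) (coord7 e z) (coord7 e w).

Lemma coord7P e s u w : coord7 e (s *: u + w) = fun a => s * coord7 e u a + coord7 e w a.
Proof. by apply/funext => a; rewrite /coord7 /coord_of linearP. Qed.

Lemma dual4_sum n e (k : 'I_n -> R) (v : 'I_n -> W) y z w :
  dual4 e (\sum_i k i *: v i) y z w = \sum_i k i * dual4 e (v i) y z w.
Proof.
have P s x x' : dual4 e (s *: x + x') y z w = s * dual4 e x y z w + dual4 e x' y z w.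
  rewrite /dual4 coord7P; move: (coord7 e x) (coord7 e x') (coord7 e y) (coord7 e z) (coord7 e w).
  by move=> X X' Y Z T; rewrite /psi4 /dot /cross /minor2 /=; ring.
elim/big_rec2: _ => [|i s t _ <-]; last exact: P.
by apply: (addrI (dual4 e 0 y z w)); rewrite -{1}[dual4 e 0 y z w]mul1r -P scaler0 !addr0.
Qed.

Lemma dual4_swap12 e x y z w : dual4 e y x z w = - dual4 e x y z w.
Proof. exact: psi4_swap12. Qed.
Lemma dual4_swap23 e x y z w : dual4 e x z y w = - dual4 e x y z w.
Proof. exact: psi4_swap23. Qed.
Lemma dual4_swap34 e x y z w : dual4 e x y w z = - dual4 e x y z w.
Proof. exact: psi4_swap34. Qed.

Lemma g2_star_dual4 (phi : kform 3 W R) x y z w :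
  g2_star phi (fun n => nth 0 [:: x; y; z; w] n) = dual4 (g2_coframe phi) x y z w.
Proof. by rewrite /g2_star g2_dual_formE emon_sum_g2_dual. Qed.

End Psi4Form.

(** * Components of a transverse perturbation *)

Section Transverse.
Variables (R : realType) (S : g2_torus_fibration R) (phi dphi : kform 3 (totV S) R).
Variables (gB : 'M[R]_4) (b : 3.-tuple (subvs_of (sd2 (Defs.eta S)))).
Hypothesis b_basis : lattice_basis (@fib_lattice R S) b.
Hypothesis fibration : associative_fibration phi gB.
Hypothesis v_metric : forall i j,
  g2_metric phi (@generator R S b i) (generator b j) = (i == j)%:R.
Local Notation v := (frame_vec b).
Local Notation psi := (dual4 (g2_coframe phi)).
Local Notation psi' := (dual4 (g2_coframe (phi \+ dphi))).

Lemma frame_vec_span w : exists k : 'I_7 -> R, w = \sum_i k i *: v i.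
Proof.
have [k [-> _]] := generator_span b_basis w; exists k.
by apply: eq_bigr => i _; rewrite /frame_vec inord_val.
Qed.

Lemma frame_vec_horizontal n : (n < 4)%N -> horizontal phi (v n).
Proof.
by move=> n4; rewrite -(@frame_vec_lshift _ _ _ (Ordinal n4)); apply: generator_horizontal.
Qed.

Lemma frame_vec_vertical n : (3 < n < 7)%N -> vertical (v n).
Proof.
case/andP => n3 n7; have n4 : (n - 4 < 3)%N by rewrite ltn_subLR.
rewrite -(subnKC n3) -(@frame_vec_rshift _ _ _ (Ordinal n4)); exact: generator_vertical.
Qed.

Lemma transverse_component : transverse_perturbation phi dphi ->
  exists2 a, (a < 4)%N & psi' (v a) (v 4) (v 5) (v 6) <> 0.
Proof.
case=> _ deg xi0; apply: contrapT => H; apply: xi0; apply/funext => u.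
have C a : (a < 4)%N -> psi' (v a) (v 4) (v 5) (v 6) = 0.
  by move=> a4; apply: contrapT => h; apply: H; exists a.
pose X x y z w : R := psi' x y z w - psi x y z w.
have XE x y z w : xi_of phi dphi (fun n => nth 0 [:: x; y; z; w] n) = X x y z w.
  by rewrite /xi_of /= !g2_star_dual4.
have X12 x y z w : X y x z w = - X x y z w by rewrite /X !(dual4_swap12 _ x); ring.
have X23 x y z w : X x z y w = - X x y z w by rewrite /X !(dual4_swap23 _ x y); ring.
have X34 x y z w : X x y w z = - X x y z w by rewrite /X !(dual4_swap34 _ x y z); ring.
have X_span y z w : (forall i : 'I_7, X (v i) y z w = 0) -> forall x, X x y z w = 0.
  move=> h x; have [k ->] := frame_vec_span x.
  rewrite /X !dual4_sum -sumrB big1 // => i _; rewrite -mulrBr.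
  by rewrite [_ - _](h i) mulr0.
have -> : u = fun n : 'I_4 => nth 0 [:: u 0; u 1; u 2; u 3] n.
  apply/funext => n.
  have [->|[->|[->|->]]] : n = 0 \/ n = 1 \/ n = 2 \/ n = 3; rewrite //=.
  by case: n => [[|[|[|[|//]]]] ?]; [left|right; left|do 2 right; left|do 3 right];
     exact/val_inj.
have Z12 x y z w : X x y z w = 0 -> X y x z w = 0 by move=> h; rewrite X12 h oppr0.
have Z23 x y z w : X x y z w = 0 -> X x z y w = 0 by move=> h; rewrite X23 h oppr0.
have Z34 x y z w : X x y z w = 0 -> X x y w z = 0 by move=> h; rewrite X34 h oppr0.
(* [X_span] acts on the first slot, so each argument in turn is brought to the front, expanded on
   the frame and moved back. *)
rewrite XE; apply: (X_span) => i; apply: (Z12); apply: (X_span) => j; apply/Z12/Z23/Z12.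
apply: (X_span) => k; apply/Z12/Z23/Z34/Z23/Z12; apply: (X_span) => l; apply/Z12/Z23/Z34.
apply: (alternating4_eq0 (N := fun i j k l => X (v i) (v j) (v k) (v l))) => //.
- move=> {}i {}j {}k {}l ijkl n1; rewrite -XE.
  pose s : seq nat := [:: i; j; k; l].
  have s7 (n : 'I_4) : (nth 0%N s n < 7)%N.
    by apply: (allP (a := fun m => (m < 7)%N)) (mem_nth _ _) => //=; rewrite andbT.
  rewrite (_ : (fun n => _) = fun n : 'I_4 => v (nth 0%N s n)); last first.
    by apply/funext; case=> [[|[|[|[|//]]]] ?].
  apply: (deg (finset (fun n : 'I_4 => nth 0%N s n < 4)%N)) => [n|n|].
  + by rewrite inE; exact: frame_vec_horizontal.
  + by rewrite inE -leqNgt => n4; apply: frame_vec_vertical; rewrite n4 s7.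
  + rewrite -sum1_card big_mkcond !big_ord_recl big_ord0 !inE /= => h; apply: n1.
    apply: etrans h; rewrite addn0 !addnA; do 4?case: (_ < 4)%N => //.
- move=> a a4; change (X (v a) (v 4) (v 5) (v 6) = 0); rewrite /X C // sub0r.
  apply/eqP; rewrite oppr_eq0; apply/eqP.
  rewrite dual4_swap12 dual4_swap23 dual4_swap34.
  by rewrite /dual4 (psi4_fibre fibration v_metric) !oppr0.
- by rewrite !ltn_ord.
Qed.

End Transverse.

(** * Averages of curvature polynomials *)

Section ComplexMeans.
Variables (R : realType) (W : vectType R) (n : nat) (b : nat -> W).
Local Notation C := R[i].
Implicit Types f g : W -> C.

Definition cmean_null f : Prop :=
  mean_null n (fun s => complex.Re (f (cube_point n b s))) /\
  mean_null n (fun s => complex.Im (f (cube_point n b s))).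

Lemma eq_cmean_null f g : (forall x, f x = g x) -> cmean_null f -> cmean_null g.
Proof. by move=> /funext ->. Qed.

Lemma cmean_nullD f g : cmean_null f -> cmean_null g -> cmean_null (fun x => f x + g x).
Proof.
move=> [f1 f2] [g1 g2]; split.
  rewrite (_ : (fun s => _) = fun s => complex.Re (f (cube_point n b s)) +
    complex.Re (g (cube_point n b s))); first exact: mean_nullD.
  by apply/funext => s; case: (f _) (g _) => [? ?] [? ?].
rewrite (_ : (fun s => _) = fun s => complex.Im (f (cube_point n b s)) +
  complex.Im (g (cube_point n b s))); first exact: mean_nullD.
by apply/funext => s; case: (f _) (g _) => [? ?] [? ?].
Qed.

Lemma cmean_nullZ (c : C) f : cmean_null f -> cmean_null (fun x => c * f x).
Proof.
case: c => a d [f1 f2]; split.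
  rewrite (_ : (fun s => _) = fun s => a * complex.Re (f (cube_point n b s)) +
    - d * complex.Im (f (cube_point n b s))).
    by apply: mean_nullD; apply: mean_nullZ.
  by apply/funext => s; case: (f _) => x y /=; rewrite mulNr.
rewrite (_ : (fun s => _) = fun s => a * complex.Im (f (cube_point n b s)) +
  d * complex.Re (f (cube_point n b s))).
  by apply: mean_nullD; apply: mean_nullZ.
by apply/funext => s; case: (f _) => x y /=.
Qed.

Lemma cmean_nullN f : cmean_null f -> cmean_null (fun x => - f x).
Proof. by move/(cmean_nullZ (- 1)); apply: eq_cmean_null => x; rewrite mulN1r. Qed.

Lemma cmean_nullB f g : cmean_null f -> cmean_null g -> cmean_null (fun x => f x - g x).
Proof. by move=> nf /cmean_nullN; apply: cmean_nullD. Qed.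

Lemma cmean_nullZr f (c : C) : cmean_null f -> cmean_null (fun x => f x * c).
Proof. by move/(cmean_nullZ c); apply: eq_cmean_null => x; rewrite mulrC. Qed.

#[local] Transparent cdir.
Lemma cmean_null_cdir i f : (i < n)%N -> csmooth f ->
  (forall x, f (x + b i) = f x) -> cmean_null (cdir (b i) f).
Proof.
move=> /subnKC; rewrite addSnnS => nE [s1 s2] pf; rewrite /cmean_null -nE.
split.
  by apply: (@mean_null_ddir _ _ i _ b (fun x => complex.Re (f x)) s1) => x; rewrite pf.
by apply: (@mean_null_ddir _ _ i _ b (fun x => complex.Im (f x)) s2) => x; rewrite pf.
Qed.
#[local] Opaque cdir.

End ComplexMeans.

Section PfaffianMean.
Variables (R : realType) (W : vectType R) (r n : nat) (b : nat -> W).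
Local Notation M := 'M[R[i]]_r.
Variables (A B : W -> W -> M) (g : nat -> W -> M).
Hypotheses (sA : smooth_form A) (sB : smooth_form B).
Hypotheses (sg : forall i, (i < n)%N -> smooth_mx (g i))
  (gu : forall i x, (i < n)%N -> g i x \in unitmx)
  (gA : forall i, (i < n)%N -> equivariant (b i) (g i) A)
  (gB : forall i, (i < n)%N -> equivariant (b i) (g i) B).

Lemma cmean_null_pfaffian i j k l :
  (i < n)%N -> (j < n)%N -> (k < n)%N -> (l < n)%N ->
  cmean_null n b (fun x =>
    pfaffian (@beta R r) (fun i j => curv A (b i) (b j) x) i j k l -
    pfaffian (@beta R r) (fun i j => curv B (b i) (b j) x) i j k l).
Proof.
move=> ni nj nk nl; pose v a := b (nth 0%N [:: i; j; k; l] a).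
have T a X Y Z : (a < n)%N -> cmean_null n b (cdir (b a) (transgression A B X Y Z)).
  move=> na; have p x : transgression A B X Y Z (x + b a) = transgression A B X Y Z x.
    exact: (transgression_periodic _ _ _ _ sA sB (sg na) (fun y => @gu a y na) (gA na) (gB na)).
  exact: (cmean_null_cdir na (csmooth_transgression X Y Z sA sB) p).
have N := cmean_nullZ 2^-1 (cmean_nullB (cmean_nullD (cmean_nullB
  (T i (b j) (b k) (b l) ni) (T j (b i) (b k) (b l) nj)) (T k (b i) (b j) (b l) nk))
  (T l (b i) (b j) (b k) nl)).
apply: (eq_cmean_null _ N) => x.
have := transgression_formula v x sA sB; rewrite /v /= => <-.
by rewrite mulKf // pnatr_eq0.
Qed.

End PfaffianMean.

Section Connections.
Variables (R : realType) (W : vectType R) (Gam : set W) (r : nat).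
Local Notation M := 'M[R[i]]_r.
Variables (G : set M) (g : W -> W -> M).
Hypotheses (G_compact : compact_group G) (g_bundle : bundle Gam G g).

Lemma group_unit X : G X -> X \in unitmx.
Proof. by have [GL_G _ _ _ _] := G_compact; exact: GL_G. Qed.

Lemma cocycle_unit l x : Gam l -> g l x \in unitmx.
Proof. by have [_ gG _] := g_bundle => Gl; apply: group_unit; exact: gG. Qed.

Lemma connection_equivariant A l : connection Gam G g A -> Gam l -> equivariant l (g l) A.
Proof.
case=> _ _ _ eA Gl x v; have gu := cocycle_unit x Gl.
by rewrite eA // mulmxBl !mulmxKV.
Qed.

Lemma gauge_class_refl A : gauge_class Gam G g A A.
Proof.
have [_ G1 _ _ _] := G_compact; exists (fun=> 1%:M).
  split=> [||l x _]; [exact: smooth_mx_cst | by [] | by rewrite mulmx1 mul1mx].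
apply/funext => x; apply/funext => v; rewrite /gauge_act ddir_mx_cst.
by rewrite invmx1 mulmx1 mul1mx mul0mx subr0.
Qed.

End Connections.

Section CurvatureLinear.
Variables (R : realType) (W : vectType R) (r : nat).
Local Notation M := 'M[R[i]]_r.
Variable A : W -> W -> M.
Hypotheses (sA : smooth_form A)
  (lA : forall x (c : R) u v, A x (c *: u + v) = c%:C *: A x u + A x v).

Lemma curv_linear_algebra (c : R[i]) (dYu dYw duY dwY u w y : M) :
  (c *: duY + dwY) - (c *: dYu + dYw) + ((c *: u + w) *m y - y *m (c *: u + w)) =
  c *: (duY - dYu + (u *m y - y *m u)) + (dwY - dYw + (w *m y - y *m w)).
Proof.
rewrite mulmxDl mulmxDr -scalemxAl -scalemxAr.
move: (u *m y) (y *m u) (w *m y) (y *m w) => uy yu wy yw.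
by apply/matrixP => i j; rewrite !mxE; ring.
Qed.

#[local] Transparent curv.
Lemma curv_linearl c u w Y x : curv A (c *: u + w) Y x = c%:C *: curv A u Y x + curv A w Y x.
Proof.
have s1 : smooth_mx (fun _ : W => c%:C%:M : M) by exact: smooth_mx_cst.
have D : ddir_mx Y (A ^~ (c *: u + w)) x = c%:C *: ddir_mx Y (A ^~ u) x + ddir_mx Y (A ^~ w) x.
  have -> : A ^~ (c *: u + w) = fun y => (c%:C%:M *m A y u) + A y w.
    by apply/funext => y; rewrite lA mul_scalar_mx.
  rewrite (ddir_mxD _ _ (smooth_mxM s1 (sA u)) (sA w)) (ddir_mxM _ _ s1 (sA u)).
  by rewrite ddir_mx_cst mul0mx add0r mul_scalar_mx.
have D' : ddir_mx (c *: u + w) (A ^~ Y) x = c%:C *: ddir_mx u (A ^~ Y) x + ddir_mx w (A ^~ Y) x.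
  by rewrite (ddir_mxDr _ _ _ (sA Y)) (ddir_mxZr _ _ _ (sA Y)).
rewrite [curv A (_ + _) _ _]/curv D D' lA.
exact: curv_linear_algebra.
Qed.

#[local] Opaque curv.

Lemma curv0r X x : curv A X 0 x = 0.
Proof.
have z (Z : M) : Z = 1 *: Z + Z -> Z = 0.
  by rewrite scale1r => h; apply: (addrI Z); rewrite -h addr0.
have h := curv_linearl 1 0 0 X x; rewrite scaler0 addr0 in h.
by rewrite curvC (z _ h) oppr0.
Qed.

End CurvatureLinear.

Section FibrationPullback.
Variables (R : realType) (S : g2_torus_fibration R) (r : nat).
Local Notation M := 'M[R[i]]_r.
Local Notation f := (@proj4 R S).
Local Notation L := (@tilde_lattice R S).
Variables (G : set M) (E : 'rV[R]_4 -> 'rV[R]_4 -> M).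
Hypotheses (G_compact : compact_group G) (E_bundle : bundle (@Z4 R) G E).

Lemma proj4_linear c u v : f (c *: u + v) = c *: f u + f v.
Proof. by []. Qed.

Lemma proj4_lattice l : L l -> Z4 (f l).
Proof. by case=> mu [nu [? _ ->]]. Qed.

Lemma pullback_connection A : connection (@Z4 R) G E A ->
  connection L G (pullback_bundle f E) (pullback f A).
Proof.
case=> sA lA gA eA; split=> [v|x c u v|x v|l x v Ll].
- exact: (smooth_mx_pullback proj4_linear (sA (f v))).
- exact: lA.
- exact: gA.
- rewrite /pullback_bundle (ddir_mx_pullback proj4_linear).
  exact: (eA (f l) (f x) (f v) (proj4_lattice Ll)).
Qed.

Lemma pullback_cocycle : bundle L G (pullback_bundle f E).
Proof.
have [sE GE cE] := E_bundle; split=> [l Ll|l x Ll|l m x Ll Lm].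
- exact: (smooth_mx_pullback proj4_linear (sE _ (proj4_lattice Ll))).
- exact: GE (proj4_lattice Ll).
- exact: cE (proj4_lattice Ll) (proj4_lattice Lm).
Qed.

Lemma curv_pullback (A : 'rV[R]_4 -> 'rV[R]_4 -> M) X Y x :
  curv (pullback f A) X Y x = curv A (f X) (f Y) (f x).
Proof.
have D Z T := ddir_mx_pullback proj4_linear Z (A ^~ (f T)) x.
exact: (f_equal2 (fun a b => a - b + (A (f x) (f X) *m A (f x) (f Y) -
  A (f x) (f Y) *m A (f x) (f X))) (D X Y) (D Y X)).
Qed.

End FibrationPullback.

(** [s] exchanges 0 and [a], and the constant is the sign of this exchange. It allows the
    contraction, written for the vector number 0, to be used with any horizontal vector. *)
Lemma pfaffian_tperm (R : realType) (r : nat) a : (a < 4)%N ->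
  let s i := if i == 0%N then a else if i == a then 0%N else i in
  exists c : R[i], forall F : nat -> nat -> 'M[R[i]]_r, (forall i j, F i j = - F j i) ->
    pfaffian (@beta R r) F 0 1 2 3 =
    c * pfaffian (@beta R r) (fun i j => F (s i) (s j)) 0 1 2 3.
Proof.
move=> a4; exists (if a == 0%N then 1 else - 1) => F FC; pose B i j k l := beta (F i j) (F k l).
have BC i j k l : B i j k l = B k l i j by exact: betaC.
have BN i j k l : B i j k l = - B j i k l by rewrite /B FC betaNl.
case: a a4 => [|[|[|[|//]]]] _ /=; rewrite /pfaffian /= -!/(B _ _ _ _).
- by rewrite mul1r.
- rewrite (BN 1 0)%N (BC 1 2 0 3)%N (BC 1 3 0 2)%N.
  move: (B 0 1 2 3)%N (B 0 2 1 3)%N (B 0 3 1 2)%N => x y z; ring.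
- rewrite (BN 2 1)%N (BC 1 2 0 3)%N (BN 2 0)%N (BC 2 3 1 0)%N (BN 1 0)%N.
  move: (B 0 1 2 3)%N (B 0 2 1 3)%N (B 0 3 1 2)%N => x y z; ring.
- rewrite (BC 3 1 2 0)%N (BN 2 0)%N (BC 0 2 3 1)%N (BN 3 1)%N (BC 1 3 0 2)%N.
  rewrite (BC 3 2 1 0)%N (BN 1 0)%N (BC 0 1 3 2)%N (BN 3 2)%N (BC 2 3 0 1)%N (BN 3 0)%N.
  move: (B 0 1 2 3)%N (B 0 2 1 3)%N (B 0 3 1 2)%N => x y z; ring.
Qed.

Lemma eq_pfaffian (R : realType) (r : nat) (F F' : nat -> nat -> 'M[R[i]]_r) :
  (forall i j, (i < 4)%N -> (j < 4)%N -> F i j = F' i j) ->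
  pfaffian (@beta R r) F 0 1 2 3 = pfaffian (@beta R r) F' 0 1 2 3.
Proof. by move=> FF; rewrite /pfaffian !FF. Qed.

(** Each of the three products has a factor that involves k; for a pulled-back curvature the vector
    k will be vertical. *)
Lemma pfaffian_eq0 (R : realType) (r : nat) (F : nat -> nat -> 'M[R[i]]_r) i j k :
  F 0%N k = 0 -> F i k = 0 -> F j k = 0 -> pfaffian (@beta R r) F 0 i j k = 0.
Proof.
have b0l X : beta (0 : 'M[R[i]]_r) X = 0 by rewrite betaC beta0r.
by rewrite /pfaffian => -> -> ->; rewrite b0l !beta0r subrr addr0.
Qed.

(** Here Q comes from the instanton and D is its difference with the pullback. They agree as soon as
    a vertical vector occurs, so the component 1 2 3 alone tells them apart, and it is expressed by
    D, whose averages vanish. *)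
Lemma contraction20_base (K : comNzRingType) (Q D : nat -> nat -> nat -> K)
    (q : nat -> nat -> nat -> nat -> K) : contraction20 Q q = 0 ->
  (forall i j k, (i < j < k)%N -> (3 < k < 7)%N -> D i j k = Q i j k) ->
  (Q 1%N 2%N 3%N - D 1%N 2%N 3%N) * q 0%N 4%N 5%N 6%N = - contraction20 D q.
Proof.
move=> h DQ; rewrite -[RHS]addr0 -h /contraction20.
rewrite (DQ 1 2 4 isT isT)%N (DQ 1 2 5 isT isT)%N (DQ 1 2 6 isT isT)%N (DQ 1 3 4 isT
  isT)%N (DQ 1 3 5 isT isT)%N (DQ 1 3 6 isT isT)%N (DQ 1 4 5 isT isT)%N (DQ 1 4 6 isT isT)%N
  (DQ 1 5 6 isT isT)%N (DQ 2 3 4 isT isT)%N (DQ 2 3 5 isT isT)%N (DQ 2 3 6 isT isT)%N (DQ 2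
  4 5 isT isT)%N (DQ 2 4 6 isT isT)%N (DQ 2 5 6 isT isT)%N (DQ 3 4 5 isT isT)%N (DQ 3 4 6
  isT isT)%N (DQ 3 5 6 isT isT)%N (DQ 4 5 6 isT isT)%N.
by ring.
Qed.

Lemma cmean_null_contraction20 (R : realType) (W : vectType R) n (b : nat -> W)
    (D : nat -> nat -> nat -> W -> R[i]) (q : nat -> nat -> nat -> nat -> R[i]) :
  (forall i j k, (i < 7)%N -> (j < 7)%N -> (k < 7)%N -> cmean_null n b (D i j k)) ->
  cmean_null n b (fun x => contraction20 (fun i j k => D i j k x) q).
Proof.
move=> nD; have T i j k (c : R[i]) : (i < 7)%N -> (j < 7)%N -> (k < 7)%N ->
    cmean_null n b (fun x => D i j k x * c).
  by move=> i7 j7 k7; exact: (cmean_nullZr c (nD i j k i7 j7 k7)).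
have P f i j k (c : R[i]) : (i < 7)%N -> (j < 7)%N -> (k < 7)%N -> cmean_null n b f ->
    cmean_null n b (fun x => f x + D i j k x * c).
  by move=> i7 j7 k7 nf; exact: (cmean_nullD nf (T i j k c i7 j7 k7)).
have N f i j k (c : R[i]) : (i < 7)%N -> (j < 7)%N -> (k < 7)%N -> cmean_null n b f ->
    cmean_null n b (fun x => f x - D i j k x * c).
  by move=> i7 j7 k7 nf; exact: (cmean_nullB nf (T i j k c i7 j7 k7)).
cbv beta delta [contraction20].
apply: (N _ 4 5 6 _ isT isT isT).
apply: (P _ 3 5 6 _ isT isT isT).
apply: (N _ 3 4 6 _ isT isT isT).
apply: (P _ 3 4 5 _ isT isT isT).
apply: (N _ 2 5 6 _ isT isT isT).
apply: (P _ 2 4 6 _ isT isT isT).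
apply: (N _ 2 4 5 _ isT isT isT).
apply: (N _ 2 3 6 _ isT isT isT).
apply: (P _ 2 3 5 _ isT isT isT).
apply: (N _ 2 3 4 _ isT isT isT).
apply: (P _ 1 5 6 _ isT isT isT).
apply: (N _ 1 4 6 _ isT isT isT).
apply: (P _ 1 4 5 _ isT isT isT).
apply: (P _ 1 3 6 _ isT isT isT).
apply: (N _ 1 3 5 _ isT isT isT).
apply: (P _ 1 3 4 _ isT isT isT).
apply: (N _ 1 2 6 _ isT isT isT).
apply: (P _ 1 2 5 _ isT isT isT).
apply: (N _ 1 2 4 _ isT isT isT).
exact: (T 1 2 3 _ isT isT isT).
Qed.

(** * The Chern number in the presence of a perturbed instanton *)

Section NoInstantons.
Variables (R : realType) (S : g2_torus_fibration R) (phi dphi : kform 3 (totV S) R).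
Variables (gB : 'M[R]_4) (fibration : associative_fibration phi gB) (r : nat).
Local Notation M := 'M[R[i]]_r.
Local Notation f := (@proj4 R S).
Local Notation L := (@tilde_lattice R S).
Variables (G : set M) (E : 'rV[R]_4 -> 'rV[R]_4 -> M).
Hypotheses (G_compact : compact_group G) (E_bundle : bundle (@Z4 R) G E).
Variable b : 3.-tuple (subvs_of (sd2 (Defs.eta S))).
Hypothesis b_basis : lattice_basis (@fib_lattice R S) b.
Hypothesis v_metric : forall i j,
  g2_metric phi (@generator R S b i) (generator b j) = (i == j)%:R.
Local Notation v := (frame_vec b).

Lemma frame_vec_lattice n : L (v n).
Proof.
have [_ LE] := b_basis; rewrite /frame_vec /generator.
have L0 (m : subvs_of (sd2 (Defs.eta S))) (c : 'I_3 -> int) :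
    \sum_(i < 3) tnth b i *~ c i = m -> (@fib_lattice R S) m.
  by move=> <-; rewrite LE; exists c.
case: fintype.split => j.
  exists (delta_mx 0 j), 0; split; last by rewrite add0r.
    by exists (delta_mx 0 j); rewrite map_delta_mx.
  by apply: (L0 _ (fun=> 0)); rewrite big1 // => i _; rewrite mulr0z.
exists 0, (tnth b j); split; last by rewrite linear0 addr0.
  by exists 0; rewrite map_mx0.
apply: (L0 _ (fun i => (i == j)%:R)); rewrite (bigD1 j) //= eqxx mulr1z big1 ?addr0 // => i.
by move/negbTE ->; rewrite mulr0z.
Qed.

Lemma proj4_frame_vec n : (n < 7)%N -> f (v n) = if (n < 4)%N then std_vec R n else 0.
Proof.
move=> n7; case: ltnP => n4; last by apply: frame_vec_vertical; rewrite n4.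
rewrite -(frame_vec_lshift b (Ordinal n4)) generator_lshift /proj4 /= /std_vec.
by congr delta_mx; apply/val_inj; rewrite /= inordK.
Qed.

(** The cube spanned by the frame lies over the unit cube on which [torus_integral] is computed. *)
Lemma proj4_cube s : f (cube_point (4 + 3) v s) = \row_(i < 4) nth 0 s i.
Proof.
have fE : f (cube_point 7 v s) = \sum_(i < 7) nth 0 s i *: f (v i).
  by apply: (big_morph f) => //= x y; rewrite -[x]scale1r proj4_linear !scale1r.
rewrite fE (@big_split_ord _ _ _ 4 3) /= [X in _ + X]big1 ?addr0 => [|i _].
  rewrite [RHS]row_sum_delta; apply: eq_bigr => i _.
  by rewrite proj4_frame_vec /= ?ltn_ord ?(ltn_trans (ltn_ord i)) // /std_vec inord_val mxE.
have -> : f (v (rshift 4 i)) = 0 by apply: frame_vec_vertical; have := ltn_ord i => /=; lia.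
by rewrite scaler0.
Qed.

Section Instanton.
Variables (A : totV S -> totV S -> M) (A0 : 'rV[R]_4 -> 'rV[R]_4 -> M).
Hypotheses (A_conn : connection L G (pullback_bundle f E) A)
  (A_inst : g2_instanton (phi \+ dphi) A) (A0_conn : connection (@Z4 R) G E A0).
Local Notation B := (pullback f A0).

Lemma cmean_null_pfaffian_pullback i j k l :
  (i < 7)%N -> (j < 7)%N -> (k < 7)%N -> (l < 7)%N ->
  cmean_null 7 v (fun x =>
    pfaffian (@beta R r) (fun i j => curv A (v i) (v j) x) i j k l -
    pfaffian (@beta R r) (fun i j => curv B (v i) (v j) x) i j k l).
Proof.
have bE := pullback_cocycle S E_bundle; have B_conn := pullback_connection S A0_conn.
have [sA _ _ _] := A_conn; have [sB _ _ _] := B_conn; have [sg _ _] := bE.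
apply: (cmean_null_pfaffian (g := fun i => pullback_bundle f E (v i)) sA sB) => i0 //.
- by move=> _; apply: sg; exact: frame_vec_lattice.
- by move=> x _; apply: (cocycle_unit G_compact bE); exact: frame_vec_lattice.
- by move=> _; apply: (connection_equivariant G_compact bE A_conn); exact: frame_vec_lattice.
- by move=> _; apply: (connection_equivariant G_compact bE B_conn); exact: frame_vec_lattice.
Qed.

Lemma curv_pullback_vertical i j x : (i < 7)%N -> (3 < j < 7)%N ->
  curv B (v i) (v j) x = 0.
Proof.
move=> i7 j7; have [sA lA _ _] := A0_conn; rewrite curv_pullback.
by have -> : f (v j) = 0; [exact: frame_vec_vertical | exact: curv0r].
Qed.

Lemma wedge24_instanton (s : nat -> nat) a0 a1 a2 a3 a4 a5 x :
  wedge24 (fun i j => curv A (v (s i)) (v (s j)) x)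
    (fun i j k l => (dual4 (g2_coframe (phi \+ dphi)) (v (s i)) (v (s j)) (v (s k)) (v (s l)))%:C)
    a0 a1 a2 a3 a4 a5 = 0.
Proof.
pose u i := v (s i); pose psi := g2_star (phi \+ dphi).
have -> : (fun i j k l => (dual4 (g2_coframe (phi \+ dphi)) (v (s i)) (v (s j)) (v (s k))
    (v (s l)))%:C) = fun i j k l => (psi (fun n => nth 0 [:: u i; u j; u k; u l] n))%:C.
  apply/funext => i; apply/funext => j; apply/funext => k; apply/funext => l.
  by rewrite /psi g2_star_dual4.
exact: (etrans (esym (wedge24E (fun X Y => curv A X Y x) psi u a0 a1 a2 a3 a4 a5))
  (A_inst x _)).
Qed.

Lemma cmean_null_pfaffian_base : transverse_perturbation phi dphi ->
  cmean_null 7 v (fun x => pfaffian (@beta R r) (fun i j => curv B (v i) (v j) x) 0 1 2 3).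
Proof.
move=> /(transverse_component b_basis fibration v_metric)[a a4 q0].
(* The horizontal vector on which the perturbed form is nonzero takes the place of number 0; the
   vertical vectors stay fixed. *)
pose s i := if i == 0%N then a else if i == a then 0%N else i.
have s7 i : (i < 7)%N -> (s i < 7)%N.
  by rewrite /s => i7; do 2?case: ifP => // _; rewrite (ltn_trans a4).
have s3 i : (3 < i)%N -> s i = i.
  rewrite /s; case: eqP => [-> //|_ i3]; case: eqP => // ia.
  by move: i3; rewrite ia ltnNge -ltnS a4.
pose q i j k l : R[i] :=
  (dual4 (g2_coframe (phi \+ dphi)) (v (s i)) (v (s j)) (v (s k)) (v (s l)))%:C.
pose QA i j k x := pfaffian (@beta R r) (fun i j => curv A (v (s i)) (v (s j)) x) 0 i j k.
pose QB i j k x := pfaffian (@beta R r) (fun i j => curv B (v (s i)) (v (s j)) x) 0 i j k.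
pose D i j k x := QA i j k x - QB i j k x.
have D0 i j k : (i < 7)%N -> (j < 7)%N -> (k < 7)%N -> cmean_null 7 v (D i j k).
  move=> i7 j7 k7.
  exact: (cmean_null_pfaffian_pullback (s7 0%N isT) (s7 i i7) (s7 j j7) (s7 k k7)).
have QB0 i j k x : (i < j < k)%N -> (3 < k < 7)%N -> QB i j k x = 0.
  move=> /andP[ij jk] /andP[k3 k7]; have j7 := ltn_trans jk k7; have i7 := ltn_trans ij j7.
  have V m : (m < 7)%N -> curv B (v (s m)) (v (s k)) x = 0.
    by move=> m7; rewrite (s3 k k3) curv_pullback_vertical ?s7 // k3.
  by apply: pfaffian_eq0; exact: V.
have q4 : q 0%N 4%N 5%N 6%N != 0.
  apply/negP => /eqP /(f_equal (@complex.Re R)); rewrite /q (s3 4 isT)%N (s3 5 isT)%N (s3 6 isT)%N.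
  exact: q0.
have C x : contraction20 (fun i j k => QA i j k x) q = 0.
  pose W6 := wedge24_instanton s.
  exact: (wedge24_contraction (@betaC R r) (@betaDr R r) (@betaZr R r) (@beta0r R r)
    (W6 0 2 3 4 5 6 x)%N (W6 0 1 3 4 5 6 x)%N (W6 0 1 2 4 5 6 x)%N
    (W6 0 1 2 3 5 6 x)%N (W6 0 1 2 3 4 6 x)%N (W6 0 1 2 3 4 5 x)%N).
have QB1 x : QB 1%N 2%N 3%N x * q 0%N 4%N 5%N 6%N = - contraction20 (fun i j k => D i j k x) q.
  have h : forall i j k, (i < j < k)%N -> (3 < k < 7)%N -> D i j k x = QA i j k x.
    by move=> i j k ijk k7; rewrite /D (QB0 i j k x ijk k7) subr0.
  rewrite -(contraction20_base (C x) h) /D.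
  by rewrite opprB addrC subrK.
(* The perturbed 4-form is constant on the torus, so its nonzero value [q 0 4 5 6] can be divided
   out of the average. *)
have N : cmean_null 7 v (QB 1%N 2%N 3%N).
  apply: (eq_cmean_null _ (cmean_nullZr (q 0 4 5 6)%N^-1 (cmean_nullN
    (cmean_null_contraction20 q D0)))) => x.
  by rewrite -QB1 mulfK.
have [k kF] := pfaffian_tperm R r a4.
apply: (eq_cmean_null _ (cmean_nullZ k N)) => x; rewrite (kF (fun i j => curv B (v i) (v j) x)) //.
by move=> i j; rewrite curvC.
Qed.

Lemma cmean_null_chern2 : transverse_perturbation phi dphi ->
  cmean_null 7 v (fun x => chern2 A0 (f x)).
Proof.
move=> /cmean_null_pfaffian_base N.
apply: (eq_cmean_null _ (cmean_nullZ ((8 * pi ^+ 2)%:C^-1 * 2) N)) => x.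
have fv i : (i < 4)%N -> f (v i) = std_vec R i.
  by move=> i4; rewrite proj4_frame_vec ?i4 // (ltn_trans i4).
have P : pfaffian (@beta R r) (fun i j => curv B (v i) (v j) x) 0 1 2 3 =
    pfaffian (@beta R r) (fun i j => curv A0 (std_vec R i) (std_vec R j) (f x)) 0 1 2 3.
  by apply: eq_pfaffian => i j i4 j4; rewrite curv_pullback !fv.
rewrite chern2E -P; exact: (esym (mulrA _ _ _)).
Qed.

Lemma torus_integral_chern2_eq0 : transverse_perturbation phi dphi ->
  torus_integral (fun x => complex.Re (chern2 A0 x)) = 0 /\
  torus_integral (fun x => complex.Im (chern2 A0 x)) = 0.
Proof.
move=> /cmean_null_chern2[nr ni]; have [sA0 _ _ _] := A0_conn.
have [sr si] := csmooth_chern2 sA0.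
by split; apply: (torus_integral_mean_null (m := 3) (b := v) (L := f) _ proj4_cube) => //;
   exact: smooth_Ck0.
Qed.

End Instanton.

End NoInstantons.

Lemma no_instantons (R : realType) (S : g2_torus_fibration R) (phi dphi : kform 3 (totV S) R)
    (gB : 'M[R]_4) (r : nat) (G : set 'M[R[i]]_r) (E : 'rV[R]_4 -> 'rV[R]_4 -> 'M[R[i]]_r) :
  associative_fibration phi gB -> compact_group G -> bundle (@Z4 R) G E ->
  c2 G E <> 0 -> transverse_perturbation phi dphi ->
  moduli (@tilde_lattice R S) G (pullback_bundle (@proj4 R S) E)
    (g2_instanton (phi \+ dphi)) = set0.
Proof.
move=> fib Gc bE c20 tr; have [_ [b b_basis v_metric] _ _] := fib.
apply/seteqP; split=> // c [A [Ac Ai] _]; apply: c20; rewrite /c2.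
(* If E had no connection, [c2] would be its default value 0, against the hypothesis; a reference
   connection therefore exists. *)
set P := [set c | _]; have [ex|nex] := pselect (exists c, P c); last first.
  by apply: xgetPN => c' Pc'; apply: nex; exists c'.
have [A0 A0c ->] := xgetPex 0 ex.
by have [-> ->] := torus_integral_chern2_eq0 fib Gc bE b_basis v_metric Ac Ai A0c tr.
Qed.

(** * Self-dual forms *)

(** Applied to real and imaginary parts of matrix entries, this reduces the instanton equation to
    real 2-forms. *)
Lemma wedge_map (V : Type) (A A' B : Type) (S S' : zmodType) (mul : A -> B -> S)
    (mul' : A' -> B -> S') (h : S -> S') (h' : A -> A') k l (a : kform k V A) (b : kform l V B) v :
  (forall x y, h (x - y) = h x - h y) -> (forall x y, h (mul x y) = mul' (h' x) y) ->
  h (wedge mul a b v) = wedge mul' (fun u => h' (a u)) b v.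
Proof.
move=> hB hM; have h0 : h 0 = 0 by rewrite -(subrr 0) hB subrr.
have hN x : h (- x) = - h x by rewrite -sub0r hB h0 sub0r.
have hD x y : h (x + y) = h x + h y by rewrite -{1}[y]opprK hB hN opprK.
rewrite /wedge (big_morph h hD h0); apply: eq_bigr => s _.
by rewrite -hM !mulrz_sign; case: ifP.
Qed.

(* foldr instead of the locked \sum, so that it evaluates on concrete matrices. *)
Fixpoint det_expand (K : comNzRingType) n (m : nat -> nat -> K) : K :=
  if n is n'.+1 then
    foldr (fun j s => m 0%N j * ((-1) ^+ j * det_expand n' (fun i k => m i.+1 (bump j k))) + s)
      0 (iota 0 n)
  else 1.

Lemma det_expandE (K : comNzRingType) n (m : nat -> nat -> K) :
  \det (\matrix_(i < n, j < n) m i j) = det_expand n m.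
Proof.
elim: n m => [|n IHn] m; first by rewrite det_mx00.
transitivity (\sum_(0 <= j < n.+1)
    m 0%N j * ((-1) ^+ j * det_expand n (fun i k => m i.+1 (bump j k)))); last first.
  by rewrite unlock /index_iota subn0.
rewrite (expand_det_row _ ord0) /= big_mkord; apply: eq_bigr => j _; rewrite mxE /cofactor -IHn.
congr (_ * (_ * \det _)); apply/matrixP => i k; rewrite !mxE; congr m.
Qed.

Lemma levi_civitaE (R : realType) (i j k l : 'I_4) :
  levi_civita R i j k l =
    det_expand 4 (fun a b => (nth 0%N [:: val i; val j; val k; val l] a == b)%:R).
Proof.
rewrite -det_expandE; congr (\det _); apply/matrixP => a b; rewrite !mxE; congr (_ %:R).
rewrite (tnth_nth i) -val_eqE /=; congr (_ == _)%N.
by case: a => [[|[|[|[|]]]]].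
Qed.

Lemma self_dual_matrix (R : realType) (w : 'M[R]_4) : hodge 1%:M w = w ->
  let W i j : R := w (inord i) (inord j) in
  [/\ forall i j, W i j = - W j i, W 2%N 3%N = W 0%N 1%N, W 1%N 3%N = - W 0%N 2%N
    & W 1%N 2%N = W 0%N 3%N].
Proof.
move=> hw W; have skew i j : W i j = - W j i.
  by have := hodge_skew 1%:M w; rewrite hw => /matrixP/(_ (inord j) (inord i)); rewrite !mxE.
have lc k l : (k < 4)%N -> (l < 4)%N ->
    W k l = 2^-1 * \sum_(0 <= i < 4) \sum_(0 <= j < 4)
      det_expand 4 (fun a b => (nth 0%N [:: i; j; k; l] a == b)%:R) * W i j.
  move=> k4 l4; rewrite {1}/W -{1}hw mxE det1 sqrtr1 mulr1 big_mkord; congr (_ * _).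
  apply: eq_bigr => i _; rewrite big_mkord; apply: eq_bigr => j _.
  by rewrite levi_civitaE /= !inordK // /W !inord_val invmx1 trmx1 mul1mx mulmx1.
have W01 := lc 0%N 1%N isT isT; have W02 := lc 0%N 2%N isT isT.
have W03 := lc 0%N 3%N isT isT; rewrite unlock /= /bump /= in W01 W02 W03.
(* Each sum has two nonzero terms, as in [W 0 1 = (W 2 3 - W 3 2) / 2]; skewness merges them. *)
split=> //.
- by rewrite W01 (skew 3 2)%N; field.
- by rewrite W02 (skew 3 1)%N; field.
- by rewrite W03 (skew 2 1)%N; field.
Qed.

Section SelfDualForms.
Variable R : realType.
Implicit Types h k x y : nat -> R.

(** The Binet-Cauchy identity. *)
Lemma lagrange_pairs7 h k x y : dot h x * dot k y - dot k x * dot h y =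
  \sum_(p <- pairs7) minor2 h k p.1 p.2 * minor2 x y p.1 p.2.
Proof. by rewrite unlock /= /dot /minor2; ring. Qed.

(* The pullback of a self-dual form with components w1, w2, w3, the horizontal
   vectors having coordinates h 0, ..., h 3. *)
Definition sd_coeff (h : nat -> nat -> R) (w1 w2 w3 : R) a b : R :=
  w1 * (minor2 (h 0%N) (h 1%N) a b + minor2 (h 2%N) (h 3%N) a b) +
  w2 * (minor2 (h 0%N) (h 2%N) a b - minor2 (h 1%N) (h 3%N) a b) +
  w3 * (minor2 (h 0%N) (h 3%N) a b + minor2 (h 1%N) (h 2%N) a b).

Lemma self_dual_sum (W : nat -> nat -> R) (h : nat -> nat -> R) x y :
  (forall i j, W i j = - W j i) -> W 2%N 3%N = W 0%N 1%N -> W 1%N 3%N = - W 0%N 2%N ->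
  W 1%N 2%N = W 0%N 3%N ->
  \sum_(k < 4) \sum_(l < 4) dot (h k) x * dot (h l) y * W k l =
  \sum_(p <- pairs7) sd_coeff h (W 0%N 1%N) (W 0%N 2%N) (W 0%N 3%N) p.1 p.2 * minor2 x y p.1 p.2.
Proof.
move=> skew e23 e13 e12; have d i : W i i = 0 by have := skew i i; lra.
pose m (k l : nat) := dot (h k) x * dot (h l) y - dot (h l) x * dot (h k) y.
transitivity (W 0%N 1%N * (m 0%N 1%N + m 2%N 3%N) + W 0%N 2%N * (m 0%N 2%N - m 1%N 3%N) +
  W 0%N 3%N * (m 0%N 3%N + m 1%N 2%N)).
  rewrite !big_ord_recl !big_ord0 /= /bump /= !add1n !d (skew 1 0)%N (skew 2 0)%N (skew 3 0)%N.
  by rewrite (skew 2 1)%N (skew 3 1)%N (skew 3 2)%N e23 e13 e12 /m; ring.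
rewrite /m !lagrange_pairs7 -!(sumrB, big_split) /= !mulr_sumr -!big_split /=.
by apply: eq_bigr => p _; rewrite /sd_coeff; ring.
Qed.

(** The seven left-hand sides are the components of a combination of the vectors h_0 × h_i + h_j ×
    h_k, with (i, j, k) cyclic, which vanish by [cross_coassociative]. *)
Lemma sd_coeff_cross (h : nat -> nat -> R) (w1 w2 w3 : R) :
  (forall i j, (i < 4)%N -> (j < 4)%N -> dot (h i) (h j) = (i == j)%:R) ->
  psi4 (h 0%N) (h 1%N) (h 2%N) (h 3%N) = 1 ->
  let C := sd_coeff h w1 w2 w3 in
  [/\ C 2%N 5%N + C 3%N 6%N + C 4%N 7%N = 0,
      - C 1%N 5%N + C 4%N 6%N - C 3%N 7%N = 0,
      - C 1%N 6%N - C 4%N 5%N + C 2%N 7%N = 0 &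
  [/\ - C 1%N 7%N + C 3%N 5%N - C 2%N 6%N = 0,
      C 6%N 7%N + C 1%N 2%N - C 3%N 4%N = 0,
      - C 5%N 7%N + C 1%N 3%N + C 2%N 4%N = 0 &
      C 5%N 6%N + C 1%N 4%N - C 2%N 3%N = 0]].
Proof.
move=> hO psi1 C.
(* Cyclic permutations of the last three vectors are even. *)
have p1 : psi4 (h 0%N) (h 2%N) (h 3%N) (h 1%N) = 1.
  by rewrite psi4_swap34 psi4_swap23 opprK.
have p2 : psi4 (h 0%N) (h 3%N) (h 1%N) (h 2%N) = 1.
  by rewrite psi4_swap23 psi4_swap34 opprK.
have X1 := @cross_coassociative R (h 0%N) (h 1%N) (h 2%N) (h 3%N).
have X2 := @cross_coassociative R (h 0%N) (h 2%N) (h 3%N) (h 1%N).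
have X3 := @cross_coassociative R (h 0%N) (h 3%N) (h 1%N) (h 2%N).
rewrite !hO // in X1 X2 X3.
have K a : (0 < a < 8)%N ->
    w1 * (cross (h 0%N) (h 1%N) a + cross (h 2%N) (h 3%N) a) +
    w2 * (cross (h 0%N) (h 2%N) a + cross (h 3%N) (h 1%N) a) +
    w3 * (cross (h 0%N) (h 3%N) a + cross (h 1%N) (h 2%N) a) = 0.
  by move=> a8; rewrite X1 // X2 // X3 // !mulr0 !addr0.
split; [| | | split].
- by apply: etrans (K 1%N isT); rewrite /C /sd_coeff /cross /minor2 /=; ring.
- by apply: etrans (K 2%N isT); rewrite /C /sd_coeff /cross /minor2 /=; ring.
- by apply: etrans (K 3%N isT); rewrite /C /sd_coeff /cross /minor2 /=; ring.
- by apply: etrans (K 4%N isT); rewrite /C /sd_coeff /cross /minor2 /=; ring.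
- by apply: etrans (K 5%N isT); rewrite /C /sd_coeff /cross /minor2 /=; ring.
- by apply: etrans (K 6%N isT); rewrite /C /sd_coeff /cross /minor2 /=; ring.
- by apply: etrans (K 7%N isT); rewrite /C /sd_coeff /cross /minor2 /=; ring.
Qed.

End SelfDualForms.

Lemma alt_form_expand (R : realType) n (q : 'rV[R]_n -> 'rV[R]_n -> R) X Y :
  (forall c u w Z, q (c *: u + w) Z = c * q u Z + q w Z) -> (forall u w, q w u = - q u w) ->
  q X Y = \sum_(k < n) \sum_(l < n) X 0 k * Y 0 l * q (delta_mx 0 k) (delta_mx 0 l).
Proof.
move=> ql qC; have q0 Z : q 0 Z = 0.
  by have := ql 1 0 0 Z; rewrite scaler0 addr0 mul1r => h; lra.
have S Z T : q Z T = \sum_(k < n) Z 0 k * q (delta_mx 0 k) T.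
  rewrite [Z in LHS]row_sum_delta; elim/big_rec2: _ => [|k x y _ <-]; first exact: q0.
  exact: ql.
rewrite S; apply: eq_bigr => k _; rewrite qC S -sumrN mulr_sumr; apply: eq_bigr => l _.
by rewrite -mulrN -qC mulrA.
Qed.

#[local] Arguments emon {R W} e I v.

Lemma emon_minor2 (R : realType) (W : vectType R) (e : 7.-tuple 'Hom(W, R^o)) a b
    (u : 'I_2 -> W) :
  emon e [:: a; b] u = minor2 (coord7 e (u 0)) (coord7 e (u 1)) a b.
Proof.
rewrite emon2 (_ : lift ord0 ord0 = 1); last exact/val_inj.
by rewrite /minor2 /coord7; ring.
Qed.

(** * Lifting self-dual connections *)

Section LiftInstanton.
Variables (R : realType) (S : g2_torus_fibration R) (phi : kform 3 (totV S) R).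
Variables (gB : 'M[R]_4) (fibration : associative_fibration phi gB) (r : nat).
Local Notation M := 'M[R[i]]_r.
Local Notation f := (@proj4 R S).
Local Notation c := (coord7 (g2_coframe phi)).
Variable b : 3.-tuple (subvs_of (sd2 (Defs.eta S))).
Hypothesis b_basis : lattice_basis (@fib_lattice R S) b.
Hypothesis v_metric : forall i j,
  g2_metric phi (@generator R S b i) (generator b j) = (i == j)%:R.
Local Notation h := (fun k => c (frame_vec b k)).

(** The pullback of dx^k is the inner product with the k-th horizontal vector; this gives
    pulled-back forms their coefficients in the coframe. *)
Lemma proj4_dot (k : 'I_4) w : f w 0 k = dot (h k) (c w).
Proof. by rewrite -g2_metricE -frame_vec_lshift metric_horizontal. Qed.

Lemma wedge_self_dual (q : 'rV[R]_4 -> 'rV[R]_4 -> R) v :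
  (forall s u w Z, q (s *: u + w) Z = s * q u Z + q w Z) -> (forall u w, q w u = - q u w) ->
  hodge 1%:M (\matrix_(k, l) q (delta_mx 0 k) (delta_mx 0 l)) =
    \matrix_(k, l) q (delta_mx 0 k) (delta_mx 0 l) ->
  wedge *%R (fun u : 'I_2 -> totV S => q (f (u 0)) (f (u 1))) (g2_star phi) v = 0.
Proof.
move=> ql qC sd.
pose W (i j : nat) : R := q (delta_mx 0 (inord i)) (delta_mx 0 (inord j)).
have [skew e23 e13 e12] : [/\ forall i j, W i j = - W j i, W 2%N 3%N = W 0%N 1%N,
    W 1%N 3%N = - W 0%N 2%N & W 1%N 2%N = W 0%N 3%N].
  by have [_ k2 k3 k4] := self_dual_matrix sd; rewrite !mxE in k2 k3 k4; split=> // i j; exact: qC.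
pose C := sd_coeff h (W 0%N 1%N) (W 0%N 2%N) (W 0%N 3%N).
have -> : (fun u : 'I_2 -> totV S => q (f (u 0)) (f (u 1))) =
    fun u => \sum_(p <- pairs7) C p.1 p.2 * emon (g2_coframe phi) [:: p.1; p.2] u.
  apply/funext => u; rewrite (alt_form_expand _ _ ql qC).
  under [RHS]eq_bigr do rewrite emon_minor2.
  rewrite -(self_dual_sum h _ _ skew e23 e13 e12); apply: eq_bigr => k _; apply: eq_bigr => l _.
  by rewrite !proj4_dot /W !inord_val.
have [i j i4 j4||C1 C2 C3 [C4 C5 C6 C7]] :=
    @sd_coeff_cross R h (W 0%N 1%N) (W 0%N 2%N) (W 0%N 3%N).
- exact: (frame_vec_dot v_metric (ltn_trans i4 _) (ltn_trans j4 _)).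
- exact: (psi4_horizontal fibration v_metric).
exact: (@wedge_dual_eq0 R _ (g2_coframe phi) C v C1 C2 C3 C4 C5 C6 C7).
Qed.

End LiftInstanton.

Section LiftCurvature.
Variables (R : realType) (S : g2_torus_fibration R) (phi : kform 3 (totV S) R).
Variables (gB : 'M[R]_4) (fibration : associative_fibration phi gB) (r : nat).
Local Notation M := 'M[R[i]]_r.
Local Notation f := (@proj4 R S).

Lemma wedge_self_dual_part (A : 'rV[R]_4 -> 'rV[R]_4 -> M) (p : M -> R) x v : smooth_form A ->
  (forall x (c : R) u w, A x (c *: u + w) = c%:C *: A x u + A x w) ->
  (forall X Y, p (X - Y) = p X - p Y) -> (forall c X, p (c%:C *: X) = p X * c) ->
  (let w := \matrix_(k, l) p (curv A (delta_mx 0 k) (delta_mx 0 l) (f x)) in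
   hodge 1%:M w = w) ->
  p (wedge (fun (X : M) (t : R) => t%:C *: X) (curvature (pullback f A) x) (g2_star phi) v) = 0.
Proof.
move=> sA lA pB pZ sd; have [_ [b b_basis v_metric] _ _] := fibration.
rewrite (wedge_map (h' := p) (mul' := *%R) _ _ _ pB) //.
pose q X Y := p (curv A X Y (f x)).
have -> : (fun u => p (curvature (pullback f A) x u)) =
    fun u : 'I_2 -> totV S => q (f (u 0)) (f (u 1)).
  by apply/funext => u; rewrite curvatureE curv_pullback.
have p0 : p 0 = 0 by rewrite -(subrr 0) pB subrr.
have pN X : p (- X) = - p X by rewrite -sub0r pB p0 sub0r.
have pD X Y : p (X + Y) = p X + p Y by rewrite -{1}[Y]opprK pB pN opprK.
have ql s u w Z : q (s *: u + w) Z = s * q u Z + q w Z.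
  by rewrite /q (curv_linearl sA lA) pD pZ mulrC.
have qC u w : q w u = - q u w by rewrite /q curvC pN.
exact: (@wedge_self_dual _ _ _ _ fibration b b_basis v_metric q v ql qC sd).
Qed.

(** The dual 4-form is real, so the equation splits into the real and imaginary parts of the matrix
    entries, each self-dual for the base metric, which is the identity. *)
Lemma pullback_instanton (A : 'rV[R]_4 -> 'rV[R]_4 -> M) : smooth_form A ->
  (forall x (c : R) u w, A x (c *: u + w) = c%:C *: A x u + A x w) ->
  self_dual gB A -> g2_instanton phi (pullback f A).
Proof.
move=> sA lA sd x v; have [_ [b b_basis v_metric] _ _] := fibration.
rewrite (base_metric1 b_basis fibration v_metric) in sd.
apply/matrixP => a a'; have [sr si] := sd (f x) a a'; rewrite [RHS]mxE.
have lr := @wedge_self_dual_part A (fun X => complex.Re (X a a')) x v sA lA.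
have li := @wedge_self_dual_part A (fun X => complex.Im (X a a')) x v sA lA.
have rB (X Y : M) : complex.Re ((X - Y) a a') = complex.Re (X a a') - complex.Re (Y a a').
  by rewrite !mxE; case: (X a a') (Y a a') => [? ?] [? ?].
have iB (X Y : M) : complex.Im ((X - Y) a a') = complex.Im (X a a') - complex.Im (Y a a').
  by rewrite !mxE; case: (X a a') (Y a a') => [? ?] [? ?].
have rZ (c : R) (X : M) : complex.Re ((c%:C *: X) a a') = complex.Re (X a a') * c.
  by rewrite mxE; case: (X a a') => y z /=; ring.
have iZ (c : R) (X : M) : complex.Im ((c%:C *: X) a a') = complex.Im (X a a') * c.
  by rewrite mxE; case: (X a a') => y z /=; ring.
move: (lr rB rZ sr) (li iB iZ si); move: (wedge _ _ _ v) => w.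
by case: (w a a') => y z /= -> ->.
Qed.

End LiftCurvature.

(** * Gauge classes and pullback *)

Section GaugeClasses.
Variables (R : realType) (W : vectType R) (Gam : set W) (r : nat).
Local Notation M := 'M[R[i]]_r.
Variables (G : set M) (g : W -> W -> M).
Hypothesis G_compact : compact_group G.

Lemma gauge_transformationM u u' : gauge_transformation Gam G g u ->
  gauge_transformation Gam G g u' -> gauge_transformation Gam G g (fun x => u' x *m u x).
Proof.
have [_ _ GM _ _] := G_compact => -[su Gu eu] [su' Gu' eu']; split=> [|x|l x Gl].
- exact: smooth_mxM.
- exact: GM.
- by rewrite -mulmxA eu // mulmxA eu' // mulmxA.
Qed.

Lemma gauge_actM u u' A : gauge_transformation Gam G g u ->
  gauge_transformation Gam G g u' ->
  gauge_act u' (gauge_act u A) = gauge_act (fun x => u' x *m u x) A.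
Proof.
move=> [su Gu _] [su' Gu' _]; apply/funext => x; apply/funext => v; rewrite /gauge_act.
have uu := group_unit G_compact (Gu x); have uu' := group_unit G_compact (Gu' x).
have -> : invmx (u' x *m u x) = invmx (u x) *m invmx (u' x).
  have P : (u' x *m u x) *m (invmx (u x) *m invmx (u' x)) = 1%:M.
    by rewrite mulmxA mulmxK // mulmxV.
  by rewrite -[LHS]mulmx1 -P mulKmx // unitmx_mul uu' uu.
rewrite (ddir_mxM v x su' su).
move: (ddir_mx v u x) (ddir_mx v u' x) (A x v) => du du' a.
have -> : (du' *m u x + u' x *m du) *m (invmx (u x) *m invmx (u' x)) =
    du' *m invmx (u' x) + u' x *m du *m invmx (u x) *m invmx (u' x).
  by rewrite mulmxDl !mulmxA mulmxK.
rewrite mulmxBr mulmxBl !mulmxA.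
by rewrite opprD addrA addrAC.
Qed.

End GaugeClasses.

(** Gauge transformations pull back too, so the pullbacks of gauge equivalent connections lie in a
    single orbit and [A] ↦ [f^* A] is well defined. *)
Lemma pullback_class_gauge (R : realType) (S : g2_torus_fibration R) (r : nat)
    (G : set 'M[R[i]]_r) (E : 'rV[R]_4 -> 'rV[R]_4 -> 'M[R[i]]_r) A : compact_group G ->
  let f := @proj4 R S in let L := @tilde_lattice R S in
  pullback_class f L G E (gauge_class (@Z4 R) G E A) =
  gauge_class L G (pullback_bundle f E) (pullback f A).
Proof.
move=> Gc f L; apply/seteqP; split=> [B [A' [u uG <-] [u' u'G <-]]|B [u uG <-]]; last first.
  by exists A; [exact: gauge_class_refl | exists u].
have [su Gu eu] := uG.
have fuG : gauge_transformation L G (pullback_bundle f E) (fun x => u (f x)).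
  split=> [|x|l x /proj4_lattice Zl]; [|exact: Gu|exact: eu].
  exact: (smooth_mx_pullback (@proj4_linear R S) su).
have -> : pullback f (gauge_act u A) = gauge_act (fun x => u (f x)) (pullback f A).
  apply/funext => x; apply/funext => v; rewrite /gauge_act /pullback.
  by rewrite (ddir_mx_pullback (@proj4_linear R S)).
by rewrite (gauge_actM Gc _ fuG u'G); eexists; [exact: gauge_transformationM fuG u'G|].
Qed.

Theorem theorem2 (R : realType) (S : g2_torus_fibration R)
    (phi : kform 3 (totV S) R) (gB : 'M[R]_4)
    (fibration : associative_fibration phi gB)
    (r : nat) (G : set 'M[R[i]]_r) (G_compact : compact_group G)
    (E : 'rV[R]_4 -> 'rV[R]_4 -> 'M[R[i]]_r)
    (E_bundle : bundle (@Z4 R) G E) (E_indec : indecomposable (@Z4 R) E) :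
  let f : totV S -> 'rV[R]_4 := @proj4 R S in
  let bE := pullback_bundle f E in
  let M4 := moduli (@Z4 R) G E (self_dual gB) in
  let M7 phi' := moduli (@tilde_lattice R S) G bE (g2_instanton phi') in
  ((forall A, connection (@Z4 R) G E A -> self_dual gB A ->
      connection (@tilde_lattice R S) G bE (pullback f A) /\
      g2_instanton phi (pullback f A)) /\
   pullback_class f (@tilde_lattice R S) G E @` M4 `<=` M7 phi) /\
  (c2 G E <> 0 ->
   forall dphi : kform 3 (totV S) R,
     transverse_perturbation phi dphi -> M7 (phi \+ dphi) = set0).
Proof.
move=> f bE M4 M7.
have lift A : connection (@Z4 R) G E A -> self_dual gB A ->
    connection (@tilde_lattice R S) G bE (pullback f A) /\ g2_instanton phi (pullback f A).
  move=> cA sdA; have [sA lA _ _] := cA.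
  by split; [exact: pullback_connection | exact: (pullback_instanton fibration sA lA sdA)].
split; [split=> // _ [_ [A [cA sdA] <-] <-]|move=> c20 dphi tr].
  by exists (pullback f A); [exact: lift | rewrite (pullback_class_gauge S E A G_compact)].
exact: (no_instantons fibration G_compact E_bundle c20 tr).
Qed.
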